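(* Let $n\ge1$ be an integer, let $B_1,\dots,B_{n+1}$ be independent standard one-dimensional Brownian motions, let $I_n(t)=B_1(|B_2(\dots|B_{n+1}(t)|\dots)|)$, and let $C$ be a standard Cauchy process independent of $B_1,\dots,B_{n+1}$. The density of the process $C(|I_n(t)|)$, $t>0$, which is given by $$p_{CI}(x,t)=\frac{2}{\pi}\int_0^{+\infty}\frac{s}{s^2+x^2}\,p_n(s,t)\,ds,$$ where $$p_n(x,t)=2^n\int_0^{+\infty}\cdots\int_0^{+\infty}\frac{e^{-\frac{x^2}{2w_1}}}{\sqrt{2\pi w_1}}\,dw_1\,\frac{e^{-\frac{w_1^2}{2w_2}}}{\sqrt{2\pi w_2}}\,dw_2\cdots\frac{e^{-\frac{w_n^2}{2t}}}{\sqrt{2\pi t}}\,dw_n,$$ satisfies the equation $$\frac{\partial^{\frac{1}{2^n}}p}{\partial t^{\frac{1}{2^n}}}=-2^{\frac{1}{2^n}-2}\frac{\partial^2p}{\partial x^2}+\frac{2^{\,n-1+\frac{1}{2^{n+1}}}}{\pi^{3/2}}\,\frac{\Gamma\left(-\frac12\right)}{\Gamma\left(-\frac{1}{2^{n+1}}\right)}\,\frac{t^{-\frac{1}{2^{n+1}}}}{x^2},\qquad x\in\mathbb{R}\setminus\{0\},\ t>0,$$ with initial condition $p(x,0)=\delta(x)$.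
   Context: $\delta$ is the Dirac delta function and $\Gamma$ the Gamma function. The Cauchy process $C(s)$ has density $\frac{s}{\pi(s^2+x^2)}$. For $0<\nu<1$, $\frac{\partial^\nu}{\partial t^\nu}$ is the Caputo fractional derivative in time, $\frac{\partial^\nu u}{\partial t^\nu}(x,t)=\frac{1}{\Gamma(1-\nu)}\int_0^t\frac{1}{(t-\tau)^\nu}\frac{\partial u}{\partial\tau}(x,\tau)\,d\tau$. *)

(* Defs.v *)
From HB Require Import structures.
From mathcomp Require Export all_boot all_order all_algebra.
From mathcomp Require Export all_classical all_reals all_analysis.

Export Order.TTheory GRing.Theory Num.Theory.
Export numFieldNormedType.Exports.

#[export] Set Implicit Arguments.
#[export] Unset Strict Implicit.
#[export] Unset Printing Implicit Defensive.

Global Open Scope classical_set_scope.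
Global Open Scope ring_scope.

Section Analysis.
Context {R : realType}.

Definition euler_integral (z : R) : R :=
  \int[lebesgue_measure]_(t in `]0%R, +oo[) (t `^ (z - 1) * expR (- t)).

(* For z <= 0, z + k is positive, so that euler_integral converges, and the
   functional equation gives Gamma z = Gamma (z + k) / (z (z+1) ... (z+k-1)).
   At the poles 0, -1, -2, ... the value is the junk value 0. *)
Definition Gamma (z : R) : R :=
  if 0 < z then euler_integral z
  else let k := (Num.truncn (- z)).+1 in
       euler_integral (z + k%:R) / \prod_(i < k) (z + i%:R).

(* In this file a function of space and time takes space first: u x t. *)
Definition caputo_integrand (nu : R) (u : R -> R -> R) (x t tau : R) : R :=
  derive1 (u x) tau / (t - tau) `^ nu.

Definition caputo (nu : R) (u : R -> R -> R) (x t : R) : R :=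
  (Gamma (1 - nu))^-1 *
  \int[lebesgue_measure]_(tau in `]0%R, t[) caputo_integrand nu u x t tau.

Definition caputo_exists (nu : R) (u : R -> R -> R) (x t : R) : Prop :=
  (forall tau, 0 < tau -> tau <= t -> derivable (u x) tau 1) /\
  (@lebesgue_measure R).-integrable `]0%R, t[
    (fun tau => (caputo_integrand nu u x t tau)%:E).

(* u(., t) tends to the Dirac mass at 0 as t decreases to 0 *)
Definition initially_dirac0 (u : R -> R -> R) : Prop :=
  forall phi : R -> R, continuous phi ->
    (exists M, forall x, `|phi x| <= M) ->
    (\int[lebesgue_measure]_(x in [set: R]) (phi x * u x t)) @[t --> 0^'+]
      --> phi 0.

Definition heat_kernel (x t : R) : R :=
  expR (- (x ^+ 2 / (2 * t))) / Num.sqrt (2 * pi * t).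

Definition cauchy_kernel (x s : R) : R := s / (pi * (s ^+ 2 + x ^+ 2)).

(* integral of F [:: w_1; ...; w_k] over all w_i in ]0, +oo[ *)
Fixpoint iterated_integral (k : nat) (F : seq R -> R) : R :=
  if k is k'.+1 then
    \int[lebesgue_measure]_(w in `]0%R, +oo[)
      iterated_integral k' (fun ws => F (w :: ws))
  else F [::].

(* With w_0 := x and w_(n+1) := t, the integrand is the product over
   0 <= i <= n of heat_kernel w_i w_(i+1). *)
Definition p_iterated (n : nat) (x t : R) : R :=
  2 ^+ n * iterated_integral n (fun ws =>
    let z := x :: rcons ws t in
    \prod_(0 <= i < n.+1) heat_kernel z`_i z`_i.+1).

Definition p_CI (n : nat) (x t : R) : R :=
  2 / pi * \int[lebesgue_measure]_(s in `]0%R, +oo[)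
             (s / (s ^+ 2 + x ^+ 2) * p_iterated n s t).

End Analysis.

Section Processes.
Context {R : realType} {d : measure_display} {T : measurableType d}.
Variable P : probability T R.

(* Y need not be measurable: it suffices that it agrees almost surely with a
   random variable (path regularity below is only almost sure). *)
Definition has_density (Y : T -> R) (f : R -> R) : Prop :=
  [/\ measurable_fun [set: R] f, forall x, 0 <= f x &
   exists2 Z : {RV P >-> R}, {ae P, forall w, Y w = Z w} &
     forall A : set R, measurable A ->
       distribution P Z A = (\int[lebesgue_measure]_(x in A) (f x)%:E)%E].

(* Each class F i is meant to be a sigma-algebra; as it contains [set: T], the
   product rule for subfamilies is included. *)
Definition independent (I : finType) (F : I -> set (set T)) : Prop :=
  forall E : I -> set T, (forall i, F i (E i)) ->
    fine (P (\bigcap_(i in [set: I]) E i)) = \prod_(i : I) fine (P (E i)).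

(* A process is indexed by R, but only its values at times t >= 0 matter. *)
Definition process_sigma (X : R -> {RV P >-> R}) : set (set T) :=
  <<s [set E | exists2 t, 0 <= t &
         exists2 A : set R, measurable A & E = X t @^-1` A] >>.

Definition independent_processes (I : finType) (X : I -> R -> {RV P >-> R}) :=
  independent (fun i => process_sigma (X i)).

Definition independent_increments (X : R -> {RV P >-> R}) : Prop :=
  forall (m : nat) (t : nat -> R), 0 <= t 0%N ->
    {homo t : i j / (i <= j)%N >-> i <= j} ->
    independent (fun i : 'I_m =>
      [set E | exists2 A : set R, measurable A &
         E = (fun w => X (t i.+1) w - X (t i) w) @^-1` A]).

Definition is_brownian (B : R -> {RV P >-> R}) : Prop :=
  [/\ {ae P, forall w, B 0 w = 0},
      independent_increments B,
      forall s t, 0 <= s -> s < t ->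
        has_density (fun w => B t w - B s w) (fun x => heat_kernel x (t - s)) &
      {ae P, forall w, {within `[0%R, +oo[, continuous (fun t => B t w)}}].

Definition cadlag (f : R -> R) : Prop :=
  (forall t, 0 <= t -> f s @[s --> t^'+] --> f t) /\
  (forall t, 0 < t -> cvg (f s @[s --> t^'-])).

Definition is_cauchy_process (C : R -> {RV P >-> R}) : Prop :=
  [/\ {ae P, forall w, C 0 w = 0},
      independent_increments C,
      forall s t, 0 <= s -> s < t ->
        has_density (fun w => C t w - C s w)
                    (fun x => cauchy_kernel x (t - s)) &
      {ae P, forall w, cadlag (fun t => C t w)}].

(* B 0 stands for B_1, ..., B n for B_(n+1); the innermost argument |t| is t
   for t >= 0. *)
Definition iterated_brownian (n : nat) (B : 'I_n.+1 -> R -> {RV P >-> R})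
    (t : R) (w : T) : R :=
  foldr (fun i s => B i `|s| w) t (enum 'I_n.+1).

End Processes.

(* Main.v *)
From HB Require Import structures.
Require Import Defs.
From mathcomp Require Import measurable_realfun.
From mathcomp Require Import ring lra.

(* Let [S f t] be the mean of [f `|B t|] for a Brownian motion [B]. Conditioning on the
   successive random times gives [p_CI n x t = S^(n+1) h t] with [h s = cauchy_kernel x s].
   By Brownian scaling, [t d/dt (S f) = 1/2 S (s f')], so
     [t d/dt (p_CI n x) = 2^-(n+1) S^(n+1) (s h')].
   Let [g s t] be the density of [`|B t|]. The first-passage identity
     [int_0^t (s / tau) g(s, tau) g(y, t - tau) dtau = 2 g(s + y, t)]
   and the duplication formula show that S intertwines the Abel integral of order 2a with
   that of order a; by induction on n, with nu = 1/2^n,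
     [nu/Gamma(1-nu) int_0^t tau^-1 (t-tau)^-nu S^n(w f)(tau) dtau = 2^(nu-1) S^n f t].
   Apply this with [w f(w) = S (s h') w]: as [s/w g(s,w) = - dg/ds], an integration by parts
   gives [f = h'(0) g(0, .) + S h''], and [h'' = - d^2h/dx^2] because the Cauchy kernel is
   harmonic. The boundary term is the power of t in the equation. *)

(** * Substitution in improper integrals *)

Section change_of_variables.
Context {R : realType}.
Local Notation mu := lebesgue_measure.
Implicit Types (F G : R -> R) (J : set R).

(** The s-derivative of the Cauchy kernel changes sign; it is a difference of two parts, each
    positive and decreasing on s >= 0, and the fractional identity is proved for each part before
    subtracting. Each identity equates a sum of two nonnegative terms with a finite power of t: this
    makes the Abel integral finite and yields the integrability of the Caputo integrand. Finiteness
    of Gamma at 1 - 1/2^k is likewise drawn from Gamma(1/2) by the duplication formula. At x = 0 the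
    kernel 1 / (pi s) is unbounded, so the calculus of bounded functions needs x != 0; in the
    statements on laws the point 0 is a null set. A process at a random time need not be measurable,
    and C has jumps. The time is rounded up to a grid, where countably many fixed times occur; right
    continuity and continuous test functions carry the law to the limit. Independence from the
    processes not yet used is part of the induction. *)

Definition itvn n : set R := `[n.+2%:R^-1, n.+2%:R]%classic.

Lemma itv0y_bigcup :
  `]0, +oo[%classic = \bigcup_n itvn n.
Proof.
apply/seteqP; split => [x|x [n _]] /=; rewrite !in_itv/= ?andbT.
- move=> x0.
  have Vx0 : 0 < x^-1 by rewrite invr_gt0.
  exists (maxn (Num.truncn x^-1) (Num.truncn x)) => //=.
  rewrite /itvn/= in_itv/= -[x in _ <= x <= _]invrK lef_pV2 ?posrE//.
  by apply/andP; split; [|rewrite invrK]; rewrite ltW//;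
     apply: lt_le_trans (truncnS_gt _) _; rewrite ler_nat !ltnS;
     apply: leqW; rewrite ?leq_maxl ?leq_maxr.
- by rewrite /itvn/= in_itv/= => /andP[+ _]; apply: lt_le_trans; rewrite invr_gt0.
Qed.

Lemma inv_le_nat n : n.+2%:R^-1 <= n.+2%:R :> R.
Proof.
by apply: (@le_trans _ _ 1); [rewrite invf_le1// ler1n|rewrite ler1n].
Qed.

Lemma nondecreasing_itv_inv_nat :
  nondecreasing_seq itvn.
Proof.
move=> m n mn; apply/subsetPset => x; rewrite /itvn/= !in_itv/= => /andP[ax xb].
apply/andP; split; [apply: le_trans ax|apply: (le_trans xb)].
- by rewrite lef_pV2 ?posrE// ler_nat !ltnS.
- by rewrite ler_nat !ltnS.
Qed.

Lemma is_derive_continuous_for F (x y : R) : is_derive x 1 F y -> {for x, continuous F}.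
Proof.
by move=> [dF _]; apply/differentiable_continuous; rewrite -derivable1_diffP.
Qed.

(** Monotone convergence along two exhaustions reduces an improper substitution to compact
    intervals; the increasing and the decreasing case share this limit. *)
Lemma exhaust_substitution F G (D : R -> R) J (K : (set R)^nat) :
  (forall x : R, 0 < x -> {for x, continuous F}) ->
  (forall x : R, 0 < x -> {for x, continuous D}) ->
  (forall x : R, 0 < x -> 0 <= D x) ->
  (forall x : R, 0 < x -> J (F x)) ->
  (forall y, J y -> {for y, continuous G}) ->
  (forall y, J y -> 0 <= G y) ->
  nondecreasing_seq K -> (forall n, measurable (K n)) -> J = \bigcup_n K n ->
  (forall n, \int[mu]_(y in K n) (G y)%:E =
    \int[mu]_(x in itvn n) (G (F x) * D x)%:E)%E ->
  (\int[mu]_(y in J) (G y)%:E =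
    \int[mu]_(x in `]0%R, +oo[) (G (F x) * D x)%:E)%E.
Proof.
move=> cF cD D0 FJ cG G0 ndK mK JK GK.
have in_gt0 n x : itvn n x -> 0 < x.
  by rewrite /itvn/= in_itv/= => /andP[+ _]; apply: lt_le_trans; rewrite invr_gt0.
have KJ n : K n `<=` J by move=> y Ky; rewrite JK; exists n.
rewrite itv0y_bigcup JK.
transitivity (limn (fun n => \int[mu]_(y in K n) (G y)%:E)%E).
  apply/esym/cvg_lim => //; apply: ge0_nondecreasing_set_cvg_integral => //.
  - move=> n; apply/measurable_EFinP.
    apply: (subspace_continuous_measurable_fun (mK n)).
    by apply: continuous_in_subspaceT => y /set_mem/(KJ n); exact: cG.
  - by move=> n y /(KJ n)/G0; rewrite lee_fin.
under eq_fun do rewrite GK.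
apply/cvg_lim => //; apply: ge0_nondecreasing_set_cvg_integral => //.
- exact: nondecreasing_itv_inv_nat.
- by move=> n; exact: measurable_itv.
- move=> n; apply/measurable_EFinP.
  have : {within itvn n, continuous (fun x => G (F x) * D x)}.
    apply: continuous_in_subspaceT => x /set_mem/(in_gt0 n) x0.
    apply: cvgM; last exact: cD.
    by apply: continuous_comp; [exact: cF|apply: cG; exact: FJ].
  by apply: subspace_continuous_measurable_fun; exact: measurable_itv.
- move=> n x /(in_gt0 n) x0; rewrite lee_fin mulr_ge0 ?D0//.
  by apply: G0; exact: FJ.
Qed.

Lemma bigcup_image_itv F J :
  (forall x : R, 0 < x -> J (F x)) ->
  (forall y, J y -> exists2 x, 0 < x & F x = y) ->
  J = \bigcup_n (F @` itvn n).
Proof.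
move=> FJ JF; apply/seteqP; split => [y /JF[x x0 <-]|y [n _] [x xn <-]].
- have : `]0, +oo[%classic x by rewrite /= in_itv/= x0.
  by rewrite itv0y_bigcup => -[n _ xn]; exists n => //; exists x.
- apply: FJ; move: xn; rewrite /itvn/= in_itv/= => /andP[+ _].
  by apply: lt_le_trans; rewrite invr_gt0.
Qed.

(** [J] is given as the image of the half-line rather than as an interval, so that half-lines and
    the whole line are both covered. By the intermediate value theorem the image of a compact
    interval is one too, and there the compact substitution rule applies. *)
Lemma ge0_substitution_incr F (F' : R -> R) G J :
  (forall x : R, 0 < x -> is_derive x 1 F (F' x)) ->
  (forall x : R, 0 < x -> {for x, continuous F'}) ->
  (forall x : R, 0 < x -> 0 <= F' x) ->
  (forall x y : R, 0 < x -> x < y -> F x < F y) ->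
  (forall x : R, 0 < x -> J (F x)) ->
  (forall y, J y -> exists2 x, 0 < x & F x = y) ->
  (forall y, J y -> {for y, continuous G}) ->
  (forall y, J y -> 0 <= G y) ->
  (\int[mu]_(y in J) (G y)%:E =
    \int[mu]_(x in `]0%R, +oo[) (G (F x) * F' x)%:E)%E.
Proof.
move=> dF cF' F'0 incF FJ JF cG G0.
have cF x : 0 < x -> {for x, continuous F}.
  by move=> /dF/is_derive_continuous_for.
have leF x y : 0 < x -> x <= y -> F x <= F y.
  move=> x0; rewrite le_eqVlt => /predU1P[->//|xy]; exact/ltW/incF.
have in_gt0 n (x : R) : n.+2%:R^-1 <= x -> 0 < x.
  by apply: lt_le_trans; rewrite invr_gt0.
have KE n : F @` itvn n =
    `[F n.+2%:R^-1, F n.+2%:R]%classic.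
  apply/seteqP; split => [y [x + <-]|y]; rewrite /itvn/= !in_itv/=.
    by move=> /andP[ax xb]; rewrite !leF// (in_gt0 n).
  have cFn : {within `[n.+2%:R^-1, n.+2%:R], continuous F}.
    apply: continuous_in_subspaceT => x; rewrite inE/= in_itv/= => /andP[ax _].
    by apply: cF; exact: (in_gt0 n).
  move=> /andP[ay yb].
  have [] := IVT (inv_le_nat n) cFn (v := y).
    by rewrite minEle maxEle leF// ?invr_gt0// ?inv_le_nat// ay.
  by move=> x; rewrite in_itv/= => xn Fx; exists x.
have KJ n : `[F n.+2%:R^-1, F n.+2%:R] `<=` J.
  rewrite -KE => _ [x + <-]; rewrite /itvn/= in_itv/= => /andP[ax _].
  by apply: FJ; exact: (in_gt0 n).
apply: (@exhaust_substitution F G F' J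
  (fun n => F @` itvn n)) => //.
- move=> m n mn; apply/subsetPset; apply: image_subset; apply/subsetPset.
  exact: nondecreasing_itv_inv_nat.
- by move=> n; rewrite KE; exact: measurable_itv.
- exact: bigcup_image_itv.
move=> n; rewrite KE.
have derE x : 0 < x -> derive1 F x = F' x by move=> /dF dFx; rewrite derive1E derive_val.
have F'E (x : R) : 0 < x -> derive1 F z @[z --> x] --> F' x.
  move=> x0; apply: (@cvg_trans _ (F' z @[z --> x])); last exact: cF'.
  by apply: near_eq_cvg; near=> z; rewrite derE//; near: z; exact: lt_nbhsr.
have a0 : 0 < n.+2%:R^-1 :> R by rewrite invr_gt0.
rewrite /itvn integration_by_substitution_increasing ?inv_le_nat//.
- apply: eq_integral => x; rewrite inE/= in_itv/= => /andP[ax _].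
  by rewrite fctE /= derE//; exact: lt_le_trans ax.
- move=> x y; rewrite !in_itv/= => /andP[ax _] _; apply: incF.
  exact: lt_le_trans ax.
- move=> x; rewrite in_itv/= => /andP[ax _].
  have x0 := lt_trans a0 ax.
  by rewrite /continuous_at derE//; exact: F'E.
- by apply/cvg_ex; exists (F' n.+2%:R^-1); apply: cvg_at_right_filter; exact: F'E.
- by apply/cvg_ex; exists (F' n.+2%:R); apply: cvg_at_left_filter; exact: F'E.
- split.
  + move=> x; rewrite in_itv/= => /andP[ax _].
    by have [] := dF _ (lt_trans a0 ax).
  + by apply: cvg_at_right_filter; exact: cF.
  + by apply: cvg_at_left_filter; exact: cF.
- by apply: continuous_in_subspaceT => y /set_mem/KJ; exact: cG.
Unshelve. all: by end_near. Qed.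

Lemma ge0_substitution_decr F (F' : R -> R) G J :
  (forall x : R, 0 < x -> is_derive x 1 F (- F' x)) ->
  (forall x : R, 0 < x -> {for x, continuous F'}) ->
  (forall x : R, 0 < x -> 0 <= F' x) ->
  (forall x y : R, 0 < x -> x < y -> F y < F x) ->
  (forall x : R, 0 < x -> J (F x)) ->
  (forall y, J y -> exists2 x, 0 < x & F x = y) ->
  (forall y, J y -> {for y, continuous G}) ->
  (forall y, J y -> 0 <= G y) ->
  (\int[mu]_(y in J) (G y)%:E =
    \int[mu]_(x in `]0%R, +oo[) (G (F x) * F' x)%:E)%E.
Proof.
move=> dF cF' F'0 decF FJ JF cG G0.
have cF x : 0 < x -> {for x, continuous F}.
  by move=> /dF/is_derive_continuous_for.
have leF x y : 0 < x -> x <= y -> F y <= F x.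
  move=> x0; rewrite le_eqVlt => /predU1P[->//|xy]; exact/ltW/decF.
have in_gt0 n (x : R) : n.+2%:R^-1 <= x -> 0 < x.
  by apply: lt_le_trans; rewrite invr_gt0.
have KE n : F @` itvn n =
    `[F n.+2%:R, F n.+2%:R^-1]%classic.
  apply/seteqP; split => [y [x + <-]|y]; rewrite /itvn/= !in_itv/=.
    by move=> /andP[ax xb]; rewrite !leF// (in_gt0 n).
  have cFn : {within `[n.+2%:R^-1, n.+2%:R], continuous F}.
    apply: continuous_in_subspaceT => x; rewrite inE/= in_itv/= => /andP[ax _].
    by apply: cF; exact: (in_gt0 n).
  move=> /andP[ay yb].
  have [] := IVT (inv_le_nat n) cFn (v := y).
    have ba : F n.+2%:R <= F n.+2%:R^-1 by rewrite leF ?invr_gt0// inv_le_nat.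
    by rewrite (min_idPr ba) (max_idPl ba) ay.
  by move=> x; rewrite in_itv/= => xn Fx; exists x.
have KJ n : `[F n.+2%:R, F n.+2%:R^-1] `<=` J.
  rewrite -KE => _ [x + <-]; rewrite /itvn/= in_itv/= => /andP[ax _].
  by apply: FJ; exact: (in_gt0 n).
apply: (@exhaust_substitution F G F' J
  (fun n => F @` itvn n)) => //.
- move=> m n mn; apply/subsetPset; apply: image_subset; apply/subsetPset.
  exact: nondecreasing_itv_inv_nat.
- by move=> n; rewrite KE; exact: measurable_itv.
- exact: bigcup_image_itv.
move=> n; rewrite KE.
have derE x : 0 < x -> derive1 F x = - F' x by move=> /dF dFx; rewrite derive1E derive_val.
have F'E (x : R) : 0 < x -> derive1 F z @[z --> x] --> - F' x.
  move=> x0; apply: (@cvg_trans _ ((- F' z) @[z --> x])).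
    by apply: near_eq_cvg; near=> z; rewrite derE//; near: z; exact: lt_nbhsr.
  exact: cvgN (cF' x x0).
have a0 : 0 < n.+2%:R^-1 :> R by rewrite invr_gt0.
rewrite /itvn integration_by_substitution_decreasing ?inv_le_nat//.
- apply: eq_integral => x; rewrite inE/= in_itv/= => /andP[ax _].
  by rewrite !fctE derE ?opprK//; exact: lt_le_trans ax.
- move=> x y; rewrite !in_itv/= => _ /andP[ax _]; apply: decF.
  exact: lt_le_trans ax.
- move=> x; rewrite in_itv/= => /andP[ax _].
  have x0 := lt_trans a0 ax.
  by rewrite /continuous_at derE//; exact: F'E.
- by apply/cvg_ex; exists (- F' n.+2%:R^-1); apply: cvg_at_right_filter; exact: F'E.
- by apply/cvg_ex; exists (- F' n.+2%:R); apply: cvg_at_left_filter; exact: F'E.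
- split.
  + move=> x; rewrite in_itv/= => /andP[ax _].
    by have [] := dF _ (lt_trans a0 ax).
  + by apply: cvg_at_right_filter; exact: cF.
  + by apply: cvg_at_left_filter; exact: cF.
- by apply: continuous_in_subspaceT => y /set_mem/KJ; exact: cG.
Unshelve. all: by end_near. Qed.


(** Here [f] is merely measurable, so the substitution rules above, which ask for continuity, do not
    apply. Instead c times the push-forward of Lebesgue measure agrees with Lebesgue measure on
    half-open intervals, hence everywhere. *)
Lemma ge0_integral_affine (f : R -> \bar R) (a c : R) :
  0 < c -> measurable_fun [set: R] f -> (forall x, 0 <= f x)%E ->
  (\int[mu]_x f x = c%:E * \int[mu]_x f (a + c * x)%R)%E.
Proof.
move=> c0 mf f0.
pose phi (x : measurableTypeR R) : measurableTypeR R := a + c * x.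
have mphi : measurable_fun [set: measurableTypeR R] phi.
  by apply: measurable_funD => //; apply: measurable_funM.
have c0' := ltW c0.
have <- := @ge0_integral_pushforward _ _ _ _ R phi mphi lebesgue_measure setT f
  measurableT mf (fun x _ => f0 x).
rewrite -(ge0_integral_mscale _ measurableT (NngNum c0'))//.
apply: eq_measure_integral => A mA _; apply: lebesgue_measure_unique => //.
move=> _ [[x y]] _ <-.
  rewrite [RHS](_ : _ = c%:E * lebesgue_measure (phi @^-1` `]x, y]))%E//.
  have -> : phi @^-1` `]x, y] = `](x - a) / c, (y - a) / c]%classic.
    apply/seteqP; split => z /=; rewrite !in_itv/= ltr_pdivrMr// ler_pdivlMr//;
      by rewrite ltrBlDl lerBrDl [z * c]mulrC.
  rewrite !lebesgue_measure_itv/= !lte_fin ltr_pM2r ?invr_gt0// ltrD2r.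
  case: ifPn => _; last by rewrite mule0.
  by rewrite -!EFinB -EFinM; congr EFin; field; rewrite gt_eqF.
Qed.

End change_of_variables.

(** * Measurability of arithmetic expressions *)

Section measurability.
Context d (T : measurableType d) {R : realType}.
Implicit Types (D : set T) (f : T -> R).

Lemma measurable_fun_invr D f :
  measurable_fun D f -> measurable_fun D (fun x => (f x)^-1).
Proof.
(* Squaring makes the base nonnegative, so that the power -1 is the inverse of the square; where [f]
   vanishes both sides are 0. *)
move=> mf; have -> : (fun x => (f x)^-1) = (fun x => f x * (f x ^+ 2) `^ (-1)).
  apply/funext => x; rewrite powR_inv1 ?sqr_ge0//.
  have [->|fx0] := eqVneq (f x) 0; first by rewrite invr0 mul0r.
  by rewrite expr2 invfM mulrA divff// mul1r.
apply: measurable_funM => //.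
apply: (measurableT_comp (measurable_powR _)); exact: measurable_funX.
Qed.

Lemma measurable_fun_expR D f :
  measurable_fun D f -> measurable_fun D (fun x => expR (f x)).
Proof. by move=> mf; apply: measurableT_comp. Qed.

Lemma measurable_fun_sqrtr D f :
  measurable_fun D f -> measurable_fun D (fun x => Num.sqrt (f x)).
Proof.
move=> mf; apply: measurableT_comp => //.
by apply: continuous_measurable_fun; exact: sqrt_continuous.
Qed.

Lemma measurable_fun_powRl D f (p : R) :
  measurable_fun D f -> measurable_fun D (fun x => f x `^ p).
Proof. by move=> mf; apply: (measurableT_comp (measurable_powR _)). Qed.

Lemma measurable_fun_oppr D f :
  measurable_fun D f -> measurable_fun D (fun x => - f x).
Proof. by move=> mf; apply: measurableT_comp. Qed.

Lemma measurable_fun_normr D f :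
  measurable_fun D f -> measurable_fun D (fun x => `|f x|).
Proof. by move=> mf; apply: measurableT_comp => //; exact: normr_measurable. Qed.

End measurability.

Ltac mfun := repeat first
  [ assumption | exact: measurable_cst | exact: measurable_id
  | exact: measurable_fst | exact: measurable_snd
  | apply: measurable_fun_invr | apply: measurable_fun_expR
  | apply: measurable_fun_sqrtr | apply: measurable_fun_powRl
  | apply: measurable_fun_oppr | apply: measurable_fun_normr
  | apply: measurable_funX | apply: measurable_funM | apply: measurable_funD
  | apply: measurable_fun_ltr | apply: measurable_fun_ler | apply: measurable_and
  | apply: measurable_fun_ifT
  | apply: measurable_funTS ].

Lemma ge0_integral_mulrEFin d (T : measurableType d) (R : realType)
    (m : {measure set T -> \bar R}) (D : set T) (g : T -> R) (c : R) :
  measurable D -> measurable_fun D g -> (forall x, D x -> 0 <= g x) -> 0 <= c ->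
  (\int[m]_(x in D) (c * g x)%:E = c%:E * \int[m]_(x in D) (g x)%:E)%E.
Proof.
move=> mD mg g0 c0; under eq_integral do rewrite EFinM.
by rewrite ge0_integralZl//; apply/measurable_EFinP.
Qed.

(** * The Cauchy-Schlomilch integral *)

Section gaussian_integrals.
Context {R : realType}.
Local Notation mu := lebesgue_measure.

Lemma itv0yE (x : R) : `]0, +oo[%classic x = (0 < x) :> Prop.
Proof. by rewrite /= in_itv/= andbT. Qed.

Lemma is_derive_invr (x : R) : x != 0 ->
  is_derive x 1 (fun r : R => r^-1) (- (x ^+ 2)^-1).
Proof.
move=> x0; have := is_deriveV x0 (is_derive_id x (1 : R)).
by rewrite /GRing.scale/= mulr1.
Qed.

(** The value does not depend on b. The inversion r -> b / (a r) changes the sign of F r = a r - b /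
    r, hence a times the integral equals the integral with weight b / r^2. Adding up gives the
    weight F' = a + b / r^2, and F maps ]0, +oo[ onto the real line, so 2 a times the integral is
    the full Gaussian integral. *)
Lemma integral_gauss_schlomilch (a b : R) : 0 < a -> 0 <= b ->
  (\int[mu]_(r in `]0%R, +oo[) (gauss_fun (a * r - b / r))%:E =
    (Num.sqrt pi / (2 * a))%:E)%E.
Proof.
move=> a0; have an0 : a != 0 by rewrite gt_eqF.
have mgc (c : R) : measurable_fun [set: R] (fun r : R => gauss_fun (a * r - c / r)).
  by rewrite /gauss_fun; mfun.
(* For b = 0 the map F is not onto the real line; a plain scaling is enough. *)
rewrite le_eqVlt => /predU1P[<-|b0].
  have dF (x : R) : 0 < x -> is_derive x 1 (fun r => a * r) a.
    by move=> _; apply: is_derive_eq; rewrite /GRing.scale/=; ring.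
  have := integral0y_gauss (R := R).
  rewrite -integral_itv_obnd_cbnd; last first.
    by apply/measurable_EFinP; rewrite /gauss_fun; mfun.
  rewrite (@ge0_substitution_incr _ _ (cst a) _ _ dF)//.
  - under eq_integral do rewrite mulrC.
    rewrite ge0_integral_mulrEFin//=; last 3 first.
    + by rewrite /gauss_fun; mfun.
    + by move=> x _; rewrite gauss_fun_ge0.
    + by rewrite ltW.
    move=> H; under eq_integral do rewrite mul0r subr0.
    rewrite (_ : Num.sqrt pi / (2 * a) = a^-1 * (Num.sqrt pi / 2)); last by field.
    rewrite EFinM -H muleA -EFinM mulVf// mul1e.
    by [].
  - by move=> x x0; exact: cvg_cst.
  - by move=> x _; exact: ltW.
  - by move=> x y x0 xy; rewrite ltr_pM2l.
  - by move=> x x0; rewrite itv0yE mulr_gt0.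
  - move=> y; rewrite itv0yE => y0; exists (y / a); first by rewrite divr_gt0.
    by rewrite mulrC divfK// gt_eqF.
  - by move=> y _; exact: continuous_gauss_fun.
  - by move=> y _; exact: gauss_fun_ge0.
pose F (r : R) := a * r - b / r.
have dF (r : R) : 0 < r -> is_derive r 1 F (a + b / r ^+ 2).
  move=> r0; have rn0 : r != 0 by rewrite gt_eqF.
  have dV := is_derive_invr rn0.
  rewrite /F; apply: is_derive_eq; rewrite /GRing.scale/=.
  by field.
have dF2 (r : R) : 0 < r -> is_derive r 1 (fun z => b / a / z) (- (b / a / r ^+ 2)).
  move=> r0; have rn0 : r != 0 by rewrite gt_eqF.
  have dV := is_derive_invr rn0.
  apply: is_derive_eq; rewrite /GRing.scale/=.
  by field; apply/andP.
have cV (d x : R) : 0 < x -> {for x, continuous (fun r : R => d / r ^+ 2)}.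
  move=> x0; apply: cvgM; first exact: cvg_cst.
  by apply: cvgV; [rewrite expf_neq0// gt_eqF|exact: exprn_continuous].
have cF (x : R) : 0 < x -> {for x, continuous (fun r => gauss_fun (F r))}.
  move=> x0; apply: continuous_comp; last exact: continuous_gauss_fun.
  exact: is_derive_continuous_for (dF _ x0).
set I := (X in X = _).
have I1 : (I * a%:E = \int[mu]_(r in `]0%R, +oo[)
    (gauss_fun (F r) * (b / r ^+ 2))%:E)%E.
  rewrite /I muleC -ge0_integral_mulrEFin//=; last 3 first.
  + by apply: measurable_funTS; exact: mgc.
  + by move=> x _; rewrite gauss_fun_ge0.
  + by rewrite ltW.
  under eq_integral do rewrite mulrC.
  rewrite (@ge0_substitution_decr _ _ (fun r => b / a / r ^+ 2) _ _ dF2).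
  - apply: eq_integral => x; rewrite inE itv0yE => x0.
    congr EFin; rewrite (_ : gauss_fun (F (b / a / x)) = gauss_fun (F x)).
      by field; rewrite an0/= gt_eqF.
    rewrite /gauss_fun -[in RHS]sqrrN; congr (expR (- (_ ^+ 2))).
    by rewrite /F; field; rewrite an0/= !gt_eqF.
  - exact: cV.
  - by move=> x x0; rewrite !divr_ge0 ?sqr_ge0 ?ltW.
  - by move=> x y x0 xy; rewrite ltr_pM2l ?divr_gt0// ltf_pV2 ?posrE// (lt_trans x0).
  - by move=> x x0; rewrite itv0yE !divr_gt0.
  - move=> y; rewrite itv0yE => y0; exists (b / a / y); first by rewrite !divr_gt0.
    by field; rewrite an0/= !gt_eqF.
  - move=> y; rewrite itv0yE => y0; apply: cvgM; [exact: cF|exact: cvg_cst].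
  - by move=> y _; rewrite mulr_ge0 ?gauss_fun_ge0// ltW.
have := integralT_gauss (R := R).
rewrite (@ge0_substitution_incr _ _ (fun r => a + b / r ^+ 2) _ _ dF).
- under eq_integral do rewrite mulrDr EFinD.
  rewrite ge0_integralD//=; last 4 first.
  + by move=> x _; rewrite lee_fin mulr_ge0 ?gauss_fun_ge0// ltW.
  + by apply/measurable_EFinP; rewrite /F; mfun; exact: mgc.
  + by move=> x; rewrite in_itv/= andbT => x0; rewrite lee_fin mulr_ge0 ?gauss_fun_ge0// divr_ge0 ?sqr_ge0 ?ltW.
  + by apply/measurable_EFinP; rewrite /F; mfun; exact: mgc.
  rewrite -I1.
  under [X in (X + _)%E]eq_integral do rewrite mulrC.
  rewrite ge0_integral_mulrEFin//=; last 3 first.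
  + by apply: measurable_funTS; exact: mgc.
  + by move=> x _; rewrite gauss_fun_ge0.
  + by rewrite ltW.
  rewrite -/I [X in (X + _)%E]muleC -mule2n -mule_natl => H.
  rewrite [_ / _]mulrC EFinM -H [(I * _)%E]muleC !muleA -!EFinM.
  by rewrite (_ : (2 * a)^-1 * 2 * a = 1) ?mul1e//; field.
- by move=> x x0; apply: cvgD; [exact: cvg_cst|exact: cV].
- by move=> x x0; rewrite addr_ge0// ?divr_ge0 ?sqr_ge0 ?ltW.
- move=> x y x0 xy; rewrite /F ltrD// ?ltr_pM2l// ltrN2 ltr_pM2l//.
  by rewrite ltf_pV2 ?posrE// (lt_trans x0).
- by [].
- move=> y _.
  (* The preimage of y is the positive root of a r^2 - y r - b = 0, whose discriminant is D^2. *)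
  pose D := Num.sqrt (y ^+ 2 + 4 * a * b).
  have D2 : D ^+ 2 = y ^+ 2 + 4 * a * b.
    by rewrite sqr_sqrtr// addr_ge0 ?sqr_ge0// ?mulr_ge0 ?ltW.
  have yD : 0 < y + D.
    have : `|y| < D.
      rewrite -sqrtr_sqr ltr_sqrt ?ltrDl ?mulr_gt0//.
      by rewrite ltr_wpDl ?sqr_ge0// ?mulr_gt0.
    by have := ler_norm (- y); rewrite normrN => h1 h2; lra.
  exists ((y + D) / (2 * a)); first by rewrite divr_gt0 ?mulr_gt0.
  have yDn0 : y + D != 0 by rewrite gt_eqF.
  rewrite /F.
  have -> : b = (D ^+ 2 - y ^+ 2) / (4 * a) by rewrite D2; field.
  by field; rewrite ?yDn0 ?an0.
- by move=> y _; exact: continuous_gauss_fun.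
- by move=> y _; exact: gauss_fun_ge0.
Qed.

End gaussian_integrals.

Ltac field0 := field; repeat (apply/andP; split); try done; rewrite gt_eqF //.

(** * Heat kernel and Gamma function *)

Section heat.
Context {R : realType}.
Local Notation mu := lebesgue_measure.

Lemma heat_kernel_ge0 (x t : R) : 0 <= heat_kernel x t.
Proof. by rewrite /heat_kernel divr_ge0 ?expR_ge0 ?sqrtr_ge0. Qed.

Lemma sqrt2pi_gt0 (t : R) : 0 < t -> 0 < Num.sqrt (2 * pi * t).
Proof. by move=> t0; rewrite sqrtr_gt0 !mulr_gt0 ?pi_gt0. Qed.

Lemma heat_kernel_le0 (x t : R) : t <= 0 -> heat_kernel x t = 0.
Proof.
move=> t0; rewrite /heat_kernel ler0_sqrtr ?invr0 ?mulr0//.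
by rewrite mulr_ge0_le0// mulr_ge0// pi_ge0.
Qed.

Lemma heat_kernel_le_center (x s : R) : heat_kernel x s <= heat_kernel 0 s.
Proof.
rewrite /heat_kernel; have [s0|s0] := ltP 0 s; last first.
  by rewrite ler0_sqrtr ?invr0 ?mulr0// mulr_ge0_le0// mulr_ge0// pi_ge0.
rewrite ler_pM2r ?invr_gt0 ?sqrt2pi_gt0// ler_expR lerN2 expr0n/= mul0r.
by rewrite divr_ge0 ?sqr_ge0// mulr_ge0// ltW.
Qed.

Lemma measurable_heat_kernel d (T : measurableType d) (D : set T) (f g : T -> R) :
  measurable_fun D f -> measurable_fun D g ->
  measurable_fun D (fun x => heat_kernel (f x) (g x)).
Proof. by move=> mf mg; rewrite /heat_kernel; mfun. Qed.

Lemma continuous_heat_kernel (x t : R) : 0 < t -> {for t, continuous (heat_kernel x)}.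
Proof.
move=> t0; apply: cvgM.
  apply: continuous_comp; last exact: continuous_expR.
  apply: cvgN; apply: cvgM; first exact: cvg_cst.
  apply: cvgV; first by rewrite mulf_neq0// gt_eqF.
  by apply: cvgM; [exact: cvg_cst|exact: cvg_id].
apply: cvgV; first by rewrite gt_eqF// sqrt2pi_gt0.
apply: continuous_comp; last exact: sqrt_continuous.
by apply: cvgM; [exact: cvg_cst|exact: cvg_id].
Qed.

(* The exponent is a square up to a constant:
   [s^2 (1 + r^2) + y^2 (1 + r^-2) = (s + y)^2 + (s r - y / r)^2]. *)
Lemma heat_kernel_convolution_integrand (s y t r : R) :
  0 < t -> 0 < r ->
  s / (t / (1 + r ^+ 2)) * heat_kernel s (t / (1 + r ^+ 2)) *
    heat_kernel y (t - t / (1 + r ^+ 2)) *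
    (2 * t * r / (1 + r ^+ 2) ^+ 2) =
  s / (pi * t) * expR (- ((s + y) ^+ 2 / (2 * t))) *
    gauss_fun (s / Num.sqrt (2 * t) * r - y / Num.sqrt (2 * t) / r).
Proof.
move=> t0 r0.
have u0 : 0 < 1 + r ^+ 2 by rewrite addr_gt0// exprn_gt0.
have un0 : 1 + r ^+ 2 != 0 by rewrite gt_eqF.
have tn0 : t != 0 by rewrite gt_eqF.
have rn0 : r != 0 by rewrite gt_eqF.
have pin0 : pi != 0 :> R by rewrite gt_eqF// pi_gt0.
rewrite /gauss_fun /heat_kernel.
have -> : t - t / (1 + r ^+ 2) = t * r ^+ 2 / (1 + r ^+ 2) by field.
set A := Num.sqrt _; set B := Num.sqrt (2 * pi * _); set c := Num.sqrt (2 * t).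
have c2 : c ^+ 2 = 2 * t by rewrite sqr_sqrtr// ltW// mulr_gt0.
have cn0 : c != 0 by rewrite gt_eqF// sqrtr_gt0 mulr_gt0.
have AB : A * B = 2 * pi * t * r / (1 + r ^+ 2).
  rewrite /A /B -sqrtrM; last by rewrite !mulr_ge0 ?pi_ge0 ?invr_ge0 ?ltW.
  rewrite [X in Num.sqrt X](_ : _ = (2 * pi * t * r / (1 + r ^+ 2)) ^+ 2); last by field.
  by rewrite sqrtr_sqr ger0_norm// !mulr_ge0 ?pi_ge0 ?invr_ge0 ?ltW.
have A0 : A != 0 by rewrite gt_eqF// sqrt2pi_gt0// divr_gt0.
have B0 : B != 0 by rewrite gt_eqF// sqrt2pi_gt0// divr_gt0// mulr_gt0// exprn_gt0.
rewrite -[RHS]mulrA -expRD.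
have -> : - ((s + y) ^+ 2 / (2 * t)) - (s / c * r - y / c / r) ^+ 2 =
   - (s ^+ 2 / (2 * (t / (1 + r ^+ 2)))) - (y ^+ 2 / (2 * (t * r ^+ 2 / (1 + r ^+ 2)))).
  rewrite (_ : (s / c * r - y / c / r) ^+ 2 = (s * r - y / r) ^+ 2 / c ^+ 2).
    by rewrite c2; field0.
  by field0.
rewrite expRD; set e1 := expR _; set e2 := expR _.
have -> : s / (t / (1 + r ^+ 2)) * (e1 / A) * (e2 / B) * (2 * t * r / (1 + r ^+ 2) ^+ 2)
  = s * e1 * e2 * 2 * r / (1 + r ^+ 2) / (A * B).
  by field0.
by rewrite AB; move: pin0; move: (pi : R) => q qn0; field0.
Qed.

(** [s / tau * heat_kernel s tau] is the density of the first time at which a Brownian motion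
    reaches s, and a path from 0 to s + y must pass s: this is the strong Markov property at that
    time. Analytically, tau = t / (1 + r^2) turns the integrand into that of
    [integral_gauss_schlomilch]. *)
Lemma heat_kernel_first_passage (s y t : R) : 0 < s -> 0 <= y -> 0 < t ->
  (\int[mu]_(tau in `]0%R, t[) (s / tau * heat_kernel s tau *
     heat_kernel y (t - tau))%:E = (heat_kernel (s + y) t)%:E)%E.
Proof.
move=> s0 y0 t0.
pose F (r : R) := t / (1 + r ^+ 2).
pose F' (r : R) := 2 * t * r / (1 + r ^+ 2) ^+ 2.
have u0 (r : R) : 0 < 1 + r ^+ 2 by rewrite ltr_wpDr// sqr_ge0.
have un0 (r : R) : 1 + r ^+ 2 != 0 by rewrite gt_eqF.
have dF (r : R) : 0 < r -> is_derive r 1 F (- F' r).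
  move=> r0; have := @is_deriveV _ (fun r => 1 + r ^+ 2) r _ 1 (un0 r) _.
  move=> /(_ (2 * r) _) H.
  have dV : is_derive r 1 (fun r => (1 + r ^+ 2)^-1) (- (1 + r ^+ 2) ^- 2 *: (2 * r)).
    by apply: H; apply: is_derive_eq; rewrite /GRing.scale/=; ring.
  by rewrite /F; apply: is_derive_eq; rewrite /F' /GRing.scale/=; field.
have cX (r : R) : {for r, continuous (fun r : R => 1 + r ^+ 2)}.
  by apply: cvgD; [exact: cvg_cst|exact: exprn_continuous].
rewrite (@ge0_substitution_decr _ F F' (fun tau => s / tau * heat_kernel s tau *
     heat_kernel y (t - tau)) `]0, t[%classic dF).
- transitivity (\int[mu]_(r in `]0%R, +oo[) ((s / (pi * t) * expR (- ((s + y) ^+ 2 / (2 * t)))) *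
    gauss_fun (s / Num.sqrt (2 * t) * r - y / Num.sqrt (2 * t) / r))%:E)%E.
    apply: eq_integral => r; rewrite inE itv0yE => r0.
    by rewrite /F /F' heat_kernel_convolution_integrand.
  have c0 : 0 < Num.sqrt (2 * t) by rewrite sqrtr_gt0 mulr_gt0.
  rewrite ge0_integral_mulrEFin//; last 3 first.
  + by rewrite /gauss_fun; mfun.
  + by move=> x _; exact: gauss_fun_ge0.
  + by rewrite mulr_ge0 ?expR_ge0// divr_ge0 ?mulr_ge0 ?pi_ge0// ltW.
  rewrite integral_gauss_schlomilch ?divr_ge0 ?divr_gt0 ?(ltW c0)//.
  rewrite -EFinM; congr EFin; rewrite /heat_kernel.
  set e := expR _; set c := Num.sqrt (2 * t) in c0 *.
  set p := Num.sqrt pi.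
  have -> : Num.sqrt (2 * pi * t) = p * c.
    by rewrite -sqrtrM ?pi_ge0//; congr Num.sqrt; ring.
  have p0 : 0 < p by rewrite sqrtr_gt0 pi_gt0.
  have c2 : c ^+ 2 = 2 * t by rewrite sqr_sqrtr// ltW// mulr_gt0.
  have -> : pi = p ^+ 2 by rewrite sqr_sqrtr// pi_ge0.
  have -> : t = c ^+ 2 / 2 by rewrite c2; field.
  by field0.
- move=> r r0; apply: cvgM.
    by apply: cvgM; [exact: cvg_cst|exact: cvg_id].
  apply: cvgV; first by rewrite expf_neq0.
  exact: (@continuous_comp _ _ _ (fun r : R => 1 + r ^+ 2) (fun x : R => x ^+ 2) r (cX r)
    (@exprn_continuous _ 2 _)).
- by move=> r r0; rewrite /F' !mulr_ge0 ?invr_ge0 ?ltW// exprn_gt0.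
- move=> x z x0 xz; rewrite /F ltr_pM2l// ltf_pV2 ?posrE// ltrD2l.
  by rewrite ltr_pXn2r// nnegrE ltW// (lt_trans x0).
- move=> r r0; rewrite /= in_itv/= divr_gt0//= ltr_pdivrMr// ltr_pMr//.
  by rewrite ltrDl exprn_gt0.
- move=> z; rewrite /= in_itv/= => /andP[z0 zt].
  have q0 : 0 < t / z - 1 by rewrite subr_gt0 ltr_pdivlMr ?mul1r.
  exists (Num.sqrt (t / z - 1)); first by rewrite sqrtr_gt0.
  rewrite /F sqr_sqrtr ?(ltW q0)// addrC subrK.
  by field0.
- move=> z; rewrite /= in_itv/= => /andP[z0 zt].
  apply: cvgM; first apply: cvgM.
  + apply: cvgM; first exact: cvg_cst.
    by apply: cvgV; [rewrite gt_eqF|exact: cvg_id].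
  + exact: continuous_heat_kernel.
  + apply: (@continuous_comp _ _ _ (fun z : R => t - z) (heat_kernel y)).
      by apply: cvgB; [exact: cvg_cst|exact: cvg_id].
    by apply: continuous_heat_kernel; rewrite subr_gt0.
- move=> z; rewrite /= in_itv/= => /andP[z0 zt].
  rewrite mulr_ge0 ?heat_kernel_ge0// mulr_ge0 ?heat_kernel_ge0//.
  by rewrite divr_ge0// ltW.
Qed.

(** A Laplace transform in time. With t = r^2 the exponent becomes t / 2 + w^2 / (2 t) = w + (r - w
    / r)^2 / 2, again a Cauchy-Schlomilch integral. *)
Lemma expR_heat_kernel (w : R) : 0 < w ->
  (\int[mu]_(t in `]0%R, +oo[) (expR (- (t / 2)) * heat_kernel w t)%:E =
   (expR (- w))%:E)%E.
Proof.
move=> w0.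
have dF (r : R) : 0 < r -> is_derive r 1 (fun r : R => r ^+ 2) (2 * r).
  by move=> _; apply: is_derive_eq; rewrite /GRing.scale/=; ring.
have s20 : 0 < Num.sqrt 2 :> R by rewrite sqrtr_gt0.
have s22 : Num.sqrt 2 ^+ 2 = 2 :> R by rewrite sqr_sqrtr.
have p0 : 0 < Num.sqrt pi :> R by rewrite sqrtr_gt0 pi_gt0.
rewrite (@ge0_substitution_incr _ _ (fun r : R => 2 * r) _ _ dF).
- transitivity (\int[mu]_(r in `]0%R, +oo[) ((Num.sqrt 2 / Num.sqrt pi * expR (- w)) *
    gauss_fun (1 / Num.sqrt 2 * r - w / Num.sqrt 2 / r))%:E)%E.
    apply: eq_integral => r; rewrite inE itv0yE => r0; congr EFin.
    rewrite /heat_kernel /gauss_fun sqrtrM ?mulr_ge0 ?pi_ge0// sqrtr_sqr gtr0_norm//.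
    rewrite -[RHS]mulrA -expRD.
    have -> : - w - (1 / Num.sqrt 2 * r - w / Num.sqrt 2 / r) ^+ 2 =
       - (r ^+ 2 / 2) - (w ^+ 2 / (2 * r ^+ 2)).
      rewrite (_ : (1 / Num.sqrt 2 * r - w / Num.sqrt 2 / r) ^+ 2 =
         (r - w / r) ^+ 2 / Num.sqrt 2 ^+ 2); last by field0.
      by rewrite s22; field0.
    rewrite expRD; set e1 := expR _; set e2 := expR _.
    have -> : 2 * r = Num.sqrt 2 ^+ 2 * r by rewrite s22.
    rewrite sqrtrM//.
    by field0.
  rewrite ge0_integral_mulrEFin//; last 2 first.
  + by rewrite /gauss_fun; mfun.
  + by move=> x _; exact: gauss_fun_ge0.
  rewrite integral_gauss_schlomilch ?divr_ge0 ?divr_gt0// ?ltW//.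
  rewrite -EFinM; congr EFin.
  rewrite (_ : 2 * (1 / Num.sqrt 2) = Num.sqrt 2); last first.
    by rewrite -[X in X * _]s22; field0.
  by field0.
- by move=> r r0; apply: cvgM; [exact: cvg_cst|exact: cvg_id].
- by move=> r r0; rewrite mulr_ge0// ltW.
- by move=> x y x0 xy; rewrite ltr_pXn2r// nnegrE ltW// (lt_trans x0).
- by move=> r r0; rewrite itv0yE exprn_gt0.
- move=> y; rewrite itv0yE => y0; exists (Num.sqrt y); first by rewrite sqrtr_gt0.
  by rewrite sqr_sqrtr// ltW.
- move=> y; rewrite itv0yE => y0; apply: cvgM; last exact: continuous_heat_kernel.
  apply: continuous_comp; last exact: continuous_expR.
  by apply: cvgN; apply: cvgM; [exact: cvg_id|exact: cvg_cst].
- by move=> y _; rewrite mulr_ge0 ?heat_kernel_ge0 ?expR_ge0.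
Qed.

End heat.

(** * Euler's integral and the duplication formula *)

Section gamma.
Context {R : realType}.
Local Notation mu := lebesgue_measure.

Lemma powRD_gt0 (x r s : R) : 0 < x -> x `^ (r + s) = x `^ r * x `^ s.
Proof. by move=> x0; rewrite powRD// (gt_eqF x0) implybT. Qed.

Lemma powRB_gt0 (x r s : R) : 0 < x -> x `^ (r - s) = x `^ r / x `^ s.
Proof. by move=> x0; rewrite powRB// (gt_eqF x0) implybT. Qed.

Lemma integral_itv0y_if (f : R -> \bar R) :
  (\int[mu]_(x in `]0%R, +oo[) f x = \int[mu]_x (if (0 < x)%R then f x else 0))%E.
Proof.
rewrite integral_mkcond; apply: eq_integral => x _.
by rewrite patchE mem_setE in_itv/= andbT.
Qed.

(** The extended value allows Tonelli arguments before Euler's integral is known to converge. *)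
Definition egamma (z : R) : \bar R :=
  (\int[mu]_(t in `]0%R, +oo[) (t `^ (z - 1) * expR (- t))%:E)%E.

Lemma egamma_ge0 (z : R) : (0 <= egamma z)%E.
Proof. by apply: integral_ge0 => t _; rewrite lee_fin mulr_ge0 ?powR_ge0 ?expR_ge0. Qed.

(** For z <= 1 the integrand is at least exp (-1) on ]0, 1]. Positivity is what lets a finite
    product of such integrals have finite factors. *)
Lemma egamma_gt0 (z : R) : z <= 1 -> (0 < egamma z)%E.
Proof.
move=> z1; apply: (@lt_le_trans _ _ (expR (- 1))%:E); first by rewrite lte_fin expR_gt0.
have -> : (expR (- 1))%:E =
    (\int[mu]_(t in `]0%R, 1%R]) (cst (expR (- 1))%:E t))%E :> \bar R.
  by rewrite integral_cst//= lebesgue_measure_itv/= lte_fin ltr01 -EFinB subr0 mule1.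
apply: (@le_trans _ _ (\int[mu]_(t in `]0%R, 1%R]) (t `^ (z - 1) * expR (- t))%:E)%E).
  apply: ge0_le_integral => //=.
  - by apply/measurable_EFinP; mfun.
  - move=> t; rewrite in_itv/= => /andP[t0 t1]; rewrite lee_fin.
    rewrite -[leLHS]mul1r ler_pM ?expR_ge0//.
      by rewrite -[leLHS](powRr0 t) ger_powR ?t0//; lra.
    by rewrite ler_expR lerN2.
apply: ge0_subset_integral => //.
- by apply/measurable_EFinP; mfun.
- by move=> t _; rewrite lee_fin mulr_ge0 ?powR_ge0 ?expR_ge0.
- by move=> t; rewrite /= !in_itv/= => /andP[->].
Qed.

(** The substitution u = w^2 / (2 t); the mean of a power of a reflected Brownian motion is an
    instance. *)
Lemma mellin_gauss (z t : R) : 0 < t ->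
  (\int[mu]_(w in `]0%R, +oo[) (w `^ (z - 1) * expR (- (w ^+ 2 / (2 * t))))%:E =
   ((2 * t) `^ (z / 2) / 2)%:E * egamma (z / 2))%E.
Proof.
move=> t0; have tn0 : t != 0 by rewrite gt_eqF.
have dF (w : R) : 0 < w -> is_derive w 1 (fun w => w ^+ 2 / (2 * t)) (w / t).
  by move=> w0; apply: is_derive_eq; rewrite /GRing.scale/=; field.
rewrite /egamma [in RHS](@ge0_substitution_incr _ _ (fun w => w / t) _ _ dF).
- rewrite -ge0_integral_mulrEFin//; last 3 first.
  + by mfun.
  + move=> w; rewrite itv0yE => w0.
    by rewrite !mulr_ge0 ?powR_ge0 ?expR_ge0 ?invr_ge0 ?ltW.
  + by rewrite divr_ge0 ?powR_ge0.
  apply: eq_integral => w; rewrite inE itv0yE => w0; congr EFin.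
  set e := expR _.
  have t20 : 0 < 2 * t by rewrite mulr_gt0.
  have -> : (w ^+ 2 / (2 * t)) `^ (z / 2 - 1) =
      w `^ (z - 1) / w * ((2 * t) / (2 * t) `^ (z / 2)).
    rewrite powRM ?sqr_ge0 ?invr_ge0 ?(ltW t20)// -powR_mulrn ?(ltW w0)// -powRrM.
    congr (_ * _).
      rewrite (_ : 2 * _ = z - 1 - 1); last by field.
      by rewrite [LHS]powRB_gt0// powRr1// ltW.
    rewrite -powR_inv1 ?(ltW t20)// -powRrM mulN1r opprB.
    by rewrite [LHS]powRB_gt0// powRr1// ltW.
  have p0 : (2 * t) `^ (z / 2) != 0 by rewrite gt_eqF// powR_gt0.
  by field0.
- by move=> w w0; apply: cvgM; [exact: cvg_id|exact: cvg_cst].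
- by move=> w w0; rewrite divr_ge0// ltW.
- move=> x y x0 xy; rewrite ltr_pM2r ?invr_gt0 ?mulr_gt0//.
  by rewrite ltr_pXn2r// nnegrE ltW// (lt_trans x0).
- by move=> w w0; rewrite itv0yE divr_gt0 ?exprn_gt0 ?mulr_gt0.
- move=> y; rewrite itv0yE => y0; have yt : 0 < 2 * t * y by rewrite !mulr_gt0.
  exists (Num.sqrt (2 * t * y)); first by rewrite sqrtr_gt0.
  by rewrite sqr_sqrtr ?(ltW yt)//; field.
- move=> y; rewrite itv0yE => y0; apply: cvgM.
    apply: (is_derive_continuous_for (is_derive1_powR _ y0)).
  by apply: continuous_comp; [apply: cvgN; exact: cvg_id|exact: continuous_expR].
- by move=> y _; rewrite mulr_ge0 ?powR_ge0 ?expR_ge0.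
Qed.

Lemma egamma_half : egamma (1 / 2) = (Num.sqrt pi)%:E.
Proof.
have := @mellin_gauss 1 (1 / 2) ltac:(lra).
rewrite (_ : 2 * (1 / 2) = 1); last by field.
rewrite powR1 => H.
have : (\int[mu]_(x in `]0%R, +oo[) (gauss_fun x)%:E)%E = (Num.sqrt pi / 2)%:E :> \bar R.
  rewrite -integral0y_gauss -integral_itv_obnd_cbnd//.
  by apply/measurable_EFinP; rewrite /gauss_fun; mfun.
under eq_integral.
  move=> x _; rewrite /gauss_fun (_ : expR _ = x `^ (1 - 1) * expR (- (x ^+ 2 / 1))); last first.
    by rewrite subrr powRr0 mul1r divr1.
  over.
rewrite /= H div1r => G.
rewrite (_ : Num.sqrt pi = 2 * (Num.sqrt pi / 2)); last by field.
by rewrite EFinM -G muleA -EFinM divff// mul1e.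
Qed.

(* Legendre's duplication formula, from
   [expR (- w) = \int_(t > 0) expR (- t / 2) * heat_kernel w t]. *)
Lemma egamma_duplication (z : R) : 0 < z ->
  egamma z = ((2 `^ (z - 1) / Num.sqrt pi)%:E * egamma (z / 2) * egamma ((z + 1) / 2))%E.
Proof.
move=> z0.
transitivity (\int[mu]_w \int[mu]_t (if (0 < w) && (0 < t) then
    w `^ (z - 1) * expR (- (t / 2)) * heat_kernel w t else 0)%:E)%E.
  rewrite /egamma integral_itv0y_if; apply: eq_integral => w _; case: ifPn => w0 /=; last first.
    by rewrite integral0.
  rewrite EFinM -expR_heat_kernel// -ge0_integral_mulrEFin//; last 3 first.
  - by mfun; exact: measurable_heat_kernel.
  - by move=> t _; rewrite mulr_ge0 ?heat_kernel_ge0 ?expR_ge0.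
  - exact: powR_ge0.
  rewrite integral_itv0y_if; apply: eq_integral => t _.
  by case: ifPn; rewrite // mulrA.
rewrite (@fubini_tonelli _ _ _ _ _ lebesgue_measure lebesgue_measure (fun p : R * R => (if (0 < p.1) && (0 < p.2) then
    p.1 `^ (z - 1) * expR (- (p.2 / 2)) * heat_kernel p.1 p.2 else 0)%:E))/=; last 2 first.
- by apply/measurable_EFinP; mfun; exact: measurable_heat_kernel.
- move=> [w t]/=; case: ifPn => // _.
  by rewrite lee_fin !mulr_ge0 ?powR_ge0 ?heat_kernel_ge0 ?expR_ge0.
have c0 : 0 <= (1 / 2) / Num.sqrt pi :> R by rewrite divr_ge0 ?sqrtr_ge0.
have sp0 : 0 < Num.sqrt pi :> R by rewrite sqrtr_gt0 pi_gt0.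
(* Integrating over w first gives Euler's integral at z / 2; what remains is a power of t against
   exp (- t / 2), that is Euler's integral at (z + 1) / 2. *)
transitivity (\int[mu]_(t in `]0%R, +oo[) (egamma (z / 2) *
   ((1 / 2) / Num.sqrt pi * ((2 * t) `^ ((z - 1) / 2) * expR (- (t / 2))))%:E))%E.
  rewrite integral_itv0y_if; apply: eq_integral => t _; case: ifPn => t0; last first.
    by rewrite integral0_eq// => w _; rewrite andbF.
  transitivity (\int[mu]_(w in `]0%R, +oo[) ((expR (- (t / 2)) / Num.sqrt (2 * pi * t)) *
     (w `^ (z - 1) * expR (- (w ^+ 2 / (2 * t)))))%:E)%E.
    rewrite integral_itv0y_if; apply: eq_integral => w _; rewrite andbT.
    by case: ifPn => // w0; congr EFin; rewrite /heat_kernel; ring.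
  rewrite ge0_integral_mulrEFin//; last 2 first.
  - by mfun.
  - by move=> w _; rewrite mulr_ge0 ?powR_ge0 ?expR_ge0.
  rewrite mellin_gauss// muleA muleC -EFinM; congr (_ * _%:E)%E.
  have t20 : 0 < 2 * t by rewrite mulr_gt0.
  rewrite (_ : z / 2 = (z - 1) / 2 + 2^-1); last by field.
  rewrite powRD_gt0// powR12_sqrt ?(ltW t20)//.
  have -> : Num.sqrt (2 * pi * t) = Num.sqrt pi * Num.sqrt (2 * t).
    by rewrite -sqrtrM ?pi_ge0//; congr Num.sqrt; ring.
  have : 0 < Num.sqrt (2 * t) by rewrite sqrtr_gt0.
  by move=> ?; field0.
rewrite ge0_integralZl//; last 3 first.
- by apply/measurable_EFinP; mfun.
- by move=> t _; rewrite lee_fin mulr_ge0// mulr_ge0 ?powR_ge0 ?expR_ge0.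
- exact: egamma_ge0.
rewrite muleC [RHS]muleAC; congr (_ * _)%E.
have dF (u : R) : 0 < u -> is_derive u 1 (fun u => 2 * u) 2.
  by move=> _; apply: is_derive_eq; rewrite /GRing.scale/=; ring.
rewrite (@ge0_substitution_incr _ _ (cst 2) _ _ dF).
- rewrite /egamma -ge0_integral_mulrEFin//; last 2 first.
  + by mfun.
  + by move=> u _; rewrite mulr_ge0 ?powR_ge0 ?expR_ge0.
  apply: eq_integral => u; rewrite inE itv0yE => u0; congr EFin => /=.
  rewrite (_ : 2 * u / 2 = u); last by field.
  rewrite (_ : (z + 1) / 2 - 1 = (z - 1) / 2); last by field.
  have -> : (2 * (2 * u)) `^ ((z - 1) / 2) = 2 `^ (z - 1) * u `^ ((z - 1) / 2).
    rewrite mulrA powRM ?(ltW u0)//; congr (_ * _).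
    rewrite (_ : 2 * 2 = 2 `^ 2) -?powRrM; last first.
      by rewrite powR_mulrn// expr2.
    by congr powR; field.
  by field0.
- by move=> u u0; exact: cvg_cst.
- by [].
- by move=> x y x0 xy; rewrite ltr_pM2l.
- by move=> u u0; rewrite itv0yE mulr_gt0.
- move=> y; rewrite itv0yE => y0; exists (y / 2); first by rewrite divr_gt0.
  by field.
- move=> t; rewrite itv0yE => t0; apply: cvgM; first exact: cvg_cst.
  apply: cvgM.
    apply: (@continuous_comp _ _ _ (fun t : R => 2 * t) (fun x => x `^ ((z - 1) / 2))).
      by apply: cvgM; [exact: cvg_cst|exact: cvg_id].
    have t20 : 0 < 2 * t by rewrite mulr_gt0.
    exact: (is_derive_continuous_for (is_derive1_powR _ t20)).
  apply: continuous_comp; last exact: continuous_expR.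
  by apply: cvgN; apply: cvgM; [exact: cvg_id|exact: cvg_cst].
- by move=> t _; rewrite mulr_ge0// mulr_ge0 ?powR_ge0 ?expR_ge0.
Qed.

End gamma.

(** * Finiteness of Gamma at 1 - 1/2^n *)

Section gamma_values.
Context {R : realType}.

Definition nu (n : nat) : R := 1 / 2 ^+ n.

Lemma nu_gt0 n : 0 < nu n.
Proof. by rewrite /nu divr_gt0// exprn_gt0. Qed.

Lemma nuS n : nu n.+1 = nu n / 2.
Proof. by rewrite /nu exprS; field; rewrite expf_neq0. Qed.

Lemma nu_lt1 n : nu n.+1 < 1.
Proof.
by rewrite /nu ltr_pdivrMr ?exprn_gt0// mul1r exprn_egt1// ltr1n.
Qed.

Lemma GammaE (z : R) : 0 < z -> Gamma z = fine (egamma z).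
Proof. by move=> z0; rewrite /Gamma z0. Qed.

(** The duplication formula at z = 1 - b. Both factors on its right are positive, so neither can be
    infinite when the left side is finite: finiteness passes from 1 - b to 1 - b / 2. *)
Lemma egamma_duplication_fin (b : R) : 0 < b -> b < 1 ->
  egamma (1 - b) \is a fin_num ->
  [/\ egamma ((1 - b) / 2) \is a fin_num, egamma (1 - b / 2) \is a fin_num &
      Gamma (1 - b) = 2 `^ (- b) / Num.sqrt pi * Gamma ((1 - b) / 2) * Gamma (1 - b / 2)].
Proof.
move=> b0 b1 fb.
have z0 : 0 < 1 - b by rewrite subr_gt0.
have := egamma_duplication z0.
rewrite (_ : 1 - b - 1 = - b); last by ring.
rewrite (_ : (1 - b + 1) / 2 = 1 - b / 2); last by field.
have c0 : 0 < 2 `^ (- b) / Num.sqrt pi :> R.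
  by rewrite divr_gt0 ?powR_gt0 ?sqrtr_gt0 ?pi_gt0.
have A0 : (0 < egamma ((1 - b) / 2))%E by apply: egamma_gt0; lra.
have B0 : (0 < egamma (1 - b / 2))%E by apply: egamma_gt0; lra.
rewrite !GammaE; [|lra|lra|lra].
move: (egamma ((1 - b) / 2)) (egamma (1 - b / 2)) A0 B0 => A B A0 B0 dup.
have fA : A \is a fin_num.
  case: A A0 dup => [//| |//] _; rewrite gt0_muley ?lte_fin// gt0_mulye// => h.
  by move: fb; rewrite h.
have fB : B \is a fin_num.
  case: B B0 dup => [//| |//] _; rewrite gt0_muley ?mule_gt0 ?lte_fin// => h.
  by move: fb; rewrite h.
by split=> //; rewrite dup -(fineK fA) -(fineK fB).
Qed.

(** Halving b repeatedly from b = 1/2, where the value is the square root of pi. The index is [n.+1]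
    because 1 - [nu 0] = 0 is a pole. *)
Lemma egamma_nu_fin n : egamma (1 - nu n.+1) \is a fin_num.
Proof.
elim: n => [|n ih].
  by rewrite (_ : 1 - nu 1 = 1 / 2) ?egamma_half// /nu expr1; field.
have [_ + _] := egamma_duplication_fin (nu_gt0 n.+1) (nu_lt1 n) ih.
by rewrite (nuS n.+1).
Qed.

Lemma Gamma_gt0 (z : R) : 0 < z -> z <= 1 -> egamma z \is a fin_num -> 0 < Gamma z.
Proof.
by move=> z0 z1 fz; rewrite GammaE// -lte_fin fineK// egamma_gt0.
Qed.

End gamma_values.

Ltac mfunh := repeat first [ apply: measurable_heat_kernel | progress mfun ].

(** * Subordination to reflected Brownian motion *)

Section subordination.
Context {R : realType}.
Local Notation mu := lebesgue_measure.
Implicit Types (f g : R -> \bar R) (s t : R).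

(** The density of a reflected Brownian motion at time t. It is extended by 0 to s <= 0 so that
    integrals run over the whole line, the form in which Tonelli's theorem is applied. *)
Definition absheat s t : R := if 0 < s then 2 * heat_kernel s t else 0.

(* [subord f t] is the mean of [f `|B t|] for a Brownian motion [B]. *)
Definition subord f t : \bar R := (\int[mu]_s (f s * (absheat s t)%:E))%E.

Lemma absheat_ge0 s t : 0 <= absheat s t.
Proof. by rewrite /absheat; case: ifPn => // _; rewrite mulr_ge0 ?heat_kernel_ge0. Qed.

Lemma measurable_absheat d (T : measurableType d) (f g : T -> R) :
  measurable_fun [set: T] f -> measurable_fun [set: T] g ->
  measurable_fun [set: T] (fun x => absheat (f x) (g x)).
Proof. by move=> mf mg; rewrite /absheat; mfunh. Qed.

Lemma subord_ge0 f t : (forall s, 0 <= f s)%E -> (0 <= subord f t)%E.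
Proof. by move=> f0; apply: integral_ge0 => s _; rewrite mule_ge0// lee_fin absheat_ge0. Qed.

Lemma measurable_subord f : measurable_fun [set: R] f -> (forall s, 0 <= f s)%E ->
  measurable_fun [set: R] (subord f).
Proof.
move=> mf f0.
have := @measurable_fun_fubini_tonelli_G _ _ _ _ R lebesgue_measure
  (fun p : R * R => f p.1 * (absheat p.1 p.2)%:E)%E.
apply.
- apply: emeasurable_funM; first exact: measurableT_comp.
  by apply/measurable_EFinP; apply: measurable_absheat.
- by move=> [s t]/=; rewrite mule_ge0// lee_fin absheat_ge0.
Qed.

Lemma eq_subord f g t : (forall s, 0 < s -> f s = g s) -> subord f t = subord g t.
Proof.
move=> fg; apply: eq_integral => s _; rewrite /absheat.
by case: ifPn => [/fg->//|_]; rewrite !mule0.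
Qed.

Lemma subordZ (c : \bar R) f t : (0 <= c)%E -> measurable_fun [set: R] f ->
  (forall s, 0 <= f s)%E -> subord (fun s => c * f s)%E t = (c * subord f t)%E.
Proof.
move=> c0 mf f0; rewrite /subord; under eq_integral do rewrite -muleA.
rewrite ge0_integralZl//.
- apply: emeasurable_funM => //.
  by apply/measurable_EFinP; apply: measurable_absheat.
- by move=> s _; rewrite mule_ge0// lee_fin absheat_ge0.
Qed.

Lemma subordD f g t : measurable_fun [set: R] f -> measurable_fun [set: R] g ->
  (forall s, 0 <= f s)%E -> (forall s, 0 <= g s)%E ->
  subord (fun s => f s + g s)%E t = (subord f t + subord g t)%E.
Proof.
move=> mf mg f0 g0; rewrite /subord -ge0_integralD//=.
- by apply: eq_integral => s _; rewrite ge0_muleDl.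
- by move=> s _; rewrite mule_ge0// lee_fin absheat_ge0.
- apply: emeasurable_funM => //.
  by apply/measurable_EFinP; apply: measurable_absheat.
- by move=> s _; rewrite mule_ge0// lee_fin absheat_ge0.
- apply: emeasurable_funM => //.
  by apply/measurable_EFinP; apply: measurable_absheat.
Qed.

Lemma le_subord f g t : measurable_fun [set: R] f -> measurable_fun [set: R] g ->
  (forall s, 0 <= f s)%E -> (forall s, f s <= g s)%E -> (subord f t <= subord g t)%E.
Proof.
move=> mf mg f0 fg; apply: ge0_le_integral => //=.
- by move=> s _; rewrite mule_ge0// lee_fin absheat_ge0.
- apply: emeasurable_funM => //.
  by apply/measurable_EFinP; apply: measurable_absheat.
- apply: emeasurable_funM => //.
  by apply/measurable_EFinP; apply: measurable_absheat.
- by move=> s _; rewrite lee_pmul// lee_fin absheat_ge0.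
Qed.

(** With this normalization the duplication formula absorbs every constant: subordination just
    halves the exponent. The identity gives the boundary term of the equation and represents a power
    as a mixture of heat kernels. *)
Lemma subord_powR (b t : R) : 0 < b -> b < 1 -> egamma (1 - b) \is a fin_num -> 0 < t ->
  subord (fun w => ((2 * w) `^ (- b) / Gamma (1 - b))%:E) t =
  ((2 * t) `^ (- (b / 2)) / Gamma (1 - b / 2))%:E.
Proof.
move=> b0 b1 fb t0.
have [fA fB dup] := egamma_duplication_fin b0 b1 fb.
have GA : 0 < Gamma ((1 - b) / 2) by apply: Gamma_gt0 => //; lra.
have GB : 0 < Gamma (1 - b / 2) by apply: Gamma_gt0 => //; lra.
have sp0 : 0 < Num.sqrt pi :> R by rewrite sqrtr_gt0 pi_gt0.
have p2 (x : R) : 0 < 2 `^ x :> R by rewrite powR_gt0.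
have G0 : 0 < Gamma (1 - b) by rewrite dup !mulr_gt0// invr_gt0.
have t20 : 0 < 2 * t by rewrite mulr_gt0.
have st0 : 0 < Num.sqrt (2 * t) by rewrite sqrtr_gt0.
transitivity (\int[mu]_(w in `]0%R, +oo[)
   (2 * 2 `^ (- b) / Gamma (1 - b) / Num.sqrt (2 * pi * t) *
   (w `^ (1 - b - 1) * expR (- (w ^+ 2 / (2 * t)))))%:E)%E.
  rewrite integral_itv0y_if; apply: eq_integral => w _; rewrite /absheat.
  case: ifPn => w0; last by rewrite mule0.
  rewrite -EFinM; congr EFin; rewrite /heat_kernel powRM// ?(ltW w0)//.
  by rewrite (_ : 1 - b - 1 = - b); [ring|ring].
rewrite ge0_integral_mulrEFin//; last 3 first.
- by mfun.
- by move=> w _; rewrite mulr_ge0 ?powR_ge0 ?expR_ge0.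
- by rewrite !divr_ge0 ?mulr_ge0 ?powR_ge0 ?sqrtr_ge0// ltW.
rewrite mellin_gauss// -(fineK fA) -GammaE; last lra.
rewrite -!EFinM; congr EFin; rewrite dup.
have -> : Num.sqrt (2 * pi * t) = Num.sqrt pi * Num.sqrt (2 * t).
  by rewrite -sqrtrM ?pi_ge0//; congr Num.sqrt; ring.
rewrite (_ : (1 - b) / 2 = 2^-1 - b / 2) in GA *; last by field.
rewrite powRB_gt0// powR12_sqrt ?(ltW t20)// [in RHS]powRN.
have := powR_gt0 (b / 2) t20.
move: (Gamma (2^-1 - b / 2)) (Gamma (1 - b / 2)) GA GB => A B A0 B0.
move: (Num.sqrt (2 * t)) (Num.sqrt pi) st0 sp0 => x y x0 y0.
have := p2 (- b); move: (2 `^ _) => q q0.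
move: (_ `^ (b / 2)) => u u0.
by field0.
Qed.

(* The Caputo kernel with the extra weight tau^-1: scaling gives access to [tau d/dtau]. *)
Definition abelk (a t tau : R) : R :=
  if (0 < tau) && (tau < t) then tau^-1 * (t - tau) `^ (- a) / Gamma (1 - a) else 0.

Definition abel (a : R) f t : \bar R := (\int[mu]_tau ((abelk a t tau)%:E * f tau))%E.

Lemma abelk_ge0 (a t tau : R) : a < 1 -> 0 <= abelk a t tau.
Proof.
move=> a1; rewrite /abelk; case: ifPn => // /andP[tau0 _].
rewrite divr_ge0 ?mulr_ge0 ?powR_ge0 ?invr_ge0 ?(ltW tau0)//.
by rewrite GammaE ?subr_gt0// fine_ge0// egamma_ge0.
Qed.

Lemma measurable_abelk (a : R) d (T : measurableType d) (f g : T -> R) :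
  measurable_fun [set: T] f -> measurable_fun [set: T] g ->
  measurable_fun [set: T] (fun x => abelk a (f x) (g x)).
Proof. by move=> mf mg; rewrite /abelk; mfun. Qed.

End subordination.

Ltac mfuna := repeat first [ apply: measurable_absheat | progress mfunh ].

Ltac emf := repeat first [ assumption | apply: measurable_cst | apply: emeasurable_funM | apply: emeasurable_funD
  | apply/measurable_EFinP; repeat first [ apply: measurable_abelk | progress mfuna ]
  | solve [ apply: measurableT_comp => //; mfun ] ].

(** * Exchange of Abel integrals and subordination *)

Section abel_subordination.
Context {R : realType}.
Local Notation mu := lebesgue_measure.
Implicit Types (f g : R -> \bar R) (s t : R).

Lemma eq_abel (a : R) f g t : (forall s, 0 < s -> f s = g s) -> abel a f t = abel a g t.
Proof.
move=> fg; apply: eq_integral => s _; rewrite /abelk.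
by case: ifPn => [/andP[/fg-> //]|_]; rewrite !mul0e.
Qed.

Lemma abelk_first_passage (s t y : R) : 0 < s -> 0 <= y -> 0 < t ->
  (\int[mu]_tau (if (0 < tau)%R && (tau < t)%R then
     (tau^-1 * heat_kernel y (t - tau))%:E * (absheat s tau)%:E else 0) =
   (2 / s * heat_kernel (s + y) t)%:E)%E.
Proof.
move=> s0 y0 t0.
rewrite EFinM -heat_kernel_first_passage// -ge0_integral_mulrEFin//; last 3 first.
- by mfunh.
- move=> tau; rewrite /= in_itv/= => /andP[tau0 _].
  by rewrite mulr_ge0 ?heat_kernel_ge0// mulr_ge0 ?heat_kernel_ge0// divr_ge0// ltW.
- by rewrite divr_ge0// ltW.
rewrite [RHS]integral_mkcond; apply: eq_integral => tau _.
rewrite patchE mem_setE in_itv/=; case: ifPn => // /andP[tau0 _].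
by rewrite /absheat s0 -EFinM; congr EFin; field0.
Qed.

(** By [subord_powR], (t - tau)^(-a) is a mixture over y > 0 of the kernels
    [heat_kernel y (t - tau)] with weight proportional to y^(-2a). The first-passage identity
    integrates tau out and leaves [heat_kernel (s + y) t]; in the variable r = s + y the weight is
    the Abel kernel of order 2a, with s the earlier and r the later time. *)
Lemma abel_absheat (a s t : R) : 0 < a -> 2 * a < 1 ->
  egamma (1 - 2 * a) \is a fin_num -> 0 < s -> 0 < t ->
  (\int[mu]_tau ((abelk a t tau)%:E * (absheat s tau)%:E) =
   (2 `^ (1 - a))%:E * \int[mu]_r ((abelk (2 * a) r s)%:E * (absheat r t)%:E))%E.
Proof.
move=> a0 a1 fa s0 t0.
have a20 : 0 < 2 * a by rewrite mulr_gt0.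
have G0 : 0 < Gamma (1 - 2 * a) by apply: Gamma_gt0 => //; lra.
have abelkE tau : (abelk a t tau)%:E = (\int[mu]_y
   (if [&& 0 < tau, tau < t & 0 < y] then
     2 * 2 `^ (- a) / Gamma (1 - 2 * a) * (tau^-1 * y `^ (- (2 * a)) * heat_kernel y (t - tau))
     else 0)%:E)%E.
  rewrite /abelk; case: ifPn => [/andP[tau0 taut]|]; last first.
    move=> /negbTE h; rewrite integral0_eq// => y _.
    by rewrite andbA h.
  rewrite tau0 taut /=.
  have u0 : 0 < t - tau by rewrite subr_gt0.
  have := subord_powR a20 a1 fa u0.
  rewrite (_ : 2 * a / 2 = a); last by field.
  move=> E.
  have -> : tau^-1 * (t - tau) `^ (- a) / Gamma (1 - a) =
      tau^-1 * 2 `^ a * ((2 * (t - tau)) `^ (- a) / Gamma (1 - a)).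
    rewrite powRM// ?(ltW u0)// [2 `^ (- a)]powRN.
    have := powR_gt0 a (ltr0n R 2); move: (2 `^ a) => q q0.
    by rewrite !mulrA; congr (_ * _ / _); field0.
  have c0 : 0 <= tau^-1 * 2 `^ a by rewrite mulr_ge0 ?powR_ge0 ?invr_ge0// ltW.
  rewrite EFinM -E /subord -ge0_integralZl//; last 2 first.
  - apply: emeasurable_funM; first by apply/measurable_EFinP; mfun.
    by apply/measurable_EFinP; apply: measurable_absheat.
  - by move=> y _; rewrite mule_ge0// lee_fin ?absheat_ge0// divr_ge0 ?powR_ge0// ltW.
  apply: eq_integral => y _; rewrite /absheat; case: ifPn => y0; last by rewrite !mule0.
  rewrite -!EFinM; congr EFin.
  rewrite powRM ?(ltW y0)// (_ : 2 `^ (- (2 * a)) = 2 `^ (- a) / 2 `^ a); last first.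
    by rewrite -powRB_gt0//; congr powR; ring.
  have := powR_gt0 a (ltr0n R 2); move: (2 `^ a) => q q0.
  by field0.
transitivity (\int[mu]_tau \int[mu]_y
   (if [&& 0 < tau, tau < t & 0 < y] then
     2 * 2 `^ (- a) / Gamma (1 - 2 * a) * (tau^-1 * y `^ (- (2 * a)) * heat_kernel y (t - tau))
       * absheat s tau else 0)%:E)%E.
  apply: eq_integral => tau _; rewrite abelkE -ge0_integralZr//; last 3 first.
  - by apply/measurable_EFinP; mfunh.
  - move=> y _; case: ifPn => // /and3P[tau0 _ _].
    by rewrite lee_fin !mulr_ge0 ?invr_ge0 ?heat_kernel_ge0 ?powR_ge0 ?(ltW G0) ?(ltW tau0).
  - by rewrite lee_fin absheat_ge0.
  by apply: eq_integral => y _; rewrite -EFinM; case: ifPn => //; rewrite mul0r.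
rewrite (@fubini_tonelli _ _ _ _ _ lebesgue_measure lebesgue_measure (fun p : R * R =>
   (if [&& 0 < p.1, p.1 < t & 0 < p.2] then
     2 * 2 `^ (- a) / Gamma (1 - 2 * a) * (p.1^-1 * p.2 `^ (- (2 * a)) * heat_kernel p.2 (t - p.1))
       * absheat s p.1 else 0)%:E))/=; last 2 first.
- by apply/measurable_EFinP; mfuna.
- move=> [tau y]/=; case: ifPn => // /and3P[tau0 _ _].
  by rewrite lee_fin !mulr_ge0 ?invr_ge0 ?absheat_ge0 ?heat_kernel_ge0 ?powR_ge0 ?(ltW G0) ?(ltW tau0).
rewrite -ge0_integralZl//; last 2 first.
- by emf.
- by move=> r _; rewrite mule_ge0// lee_fin ?absheat_ge0// abelk_ge0.
(* The shift r = s + y: the Abel kernel [abelk (2 * a) r s] lives on r > s, that is y > 0. *)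
rewrite [RHS](ge0_integral_affine s ltr01); last 2 first.
- by emf.
- by move=> r; rewrite !mule_ge0// lee_fin ?powR_ge0 ?absheat_ge0// abelk_ge0.
rewrite mul1e; apply: eq_integral => y _; rewrite mul1r.
have [y0|y0] := boolP (0 < y); last first.
  rewrite integral0_eq => [|tau _]; last by rewrite !andbF.
  by rewrite /abelk ltrDl (negbTE y0) andbF mul0e mule0.
transitivity (\int[mu]_tau ((2 * 2 `^ (- a) / Gamma (1 - 2 * a) * y `^ (- (2 * a)))%:E *
  (if (0 < tau)%R && (tau < t)%R then
     (tau^-1 * heat_kernel y (t - tau))%:E * (absheat s tau)%:E else 0)))%E.
  apply: eq_integral => tau _; rewrite andbT; case: ifPn => _; last by rewrite mule0.
  by rewrite -!EFinM; congr EFin; ring.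
rewrite ge0_integralZl//; last 3 first.
- rewrite (_ : (fun _ => _) = (fun tau => (if (0 < tau)%R && (tau < t)%R then
     (tau^-1 * heat_kernel y (t - tau)) * absheat s tau else 0)%:E)); last first.
    by apply/funext => tau; case: ifPn => //; rewrite EFinM.
  by apply/measurable_EFinP; mfuna.
- move=> tau _; case: ifPn => // /andP[tau0 _].
  by rewrite -EFinM lee_fin !mulr_ge0 ?invr_ge0 ?absheat_ge0 ?heat_kernel_ge0 ?(ltW tau0).
- by rewrite lee_fin !mulr_ge0 ?invr_ge0 ?powR_ge0 ?(ltW G0).
rewrite abelk_first_passage ?(ltW y0)// /abelk /absheat s0 ltrDl y0 addr_gt0//=.
rewrite -!EFinM; congr EFin.
rewrite (_ : s + y - s = y); last by ring.
rewrite [2 `^ (1 - a)]powRB_gt0// powRr1// powRN.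
have := powR_gt0 a (ltr0n R 2); move: (2 `^ a) => q q0.
by field0.
Qed.

(** [abel_absheat] is this identity for kernels; Tonelli's theorem transfers it to any nonnegative
    [f], infinite values included. *)
Lemma abel_subord (a t : R) f : 0 < a -> 2 * a < 1 ->
  egamma (1 - 2 * a) \is a fin_num -> 0 < t ->
  measurable_fun [set: R] f -> (forall s, 0 <= f s)%E ->
  abel a (subord f) t = ((2 `^ (1 - a))%:E * subord (abel (2 * a) f) t)%E.
Proof.
move=> a0 a1 fa t0 mf f0.
have mabel (b : R) d (T : measurableType d) (u v : T -> R) :
  measurable_fun [set: T] u -> measurable_fun [set: T] v ->
  measurable_fun [set: T] (fun x => (abelk b (u x) (v x))%:E).
  by move=> mu mv; apply/measurable_EFinP; apply: measurable_abelk.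
have mabs d (T : measurableType d) (u v : T -> R) :
  measurable_fun [set: T] u -> measurable_fun [set: T] v ->
  measurable_fun [set: T] (fun x => (absheat (u x) (v x))%:E).
  by move=> mu mv; apply/measurable_EFinP; apply: measurable_absheat.
transitivity (\int[mu]_tau \int[mu]_s
   ((abelk a t tau)%:E * (f s * (absheat s tau)%:E)))%E.
  apply: eq_integral => tau _; rewrite ge0_integralZl//.
  - by apply: emeasurable_funM => //; apply: mabs.
  - by move=> s _; rewrite mule_ge0// lee_fin absheat_ge0.
  - by rewrite lee_fin abelk_ge0//; lra.
rewrite (@fubini_tonelli _ _ _ _ _ lebesgue_measure lebesgue_measure (fun p : R * R =>
   ((abelk a t p.1)%:E * (f p.2 * (absheat p.2 p.1)%:E))%E))/=; last 2 first.
- apply: emeasurable_funM; first by apply: mabel.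
  apply: emeasurable_funM; first exact: measurableT_comp.
  by apply: mabs.
- move=> [tau s]/=; rewrite !mule_ge0// ?lee_fin ?absheat_ge0//.
  by rewrite abelk_ge0//; lra.
transitivity (\int[mu]_s \int[mu]_r ((2 `^ (1 - a))%:E * (f s *
   ((abelk (2 * a) r s)%:E * (absheat r t)%:E))))%E.
  apply: eq_integral => s _.
  transitivity (f s * \int[mu]_tau ((abelk a t tau)%:E * (absheat s tau)%:E))%E.
    rewrite -ge0_integralZl//; last 2 first.
    - by apply: emeasurable_funM; [apply: mabel|apply: mabs].
    - by move=> tau _; rewrite mule_ge0// lee_fin ?absheat_ge0// abelk_ge0//; lra.
    by apply: eq_integral => tau _; rewrite muleCA.
  have [s0|s0] := boolP (0 < s); last first.
    rewrite !integral0_eq ?mule0// => [r _|tau _].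
      by rewrite /abelk (negbTE s0) /= mul0e !mule0.
    by rewrite /absheat (negbTE s0) mule0.
  rewrite abel_absheat// muleCA -!ge0_integralZl//.
  - by emf.
  - by move=> r _; rewrite !mule_ge0// lee_fin ?absheat_ge0// abelk_ge0.
  - by emf.
  - by move=> r _; rewrite !mule_ge0// lee_fin ?absheat_ge0// abelk_ge0.
rewrite (@fubini_tonelli _ _ _ _ _ lebesgue_measure lebesgue_measure (fun p : R * R =>
  ((2 `^ (1 - a))%:E * (f p.1 * ((abelk (2 * a) p.2 p.1)%:E * (absheat p.2 t)%:E)))%E))/=; last 2 first.
- by emf.
- by move=> [s r]/=; rewrite !mule_ge0// lee_fin ?powR_ge0 ?absheat_ge0// abelk_ge0.
have mabelf : measurable_fun [set: R] (abel (2 * a) f).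
  have := @measurable_fun_fubini_tonelli_F _ _ _ _ R lebesgue_measure
    (fun p : R * R => (abelk (2 * a) p.1 p.2)%:E * f p.2)%E.
  apply.
  - by apply: emeasurable_funM; [apply: mabel|exact: measurableT_comp].
  - by move=> [r s]/=; rewrite mule_ge0// lee_fin abelk_ge0.
have abelf0 r : (0 <= abel (2 * a) f r)%E.
  by apply: integral_ge0 => s _; rewrite mule_ge0// lee_fin abelk_ge0.
rewrite /subord -ge0_integralZl//; last 2 first.
- by emf.
- by move=> r _; rewrite mule_ge0// lee_fin absheat_ge0.
apply: eq_integral => r _; rewrite /abel.
rewrite -ge0_integralZr//; last 3 first.
- by apply: emeasurable_funM => //; apply: mabel.
- by move=> s _; rewrite mule_ge0// lee_fin abelk_ge0.
- by rewrite lee_fin absheat_ge0.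
rewrite -ge0_integralZl//; last 2 first.
- by emf.
- by move=> s _; rewrite !mule_ge0// lee_fin ?absheat_ge0// abelk_ge0.
by apply: eq_integral => s _; rewrite [(f s * _)%E]muleCA [X in (_ * X)%E]muleA.
Qed.

End abel_subordination.

(** * Iterates of the subordination *)

Section iterated_subordination.
Context {R : realType}.
Local Notation mu := lebesgue_measure.
Implicit Types (f g : R -> \bar R) (s t : R).

Lemma iter_subord_ge0 n f t : (forall s, 0 <= f s)%E -> (0 <= iter n subord f t)%E.
Proof. by elim: n t => [|n ih] t f0 //=; apply: subord_ge0 => s; exact: ih. Qed.

Lemma measurable_iter_subord n f : measurable_fun [set: R] f -> (forall s, 0 <= f s)%E ->
  measurable_fun [set: R] (iter n subord f).
Proof.
move=> mf f0; elim: n => [//|n ih] /=; apply: measurable_subord => // s.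
exact: iter_subord_ge0.
Qed.

Lemma eq_iter_subord n f g t : 0 < t -> (forall s, 0 < s -> f s = g s) ->
  iter n subord f t = iter n subord g t.
Proof.
move=> + fg; elim: n t => [|n ih] t t0 /=; first exact: fg.
by apply: eq_subord => s s0; exact: ih.
Qed.

Lemma iter_subordZ n (c : \bar R) f t : (0 <= c)%E -> 0 < t -> measurable_fun [set: R] f ->
  (forall s, 0 <= f s)%E ->
  iter n subord (fun s => c * f s)%E t = (c * iter n subord f t)%E.
Proof.
move=> c0 + mf f0; elim: n t => [//|n ih] t t0 /=.
rewrite -subordZ//; first exact: eq_subord.
- exact: measurable_iter_subord.
- by move=> s; exact: iter_subord_ge0.
Qed.

Lemma iter_subordD n f g t : 0 < t -> measurable_fun [set: R] f -> measurable_fun [set: R] g ->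
  (forall s, 0 <= f s)%E -> (forall s, 0 <= g s)%E ->
  iter n subord (fun s => f s + g s)%E t = (iter n subord f t + iter n subord g t)%E.
Proof.
move=> + mf mg f0 g0; elim: n t => [//|n ih] t t0 /=.
rewrite -subordD//; first exact: eq_subord.
- exact: measurable_iter_subord.
- exact: measurable_iter_subord.
- by move=> s; exact: iter_subord_ge0.
- by move=> s; exact: iter_subord_ge0.
Qed.

Lemma le_iter_subord n f g t : measurable_fun [set: R] f -> measurable_fun [set: R] g ->
  (forall s, 0 <= f s)%E -> (forall s, f s <= g s)%E ->
  (iter n subord f t <= iter n subord g t)%E.
Proof.
move=> mf mg f0 fg; have g0 s : (0 <= g s)%E by exact: le_trans (f0 s) (fg s).
elim: n t => [//|n ih] t /=; apply: le_subord => //.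
- exact: measurable_iter_subord.
- exact: measurable_iter_subord.
- by move=> s; exact: iter_subord_ge0.
Qed.

Lemma subord1 t : 0 < t -> subord (cst 1%E) t = 1%E.
Proof.
move=> t0; have st0 : 0 < Num.sqrt (2 * t) by rewrite sqrtr_gt0 mulr_gt0.
have sp0 : 0 < Num.sqrt pi :> R by rewrite sqrtr_gt0 pi_gt0.
transitivity (\int[mu]_(w in `]0%R, +oo[)
   (2 / Num.sqrt (2 * pi * t) * (w `^ (1 - 1) * expR (- (w ^+ 2 / (2 * t)))))%:E)%E.
  rewrite integral_itv0y_if; apply: eq_integral => w _; rewrite /absheat.
  case: ifPn => w0; last by rewrite mule0.
  by rewrite mul1e; congr EFin; rewrite /heat_kernel subrr powRr0; ring.
rewrite ge0_integral_mulrEFin//; last 2 first.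
- by mfun.
- by move=> w _; rewrite mulr_ge0 ?powR_ge0 ?expR_ge0.
rewrite mellin_gauss// egamma_half -!EFinM; congr EFin.
have -> : Num.sqrt (2 * pi * t) = Num.sqrt pi * Num.sqrt (2 * t).
  by rewrite -sqrtrM ?pi_ge0//; congr Num.sqrt; ring.
rewrite div1r powR12_sqrt ?mulr_ge0 ?ltW//.
move: (Num.sqrt (2 * t)) (Num.sqrt pi) st0 sp0 => x y x0 y0.
by field0.
Qed.

Lemma iter_subord1 n t : 0 < t -> iter n subord (cst 1%E) t = 1%E.
Proof.
elim: n t => [//|n ih] t t0 /=; rewrite -[RHS](subord1 t0).
by apply: eq_subord => s s0; exact: ih.
Qed.

Lemma iter_subord_powR n t : 0 < t ->
  iter n subord (fun w => ((2 * w) `^ (- nu 1) / Gamma (1 - nu 1))%:E) t =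
  ((2 * t) `^ (- nu n.+1) / Gamma (1 - nu n.+1))%:E.
Proof.
elim: n t => [//|n ih] t t0 /=.
rewrite (nuS n.+1) -subord_powR ?nu_gt0 ?nu_lt1 ?egamma_nu_fin//.
by apply: eq_subord => s s0; exact: ih.
Qed.

(** The case a = 1/2 escapes [abel_subord]: the order 2a = 1 would meet a pole of Gamma. Here (t -
    tau)^(-1/2) is itself a multiple of [heat_kernel 0 (t - tau)], so the first-passage identity
    applies with y = 0, and the weight [|w|] cancels the factor 1 / w that it produces. The absolute
    value keeps the integrand nonnegative on the whole line. *)
Lemma abel_subord_id f t : 0 < t -> measurable_fun [set: R] f -> (forall s, 0 <= f s)%E ->
  abel (1 / 2) (subord (fun w => `|w|%:E * f w)%E) t = ((Num.sqrt 2)%:E * subord f t)%E.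
Proof.
move=> t0 mf f0.
transitivity (\int[mu]_tau \int[mu]_w
   ((abelk (1 / 2) t tau)%:E * (`|w|%:E * f w * (absheat w tau)%:E)))%E.
  apply: eq_integral => tau _; rewrite ge0_integralZl//.
  - by emf.
  - by move=> s _; rewrite !mule_ge0// lee_fin absheat_ge0.
  - by rewrite lee_fin abelk_ge0//; lra.
rewrite (@fubini_tonelli _ _ _ _ _ lebesgue_measure lebesgue_measure (fun p : R * R =>
   ((abelk (1 / 2) t p.1)%:E * (`|p.2|%:E * f p.2 * (absheat p.2 p.1)%:E))%E))/=; last 2 first.
- by emf.
- move=> [tau s]/=; rewrite !mule_ge0// ?lee_fin ?absheat_ge0//.
  by rewrite abelk_ge0//; lra.
rewrite /subord -ge0_integralZl//; last 2 first.
- by emf.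
- by move=> s _; rewrite mule_ge0// lee_fin absheat_ge0.
apply: eq_integral => w _; have [w0|w0] := boolP (0 < w); last first.
  rewrite integral0_eq => [|tau _]; rewrite /absheat (negbTE w0) ?mule0//.
transitivity (\int[mu]_tau ((w%:E * f w * (Num.sqrt 2)%:E) *
  (if (0 < tau)%R && (tau < t)%R then
     (tau^-1 * heat_kernel 0 (t - tau))%:E * (absheat w tau)%:E else 0)))%E.
  apply: eq_integral => tau _; rewrite /abelk gtr0_norm//.
  case: ifPn => [/andP[tau0 taut]|_]; last by rewrite mul0e mule0.
  have u0 : 0 < t - tau by rewrite subr_gt0.
  have -> : tau^-1 * (t - tau) `^ (- (1 / 2)) / Gamma (1 - 1 / 2) =
      Num.sqrt 2 * (tau^-1 * heat_kernel 0 (t - tau)).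
    rewrite /heat_kernel expr0n/= mul0r oppr0 expR0.
    rewrite (_ : 1 - 1 / 2 = 1 / 2); last by field.
    rewrite GammaE ?egamma_half/=; last lra.
    rewrite powRN div1r powR12_sqrt ?(ltW u0)//.
    have -> : Num.sqrt (2 * pi * (t - tau)) = Num.sqrt 2 * Num.sqrt pi * Num.sqrt (t - tau).
      by rewrite -!sqrtrM ?mulr_ge0 ?pi_ge0.
    have s20 : 0 < Num.sqrt 2 :> R by rewrite sqrtr_gt0.
    have sp0 : 0 < Num.sqrt pi :> R by rewrite sqrtr_gt0 pi_gt0.
    have su0 : 0 < Num.sqrt (t - tau) by rewrite sqrtr_gt0.
    by field0.
  by rewrite EFinM muleACA [((Num.sqrt 2)%:E * _)%E]muleC.
rewrite ge0_integralZl//; last 3 first.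
- rewrite (_ : (fun _ => _) = (fun tau => (if (0 < tau)%R && (tau < t)%R then
     (tau^-1 * heat_kernel 0 (t - tau)) * absheat w tau else 0)%:E)); last first.
    by apply/funext => tau; case: ifPn => //; rewrite EFinM.
  by apply/measurable_EFinP; mfuna.
- move=> tau _; case: ifPn => // /andP[tau0 _].
  by rewrite -EFinM lee_fin !mulr_ge0 ?invr_ge0 ?absheat_ge0 ?heat_kernel_ge0 ?(ltW tau0).
- by rewrite !mule_ge0// lee_fin ?sqrtr_ge0 ?ltW.
rewrite abelk_first_passage// addr0 /absheat w0.
rewrite [(w%:E * f w)%E]muleC [in RHS]muleCA -!muleA -!EFinM.
by congr (_ * _%:E)%E; field0.
Qed.

(** The weight [|w|] sits innermost. Each outer [subord] doubles the order of the Abel integral that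
    has to act further inside, until order 1/2 meets [abel_subord_id]. With k = [nu n.+2] the
    constants reproduce themselves: k 2^(1-k) 2^(2k-1) / (2k) = 2^(k-1). *)
Lemma abel_iter_subord n f t : 0 < t -> measurable_fun [set: R] f -> (forall s, 0 <= f s)%E ->
  ((nu n.+1)%:E * abel (nu n.+1) (iter n.+1 subord (fun w => `|w|%:E * f w)) t =
   (2 `^ (nu n.+1 - 1))%:E * iter n.+1 subord f t)%E.
Proof.
move=> + mf f0; elim: n t => [|n ih] t t0.
  rewrite /= (_ : nu 1 = 1 / 2); last by rewrite /nu expr1.
  rewrite abel_subord_id// muleA -EFinM; congr (_%:E * _)%E.
  rewrite powRB_gt0// powRr1// div1r powR12_sqrt//.
  by rewrite mulrC.
set h := (fun w => _); set k := nu n.+2.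
have k1 : 2 * k = nu n.+1 by rewrite /k nuS; field.
have mh : measurable_fun [set: R] h.
  by rewrite /h; emf.
have h0 s : (0 <= h s)%E by rewrite /h mule_ge0.
rewrite iterS abel_subord ?k1 ?nu_gt0 ?nu_lt1 ?egamma_nu_fin//; last 2 first.
- exact: measurable_iter_subord.
- by move=> s; exact: iter_subord_ge0.
have n0 := nu_gt0 (R := R) n.+1.
have E r : 0 < r -> abel (nu n.+1) (iter n.+1 subord h) r =
    ((2 `^ (nu n.+1 - 1) / nu n.+1)%:E * iter n.+1 subord f r)%E.
  move=> r0; rewrite mulrC EFinM -muleA -ih// muleA -EFinM mulVf ?mul1e//.
  by rewrite gt_eqF.
rewrite (eq_subord _ E) subordZ ?lee_fin ?divr_ge0 ?powR_ge0 ?(ltW n0)//; last 2 first.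
- exact: measurable_iter_subord.
- by move=> s; exact: iter_subord_ge0.
rewrite !muleA -!EFinM [iter n.+2 _ _]iterS; congr (_%:E * _)%E.
rewrite -k1 !powRB_gt0// powRr1// (_ : 2 `^ (2 * k) = 2 `^ k * 2 `^ k); last first.
  by rewrite -powRD_gt0//; congr powR; ring.
have : 0 < 2 `^ k :> R by rewrite powR_gt0.
have : 0 < k by exact: nu_gt0.
by move=> k0 q0; field0.
Qed.

End iterated_subordination.

(** * Iterated densities and a formula for [p_CI] *)

Section densities.
Context {R : realType}.
Local Notation mu := lebesgue_measure.
Implicit Types (f g : R -> \bar R) (s t : R).

(** Measurability jointly in the parameter and the time is what Tonelli's theorem asks for when an
    integral over the parameter is moved through the iterates. *)
Lemma measurable_iter_subord2 n (h : R * R -> \bar R) :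
  measurable_fun [set: R * R] h -> (forall p, 0 <= h p)%E ->
  measurable_fun [set: R * R] (fun p => iter n subord (fun w => h (p.1, w)) p.2).
Proof.
move=> mh h0; elim: n => [|n ih] /=.
  rewrite (_ : (fun p => _) = h)//; apply/funext => -[]//.
have H := @measurable_fun_fubini_tonelli_F _ _ _ _ R lebesgue_measure
    (fun p : (R * R) * R => iter n subord (fun w => h (p.1.1, w)) p.2 * (absheat p.2 p.1.2)%:E)%E.
apply: H.
- apply: emeasurable_funM.
    apply: (measurableT_comp ih (g := fun p : (R * R) * R => (p.1.1, p.2))).
    apply: measurable_fun_pair; last exact: measurable_snd.
    exact: (measurableT_comp measurable_fst measurable_fst).
  apply/measurable_EFinP; apply: measurable_absheat; first exact: measurable_snd.
  exact: (measurableT_comp measurable_snd measurable_fst).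
- by move=> [[a b] c]/=; rewrite mule_ge0// ?lee_fin ?absheat_ge0// iter_subord_ge0.
Qed.

Lemma iter_subord_swap n (h : R * R -> \bar R) t : 0 < t ->
  measurable_fun [set: R * R] h -> (forall p, 0 <= h p)%E ->
  (\int[mu]_s iter n subord (fun w => h (s, w)) t =
   iter n subord (fun w => \int[mu]_s h (s, w)) t)%E.
Proof.
move=> + mh h0; elim: n t => [//|n ih] t t0 /=.
transitivity (\int[mu]_s \int[mu]_w (iter n subord (fun w => h (s, w)) w * (absheat w t)%:E))%E.
  by [].
have mi := measurable_iter_subord2 n mh h0.
rewrite (@fubini_tonelli _ _ _ _ _ lebesgue_measure lebesgue_measure
  (fun p : R * R => iter n subord (fun w => h (p.1, w)) p.2 * (absheat p.2 t)%:E)%E)/=; last 2 first.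
- by apply: emeasurable_funM => //; emf.
- by move=> [a b]/=; rewrite mule_ge0// ?lee_fin ?absheat_ge0// iter_subord_ge0.
apply: eq_integral => w _; rewrite /absheat.
have [w0|w0] := boolP (0 < w); last by rewrite integral0_eq ?mule0// => s _; rewrite mule0.
rewrite -ih// ge0_integralZr//.
- exact: (measurableT_comp mi (measurable_pair2 w)).
- by move=> s _; exact: iter_subord_ge0.
- by rewrite lee_fin mulr_ge0 ?heat_kernel_ge0.
Qed.

(* Twice the density at s > 0 of the iterated Brownian motion. *)
Definition iterated_density n s t : \bar R :=
  iter n subord (fun w => (absheat s w)%:E) t.

Lemma iterated_density_ge0 n s t : (0 <= iterated_density n s t)%E.
Proof. by apply: iter_subord_ge0 => w; rewrite lee_fin absheat_ge0. Qed.

Lemma measurable_iterated_density n :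
  measurable_fun [set: R * R] (fun p => iterated_density n p.1 p.2).
Proof.
apply: (@measurable_iter_subord2 n (fun p : R * R => (absheat p.1 p.2)%:E)).
- by apply/measurable_EFinP; apply: measurable_absheat.
- by move=> p; rewrite lee_fin absheat_ge0.
Qed.

(** [iterated_density n] holds n + 1 kernels: the innermost one, integrated against [f], is itself a
    subordination, whence [n.+1]. *)
Lemma integral_iterated_density n (f : R -> R) t : 0 < t ->
  measurable_fun [set: R] f -> (forall s, 0 <= f s) ->
  (\int[mu]_s ((f s)%:E * iterated_density n s t) = iter n.+1 subord (EFin \o f) t)%E.
Proof.
move=> t0 mf f0.
rewrite iterSr -(@iter_subord_swap n (fun p : R * R => (f p.1)%:E * (absheat p.1 p.2)%:E)%E)//.
- apply: eq_integral => s _; rewrite -iter_subordZ ?lee_fin//.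
  + by emf.
  + by move=> w; rewrite lee_fin absheat_ge0.
- apply: emeasurable_funM; first by apply/measurable_EFinP; apply: measurableT_comp.
  by emf.
- by move=> p; rewrite mule_ge0// lee_fin ?absheat_ge0.
Qed.

(** The heat kernel at the origin is the normalized power of order 1/2, on which [subord_powR] can
    be iterated. *)
Lemma heat_kernel0 (w : R) : 0 < w ->
  heat_kernel 0 w = (2 * w) `^ (- nu 1) / Gamma (1 - nu 1).
Proof.
move=> w0; rewrite (_ : nu 1 = 2^-1); last by rewrite /nu expr1 div1r.
rewrite (_ : 1 - 2^-1 = 1 / 2); last by field.
rewrite GammaE ?egamma_half/=; last lra.
rewrite powRN powR12_sqrt ?mulr_ge0 ?(ltW w0)//.
rewrite /heat_kernel expr0n/= mul0r oppr0 expR0 div1r -invfM -sqrtrM ?mulr_ge0 ?(ltW w0)//.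
by congr (Num.sqrt _)^-1; ring.
Qed.

Lemma iter_subord_heat_kernel0 n t : 0 < t ->
  iter n subord (fun w => (heat_kernel 0 w)%:E) t =
  ((2 * t) `^ (- nu n.+1) / Gamma (1 - nu n.+1))%:E.
Proof.
move=> t0; rewrite -iter_subord_powR//; apply: eq_iter_subord => // s s0.
by rewrite heat_kernel0.
Qed.

Lemma absheat_le s w : absheat s w <= 2 * heat_kernel 0 w.
Proof.
rewrite /absheat; case: ifPn => _; last by rewrite mulr_ge0 ?heat_kernel_ge0.
by rewrite ler_pM2l// heat_kernel_le_center.
Qed.

Lemma iterated_density_fin n s t : 0 < t -> iterated_density n s t \is a fin_num.
Proof.
move=> t0; rewrite ge0_fin_numE ?iterated_density_ge0//.
apply: (@le_lt_trans _ _ (iter n subord (fun w => 2%:E * (heat_kernel 0 w)%:E)%E t)).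
  apply: le_iter_subord.
  - by emf.
  - by apply: emeasurable_funM; apply/measurable_EFinP; mfunh.
  - by move=> w; rewrite lee_fin absheat_ge0.
  - by move=> w; rewrite -EFinM lee_fin absheat_le.
rewrite iter_subordZ//.
- by rewrite iter_subord_heat_kernel0// -EFinM ltry.
- by apply/measurable_EFinP; mfunh.
- by move=> w; rewrite lee_fin heat_kernel_ge0.
Qed.

Lemma iterated_density_le0 n s t : 0 < t -> s <= 0 -> iterated_density n s t = 0%E.
Proof.
move=> t0 s0; rewrite /iterated_density (_ : (fun _ => _) = cst 0%E); last first.
  by apply/funext => z; rewrite /absheat ltNge s0.
elim: n t t0 => [//|n ih] t t0 /=; rewrite /subord integral0_eq// => z _.
rewrite /absheat; case: ifPn => [z0|_]; last by rewrite mule0.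
by rewrite ih ?mul0e.
Qed.

Lemma measurable_fine_iterated_density n t :
  measurable_fun [set: R] (fun s => fine (iterated_density n s t)).
Proof.
apply: measurableT_comp => //.
exact: (measurableT_comp (measurable_iterated_density n) (measurable_pair2 t)).
Qed.

Lemma eq_iterated_integral k (F G : seq R -> R) :
  (forall ws, size ws = k -> F ws = G ws) -> iterated_integral k F = iterated_integral k G.
Proof.
elim: k F G => [|k ih] F G FG /=; first exact: FG.
by apply: eq_Rintegral => w _; apply: ih => ws sws; apply: FG; rewrite /= sws.
Qed.

(** The constant [c] makes the induction work: peeling off the outermost variable leaves its heat
    kernel as a factor of the inner integral. The divisions by 2 undo the n + 1 doublings contained
    in [absheat]. *)
Lemma iterated_integral_heat_kernel n (c s t : R) : 0 < t -> 0 <= c -> 0 < s ->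
  iterated_integral n (fun ws => c * \prod_(0 <= i < n.+1)
     heat_kernel (s :: rcons ws t)`_i (s :: rcons ws t)`_i.+1) =
  c * (fine (iterated_density n s t) / 2 / 2 ^+ n).
Proof.
move=> t0; elim: n c s => [|n ih] c s c0 s0.
  rewrite /= big_nat1 /= expr0 divr1 /absheat s0; congr (_ * _).
  by rewrite mulrC mulKf.
rewrite /=.
transitivity (\int[mu]_(w in `]0%R, +oo[)
   (c / 2 / 2 ^+ n / 2 * (2 * heat_kernel s w * fine (iterated_density n w t)))).
  apply: eq_Rintegral => w; rewrite inE itv0yE => w0.
  transitivity (c * heat_kernel s w * (fine (iterated_density n w t) / 2 / 2 ^+ n)).
    rewrite -ih ?mulr_ge0 ?heat_kernel_ge0//; apply: eq_iterated_integral => ws _.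
    by rewrite big_nat_recl//= mulrA.
  by field; rewrite expf_neq0.
have c1 : 0 <= c / 2 / 2 ^+ n / 2 by rewrite !divr_ge0// exprn_ge0.
rewrite /Rintegral ge0_integral_mulrEFin//; last 2 first.
- apply: measurable_funTS; apply: measurable_funM; first by mfunh.
  exact: measurable_fine_iterated_density.
- by move=> w _; rewrite !mulr_ge0 ?heat_kernel_ge0// fine_ge0// iterated_density_ge0.
have -> : (\int[mu]_(w in `]0%R, +oo[)
   (2 * heat_kernel s w * fine (iterated_density n w t))%:E = iterated_density n.+1 s t)%E.
  rewrite integral_itv0y_if /iterated_density.
  rewrite (_ : (fun w => (absheat s w)%:E) = EFin \o absheat s)//.
  rewrite -integral_iterated_density//.
  - apply: eq_integral => w _; case: ifPn => w0.
      by rewrite EFinM fineK ?iterated_density_fin// /absheat s0.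
    by rewrite iterated_density_le0 ?mule0// leNgt.
  - by apply: measurable_absheat.
  - exact: absheat_ge0.
rewrite -(fineK (iterated_density_fin n.+1 s t0)) /= exprS.
by field; rewrite expf_neq0.
Qed.

Lemma p_iteratedE n s t : 0 < t -> 0 < s ->
  p_iterated n s t = fine (iterated_density n s t) / 2.
Proof.
move=> t0 s0; rewrite /p_iterated.
rewrite (@eq_iterated_integral n _ (fun ws => 1 * \prod_(0 <= i < n.+1)
   heat_kernel (s :: rcons ws t)`_i (s :: rcons ws t)`_i.+1)); last first.
  by move=> ws _; rewrite mul1r.
rewrite iterated_integral_heat_kernel// mul1r.
by field; rewrite expf_neq0.
Qed.

Lemma cauchy_kernel_ge0 (x s : R) : 0 <= s -> 0 <= cauchy_kernel x s.
Proof.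
by move=> s0; rewrite /cauchy_kernel divr_ge0// mulr_ge0 ?pi_ge0// addr_ge0 ?sqr_ge0.
Qed.

Lemma measurable_cauchy_kernel d (T : measurableType d) (D : set T) (f g : T -> R) :
  measurable_fun D f -> measurable_fun D g ->
  measurable_fun D (fun x => cauchy_kernel (f x) (g x)).
Proof. by move=> mf mg; rewrite /cauchy_kernel; mfun. Qed.

Lemma p_CIE n x t : 0 < t ->
  p_CI n x t = fine (iter n.+1 subord (fun s => (cauchy_kernel x `|s|)%:E) t).
Proof.
move=> t0; rewrite /p_CI.
rewrite (_ : (fun s => _) = EFin \o (fun s => cauchy_kernel x `|s|))//.
rewrite -integral_iterated_density//; last 2 first.
- by apply: measurable_cauchy_kernel; mfun.
- by move=> s; exact: cauchy_kernel_ge0.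
have pi0 : 0 < pi :> R by exact: pi_gt0.
have -> : (\int[mu]_s ((cauchy_kernel x `|s|)%:E * iterated_density n s t) =
  (2 / pi)%:E * \int[mu]_(s in `]0%R, +oo[) (s / (s ^+ 2 + x ^+ 2) * p_iterated n s t)%:E)%E.
  transitivity ((2 / pi)%:E * \int[mu]_(s in `]0%R, +oo[)
      (s / (s ^+ 2 + x ^+ 2) * (fine (iterated_density n s t) / 2))%:E)%E; last first.
    congr (_ * _)%E; apply: eq_integral => s; rewrite inE itv0yE => s0.
    by rewrite p_iteratedE.
  rewrite -ge0_integral_mulrEFin//; last 3 first.
  - apply: measurable_funTS; apply: measurable_funM; first by mfun.
    by apply: measurable_funM => //; exact: measurable_fine_iterated_density.
  - move=> s; rewrite itv0yE => s0.
    rewrite mulr_ge0// divr_ge0// ?addr_ge0 ?sqr_ge0 ?(ltW s0)//.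
    by rewrite fine_ge0// iterated_density_ge0.
  - by rewrite divr_ge0// ltW.
  rewrite integral_itv0y_if; apply: eq_integral => s _; case: ifPn => s0; last first.
    by rewrite iterated_density_le0 ?mule0// leNgt.
  rewrite -[in LHS](fineK (iterated_density_fin n s t0)) -!EFinM; congr EFin.
  rewrite /cauchy_kernel gtr0_norm//; move: (pi : R) pi0 => q q0.
  by field0; rewrite ltr_wpDr ?sqr_ge0 ?exprn_gt0.
(* For x = 0 the integral may be infinite; both sides are then the default value 0, so that no
   condition on x is needed. *)
rewrite /Rintegral; case: (\int[_]_(_ in _) _)%E => [r| |] //=.
  by rewrite gt0_muley ?mulr0// lte_fin divr_gt0.
by rewrite gt0_muleNy ?mulr0// lte_fin divr_gt0.
Qed.

End densities.

(** * Derivatives of subordinated functions *)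

Section bounded_functions.
Context {R : realType}.
Local Notation mu := lebesgue_measure.
Implicit Types (phi psi m : R -> R) (s t : R).

Definition bounded_mfun phi :=
  measurable_fun [set: R] phi /\ exists M, forall s, `|phi s| <= M.

Lemma integrable_mul_bounded d (T : measurableType d) (P : {measure set T -> \bar R})
    (D : set T) (f g : T -> R) (M : R) : measurable D ->
  measurable_fun D f -> (forall x, D x -> `|f x| <= M) ->
  P.-integrable D (EFin \o g) -> P.-integrable D (fun x => (f x * g x)%:E).
Proof.
move=> mD mf fM ig; rewrite (_ : (fun x => _) = (EFin \o f) \* (EFin \o g))%E.
  apply: integrableMr => //; exists M; split; first exact: num_real.
  by move=> K MK x Dx; apply: le_trans (fM _ Dx) (ltW MK).
by apply/funext => x; rewrite /= EFinM.
Qed.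

Lemma integrable_absheat t : (lebesgue_measure).-integrable [set: R] (EFin \o absheat ^~ t).
Proof.
apply/integrableP; split.
  by apply/measurable_EFinP; apply: measurable_absheat.
have [t0|t0] := ltP 0 t.
  apply: (@le_lt_trans _ _ (subord (cst 1%E) t)); last by rewrite subord1// ltry.
  apply: ge0_le_integral => //=.
  - by emf.
  - by emf.
  - by move=> s _; rewrite mul1e lee_fin ger0_norm// absheat_ge0.
rewrite integral0_eq ?ltry// => s _ /=.
by rewrite /absheat heat_kernel_le0// mulr0 if_same normr0.
Qed.

Lemma integrable_mul_absheat phi t : bounded_mfun phi ->
  (lebesgue_measure).-integrable [set: R] (fun s => (phi s * absheat s t)%:E).
Proof.
move=> [mphi [M phiM]]; apply: (@integrable_mul_bounded _ _ _ _ _ _ M) => //.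
exact: integrable_absheat.
Qed.

(** The real-valued operator S on bounded functions of any sign: differentiation and differences
    leave the nonnegative functions on which [subord] is handled. *)
Definition rsubord phi t : R := \int[mu]_s (phi s * absheat s t).

Lemma EFin_rsubord phi t : bounded_mfun phi ->
  (rsubord phi t)%:E = subord (EFin \o phi) t.
Proof.
move=> bphi; rewrite /rsubord /Rintegral fineK.
  by apply: eq_integral => s _; rewrite EFinM.
by apply: integrable_fin_num => //; exact: integrable_mul_absheat.
Qed.

Lemma rsubord_le0 phi t : t <= 0 -> rsubord phi t = 0.
Proof.
move=> t0; rewrite /rsubord /Rintegral integral0_eq// => s _.
by rewrite /absheat heat_kernel_le0// mulr0 if_same mulr0.
Qed.

Lemma eq_rsubord phi psi t : (forall s, 0 < s -> phi s = psi s) ->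
  rsubord phi t = rsubord psi t.
Proof.
move=> e; apply: eq_Rintegral => s _; rewrite /absheat.
by case: ifPn => [/e->//|_]; rewrite !mulr0.
Qed.

Lemma rsubordB phi psi t : bounded_mfun phi -> bounded_mfun psi ->
  rsubord (phi \- psi) t = rsubord phi t - rsubord psi t.
Proof.
move=> bphi bpsi; rewrite /rsubord -RintegralB//.
- by apply: eq_Rintegral => s _; rewrite mulrBl.
- exact: integrable_mul_absheat.
- exact: integrable_mul_absheat.
Qed.

Lemma rsubordZ (c : R) phi t : bounded_mfun phi ->
  rsubord (fun s => c * phi s) t = c * rsubord phi t.
Proof.
move=> bphi; rewrite /rsubord -RintegralZl//.
- by apply: eq_Rintegral => s _; rewrite mulrA.
- exact: integrable_mul_absheat.
Qed.

Lemma bounded_mfunB phi psi : bounded_mfun phi -> bounded_mfun psi ->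
  bounded_mfun (phi \- psi).
Proof.
move=> [mphi [M phiM]] [mpsi [N psiN]]; split; first exact: measurable_funB.
exists (M + N) => s /=; rewrite (le_trans (ler_normB _ _))// lerD//.
Qed.

Lemma bounded_mfunZ (c : R) phi : bounded_mfun phi -> bounded_mfun (fun s => c * phi s).
Proof.
move=> [mphi [M phiM]]; split; first exact: measurable_funM.
by exists (`|c| * M) => s; rewrite normrM ler_wpM2l.
Qed.

Lemma bounded_mfun_cst (c : R) : bounded_mfun (cst c).
Proof. by split => //; exists `|c|. Qed.

Lemma rsubord1 t : 0 < t -> rsubord (cst 1) t = 1.
Proof.
move=> t0; suff : (rsubord (cst 1) t)%:E = 1%:E by move=> [->].
rewrite EFin_rsubord; last exact: bounded_mfun_cst.
by rewrite (_ : EFin \o cst 1 = cst 1%E)// subord1.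
Qed.

Lemma norm_rsubord_le phi (M : R) t : bounded_mfun phi -> (forall s, `|phi s| <= M) ->
  `|rsubord phi t| <= M.
Proof.
move=> bphi phiM; have M0 : 0 <= M by apply: le_trans (phiM 0).
have [t0|t0] := ltP 0 t; last by rewrite rsubord_le0// normr0.
have iM := integrable_mul_absheat t (bounded_mfun_cst M).
apply: (@le_trans _ _ (rsubord (cst M) t)).
  apply: (le_trans (le_normr_Rintegral _ _)) => //; first exact: integrable_mul_absheat.
  apply: le_Rintegral => //.
    by apply: integrable_norm; exact: integrable_mul_absheat.
  by move=> s _; rewrite normrM [`|absheat _ _|]ger0_norm ?absheat_ge0// ler_wpM2r ?absheat_ge0.
rewrite (_ : cst M = fun s => M * cst 1 s); last by apply/funext => s; rewrite mulr1.
rewrite rsubordZ; last exact: bounded_mfun_cst.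
by rewrite rsubord1// mulr1.
Qed.

Lemma bounded_mfun_rsubord phi : bounded_mfun phi -> bounded_mfun (rsubord phi).
Proof.
move=> bphi; have [mphi [M phiM]] := bphi.
split; last by exists M => t; exact: norm_rsubord_le.
(* Adding the bound M makes the function nonnegative, where measurability of [subord] is
   available. *)
pose psi s := phi s - cst (- M) s.
have bpsi : bounded_mfun psi by apply: bounded_mfunB => //; exact: bounded_mfun_cst.
have psi0 s : 0 <= psi s.
  by rewrite /psi opprK -lerBlDr sub0r; have := phiM s; rewrite ler_norml => /andP[].
have -> : rsubord phi = fun t => fine (subord (EFin \o psi) t) + rsubord (cst (- M)) t.
  apply/funext => t; rewrite -EFin_rsubord//= rsubordB ?subrK//.
  exact: bounded_mfun_cst.
apply: measurable_funD.
  apply: measurableT_comp => //; apply: measurable_subord => //.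
  by apply/measurable_EFinP; case: bpsi.
rewrite (_ : rsubord _ = fun t => if 0 < t then - M else 0); first by mfun.
apply/funext => t; case: ifPn => t0; last by rewrite rsubord_le0// leNgt.
rewrite (_ : cst (- M) = fun s => - M * cst 1 s); last by apply/funext => s; rewrite mulr1.
rewrite rsubordZ; last exact: bounded_mfun_cst.
by rewrite rsubord1// mulr1.
Qed.

Lemma bounded_mfun_iter n phi : bounded_mfun phi -> bounded_mfun (iter n rsubord phi).
Proof. by elim: n => [//|n ih] /= bphi; apply: bounded_mfun_rsubord; exact: ih. Qed.

Lemma iter_rsubordB n phi psi t : bounded_mfun phi -> bounded_mfun psi ->
  iter n rsubord (phi \- psi) t = iter n rsubord phi t - iter n rsubord psi t.
Proof.
move=> bphi bpsi; elim: n t => [//|n ih] t /=.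
transitivity (rsubord (iter n rsubord phi \- iter n rsubord psi) t).
  by apply: eq_rsubord => s _; exact: ih.
by apply: rsubordB; exact: bounded_mfun_iter.
Qed.

Lemma EFin_iter_rsubord n phi t : bounded_mfun phi ->
  (iter n rsubord phi t)%:E = iter n subord (EFin \o phi) t.
Proof.
move=> bphi; elim: n t => [//|n ih] t /=.
rewrite EFin_rsubord; last exact: bounded_mfun_iter.
by apply: eq_subord => s _; exact: ih.
Qed.

Lemma Rintegral_scale (f : R -> R) (c : R) : 0 < c ->
  (lebesgue_measure).-integrable [set: R] (EFin \o f) ->
  \int[mu]_x f x = c * \int[mu]_x f (c * x).
Proof.
move=> c0 intf; have mf : measurable_fun [set: R] (EFin \o f) by case/integrableP: intf.
have E (g : R -> \bar R) : measurable_fun [set: R] g -> (forall x, 0 <= g x)%E ->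
    (\int[mu]_x g x = c%:E * \int[mu]_x g (c * x)%R)%E.
  move=> mg g0; rewrite (ge0_integral_affine 0 c0)//.
  by under eq_integral do rewrite add0r.
rewrite /Rintegral integralE [in RHS]integralE.
have fp : (\int[mu]_x (EFin \o f)^\+ x)%E \is a fin_num by exact: integrable_pos_fin_num.
have fn : (\int[mu]_x (EFin \o f)^\- x)%E \is a fin_num by exact: integrable_neg_fin_num.
move: fp fn; rewrite E; [|exact: measurable_funepos|by []].
rewrite (E (EFin \o f)^\-)%E; [|exact: measurable_funeneg|by []].
rewrite (_ : (\int[mu]_x (fun x => (f (c * x)%R)%:E)^\+ x =
  \int[mu]_x (EFin \o f)^\+ (c * x)%R)%E); last by apply: eq_integral => x _; rewrite !funeposE.
rewrite (_ : (\int[mu]_x (fun x => (f (c * x)%R)%:E)^\- x =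
  \int[mu]_x (EFin \o f)^\- (c * x)%R)%E); last by apply: eq_integral => x _; rewrite !funenegE.
have p0 : (0 <= \int[mu]_x (EFin \o f)^\+ (c * x)%R)%E by exact: integral_ge0.
have n0 : (0 <= \int[mu]_x (EFin \o f)^\- (c * x)%R)%E by exact: integral_ge0.
move: (\int[mu]_x _)%E (\int[mu]_x _)%E p0 n0 => [a| |] [b| |] // _ _;
  rewrite ?gt0_muley ?lte_fin//.
by move=> _ _; rewrite -!EFinM /= mulrBr.
Qed.

Lemma absheat_scale t y : 0 < t -> Num.sqrt t * absheat (Num.sqrt t * y) t = absheat y 1.
Proof.
move=> t0; have st0 : 0 < Num.sqrt t by rewrite sqrtr_gt0.
rewrite /absheat pmulr_rgt0//; case: ifPn => y0; last by rewrite mulr0.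
rewrite /heat_kernel exprMn sqr_sqrtr ?(ltW t0)//.
have -> : t * y ^+ 2 / (2 * t) = y ^+ 2 / (2 * 1) by field; rewrite gt_eqF.
rewrite sqrtrM ?mulr_ge0 ?pi_ge0// !mulr1.
have : 0 < Num.sqrt (2 * pi) :> R by rewrite sqrtr_gt0 mulr_gt0 ?pi_gt0.
by move: (Num.sqrt (2 * pi)) => q q0; field0.
Qed.

(** Brownian scaling moves t from the kernel into the argument of [phi], so that a derivative in t
    falls on [phi]. *)
Lemma rsubord_scale phi t : 0 < t -> bounded_mfun phi ->
  rsubord phi t = \int[mu]_(y in `]0%R, +oo[) (phi (Num.sqrt t * y) * absheat y 1).
Proof.
move=> t0 bphi; have st0 : 0 < Num.sqrt t by rewrite sqrtr_gt0.
rewrite /rsubord (Rintegral_scale st0); last exact: integrable_mul_absheat.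
rewrite -RintegralZl//; last first.
  have [mphi [M phiM]] := bphi.
  rewrite (_ : EFin \o _ = fun x => (phi (Num.sqrt t * x) / Num.sqrt t * absheat x 1)%:E).
    apply: (@integrable_mul_bounded _ _ _ _ _ _ (M / Num.sqrt t)) => //.
    - by apply: measurable_funM => //; apply: (measurableT_comp mphi); mfun.
    - move=> x _; rewrite normrM normfV [`|Num.sqrt t|]gtr0_norm//.
      by rewrite ler_wpM2r// invr_ge0 ltW.
    - exact: integrable_absheat.
  by apply/funext => x /=; rewrite -(absheat_scale x t0); congr EFin; field0.
rewrite [RHS]Rintegral_mkcond; apply: eq_Rintegral => y _.
rewrite patchE mem_setE in_itv/= andbT -(absheat_scale y t0).
by case: ifPn => y0; [ring|rewrite /absheat pmulr_rgt0// (negbTE y0) !mulr0].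
Qed.

(** In scaled form the x-derivative of phi (sqrt x * y) is m (sqrt x * y) / (2 x): it involves [phi]
    only through m = s phi'. The conclusion again has the shape of the hypothesis on [phi], so the
    lemma iterates. *)
Lemma is_derive_rsubord phi m t : bounded_mfun phi -> bounded_mfun m ->
  (forall s, 0 < s -> is_derive s 1 phi (m s / s)) -> 0 < t ->
  is_derive t 1 (rsubord phi) (2^-1 * rsubord m t / t).
Proof.
move=> bphi bm dphi t0.
have [mphi [M phiM]] := bphi; have [mm [N mN]] := bm.
have N0 : 0 <= N by apply: le_trans (mN 0).
pose f (x y : R) := phi (Num.sqrt x * y) * absheat y 1.
have It : `](t / 2), (2 * t)[%classic t by rewrite /= in_itv/=; apply/andP; split; lra.
have I0 (x : R) : `](t / 2), (2 * t)[%classic x -> 0 < x.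
  by rewrite /= in_itv/= => /andP[+ _]; apply: lt_trans; lra.
have df (x y : R) : 0 < x -> 0 < y ->
    is_derive x 1 (f ^~ y) (m (Num.sqrt x * y) / (2 * x) * absheat y 1).
  move=> x0 y0; have sx0 : 0 < Num.sqrt x by rewrite sqrtr_gt0.
  have d1 := is_derive1_sqrt x0.
  have d2 : is_derive x 1 (fun x => Num.sqrt x * y) (y / (2 * Num.sqrt x)).
    by apply: is_derive_eq; rewrite /GRing.scale/=; field0.
  have d3 := dphi _ (mulr_gt0 sx0 y0).
  have d4 := @is_derive1_comp _ phi (fun x => Num.sqrt x * y) x _ _ d3 d2.
  rewrite /f; apply: is_derive_eq; rewrite /GRing.scale/=.
  have xE : x = Num.sqrt x ^+ 2 by rewrite sqr_sqrtr// ltW.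
  have -> : m (Num.sqrt x * y) / (2 * x) = m (Num.sqrt x * y) / (2 * Num.sqrt x ^+ 2).
    by rewrite -xE.
  by field0.
have intf (x : R) : `](t / 2), (2 * t)[%classic x ->
    (lebesgue_measure).-integrable `]0, +oo[ (EFin \o f x).
  move=> Ix; apply: (@integrable_mul_bounded _ _ _ _ _ _ M) => //.
    by apply: measurable_funTS; apply: (measurableT_comp mphi); mfun.
  by apply: integrableS (integrable_absheat 1).
have derf1 (x y : R) : `](t / 2), (2 * t)[%classic x -> `]0, +oo[%classic y -> derivable (f ^~ y) x 1.
  by move=> /I0 x0; rewrite itv0yE => y0; have [] := df x y x0 y0.
(* A dominating function on the window ]t / 2, 2 t[: there 1 / (2 x) <= 1 / t. *)
pose G (y : R) := N / t * absheat y 1.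
have G0 y : 0 <= G y by rewrite mulr_ge0 ?absheat_ge0// divr_ge0// ltW.
have intG : (lebesgue_measure).-integrable `]0, +oo[ (EFin \o G).
  apply: (@integrable_mul_bounded _ _ _ _ (cst (N / t)) _ `|N / t|) => //.
  by apply: integrableS (integrable_absheat 1).
have d1E (x y : R) : 0 < x -> 0 < y ->
    partial1of2 f x y = m (Num.sqrt x * y) / (2 * x) * absheat y 1.
  by move=> x0 y0; rewrite partial1of2E; have := df x y x0 y0; move=> ?; rewrite derive_val.
have Gub (x y : R) : `](t / 2), (2 * t)[%classic x -> `]0, +oo[%classic y ->
    `|partial1of2 f x y| <= G y.
  move=> Ix; rewrite itv0yE => y0; have x0 := I0 _ Ix; rewrite d1E//.
  rewrite normrM [`|absheat _ _|]ger0_norm ?absheat_ge0// ler_wpM2r ?absheat_ge0//.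
  rewrite normrM ler_pM// normfV gtr0_norm ?mulr_gt0//.
  rewrite lef_pV2 ?posrE ?mulr_gt0//.
  by move: Ix; rewrite /= in_itv/= => /andP[h _]; lra.
have mI : measurable (`]0, +oo[%classic : set (measurableTypeR R)) by exact: measurable_itv.
have D := @derivable_under_integral R _ (measurableTypeR R) lebesgue_measure f _ mI _ _ _ It intf derf1 _ G0 intG Gub.
have V := @differentiation_under_integral R _ (measurableTypeR R) lebesgue_measure f _ mI _ _ _ It intf derf1 _ G0 intG Gub.
have d : is_derive t 1 (fun x => \int[mu]_(y in `]0%R, +oo[) f x y) (2^-1 * rsubord m t / t).
  apply: DeriveDef => //; rewrite -derive1E V.
  rewrite rsubord_scale// mulrAC -RintegralZl//; last first.
    apply: (@integrable_mul_bounded _ _ _ _ _ _ N) => //.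
      by apply: measurable_funTS; apply: (measurableT_comp mm); mfun.
    by apply: integrableS (integrable_absheat 1).
  apply: eq_Rintegral => y; rewrite inE itv0yE => y0; rewrite d1E//.
  by field; rewrite gt_eqF.
apply: near_eq_is_derive d; near=> x; rewrite rsubord_scale//.
by near: x; exact: lt_nbhsr.
Unshelve. all: by end_near.
Qed.

(** Each application replaces [m] by half its mean; the halves multiply to [nu n]. *)
Lemma is_derive_iter_rsubord n phi m t : bounded_mfun phi -> bounded_mfun m ->
  (forall s, 0 < s -> is_derive s 1 phi (m s / s)) -> 0 < t ->
  is_derive t 1 (iter n rsubord phi) (nu n * iter n rsubord m t / t).
Proof.
move=> bphi bm dphi; elim: n t => [|n ih] t t0.
  by rewrite /= /nu expr0 divr1 mul1r; exact: dphi.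
have bi := bounded_mfun_iter n bm.
have H := @is_derive_rsubord (iter n rsubord phi) (fun s => nu n * iter n rsubord m s) t
  (bounded_mfun_iter n bphi) (bounded_mfunZ _ bi) ih t0.
rewrite /= nuS; apply: is_derive_eq; rewrite rsubordZ//.
by ring.
Qed.

End bounded_functions.

(** * Integration by parts against the heat kernel *)

Section integration_by_parts.
Context {R : realType}.
Local Notation mu := lebesgue_measure.

Lemma cvg_heat_kernel_pinfty (w : R) : 0 < w -> heat_kernel s w @[s --> +oo] --> (0 : R).
Proof.
move=> w0; have c0 : 0 < Num.sqrt (2 * w) by rewrite sqrtr_gt0 mulr_gt0.
rewrite -[X in _ --> X](mul0r (Num.sqrt (2 * pi * w))^-1).
apply: cvgM; last exact: cvg_cst.
have -> : (fun s => expR (- (s ^+ 2 / (2 * w)))) = (@gauss_fun R) \o (fun s => s * (Num.sqrt (2 * w))^-1).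
  apply/funext => s; rewrite /gauss_fun /= exprMn exprVn sqr_sqrtr//.
  by rewrite mulr_ge0// ltW.
apply: (@cvg_comp _ _ _ (fun s : R => s * (Num.sqrt (2 * w))^-1) (@gauss_fun R) _ (pinfty_nbhs R)); last exact: cvg_gauss_fun.
apply: gt0_cvgMly; last exact: cvg_id.
by rewrite invr_gt0.
Qed.

Lemma is_derive_heat_kernel (s w : R) : 0 < w ->
  is_derive s 1 (heat_kernel ^~ w) (- (s / w * heat_kernel s w)).
Proof.
move=> w0; have d1 : is_derive s 1 (fun s => - (s ^+ 2 / (2 * w))) (- (s / w)).
  by apply: is_derive_eq; rewrite /GRing.scale/=; field0.
have d2 := @is_derive1_comp _ expR _ s _ _ (is_derive_expR _) d1.
rewrite /heat_kernel; apply: is_derive_eq; rewrite /GRing.scale/=.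
by ring.
Qed.

(** Since [phi] decreases on s >= 0, the two terms of the integration by parts have the same sign.
    Written as a sum, the identity holds for extended values without any integrability
    assumption. *)
Lemma subord_by_parts (phi psi : R -> R) (M w : R) : 0 < w ->
  (forall s : R, is_derive s 1 phi (- psi s)) -> continuous psi ->
  (forall s, 0 <= s -> 0 <= psi s) -> (forall s, 0 <= phi s) -> (forall s, phi s <= M) ->
  ((w^-1)%:E * subord (fun s => (`|s| * phi s)%:E) w + subord (fun s => `|psi s|%:E) w =
   (2 * phi 0 * heat_kernel 0 w)%:E)%E.
Proof.
move=> w0 dphi cpsi psi0 phi0 phiM.
have cphi : continuous phi by move=> s; exact: is_derive_continuous_for (dphi s).
have mphi : measurable_fun [set: R] phi by exact: continuous_measurable_fun.
have mpsi : measurable_fun [set: R] psi by exact: continuous_measurable_fun.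
rewrite /subord -ge0_integralZl//; last 3 first.
- by emf.
- by move=> s _; rewrite mule_ge0// lee_fin ?absheat_ge0// mulr_ge0.
- by rewrite lee_fin invr_ge0 ltW.
rewrite -ge0_integralD//=; last 4 first.
- by move=> s _; rewrite !mule_ge0// lee_fin ?absheat_ge0 ?invr_ge0 ?mulr_ge0// ltW.
- by emf.
- by move=> s _; rewrite !mule_ge0// lee_fin ?absheat_ge0.
- by emf.
pose f s := 2 * (s / w * heat_kernel s w * phi s + heat_kernel s w * psi s).
(* [F] is a primitive of [f]; it vanishes at infinity because [phi] is bounded, so only the boundary
   value at 0 survives. *)
pose F s := - (2 * phi s * heat_kernel s w).
have dF (s : R) : is_derive s 1 F (f s).
  have d1 := dphi s; have d2 := is_derive_heat_kernel s w0.
  rewrite /F; apply: is_derive_eq; rewrite /f /GRing.scale/=.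
  by ring.
have ch : continuous (heat_kernel ^~ w).
  by move=> s; exact: is_derive_continuous_for (is_derive_heat_kernel s w0).
have cf : continuous f.
  move=> s; apply: cvgM; first exact: cvg_cst.
  apply: cvgD; last by apply: cvgM; [exact: ch|exact: cpsi].
  apply: cvgM; last exact: cphi.
  by apply: cvgM; [apply: cvgM; [exact: cvg_id|exact: cvg_cst]|exact: ch].
transitivity (\int[mu]_(s in `[0%R, +oo[) (f s)%:E)%E.
  rewrite -integral_itv_obnd_cbnd; last first.
    by apply/measurable_EFinP/measurable_funTS; exact: continuous_measurable_fun.
  rewrite integral_itv0y_if; apply: eq_integral => s _; rewrite /absheat.
  case: ifPn => s0; last by rewrite !mule0 adde0.
  rewrite -!EFinM -EFinD; congr EFin; rewrite !ger0_norm ?psi0 ?ltW// /f.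
  by field0.
rewrite (@ge0_continuous_FTC2y _ f F 0 0).
- by rewrite sub0e; congr EFin; rewrite /F opprK.
- move=> s s0; rewrite /f mulr_ge0// addr_ge0// mulr_ge0 ?heat_kernel_ge0 ?psi0//.
  by rewrite mulr_ge0 ?heat_kernel_ge0// divr_ge0// ltW.
- exact: continuous_subspaceT.
- rewrite /F -oppr0; apply: cvgN.
  apply: (@squeeze_cvgr _ _ _ _ (cst 0) (fun s => 2 * M * heat_kernel s w)).
  + apply: nearW => s; rewrite /cst mulr_ge0 ?heat_kernel_ge0 ?mulr_ge0//=.
    by rewrite ler_wpM2r ?heat_kernel_ge0// ler_pM2l.
  + exact: cvg_cst.
  + rewrite -[X in _ --> X](mulr0 (2 * M)); apply: cvgM; first exact: cvg_cst.
    exact: cvg_heat_kernel_pinfty.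
- by move=> s _; have [] := dF s.
- apply: cvg_at_right_filter; exact: is_derive_continuous_for (dF 0).
- by move=> s _; have d := dF s; rewrite derive1E derive_val.
Qed.

(** The constant in front of [abel] is the one that cancels the power of 2 of [abel_iter_subord].
    What is then left under n + 1 subordinations is the sum computed by [subord_by_parts], whose
    value is a multiple of the heat kernel at the origin and hence has an explicit mean. *)
Lemma abel_iter_subord_by_parts n (phi psi : R -> R) (M t : R) : 0 < t ->
  (forall s : R, is_derive s 1 phi (- psi s)) -> continuous psi ->
  (forall s, 0 <= s -> 0 <= psi s) -> (forall s, 0 <= phi s) -> (forall s, phi s <= M) ->
  ((2 `^ (1 - nu n.+1) * nu n.+1)%:E *
     abel (nu n.+1) (iter n.+2 subord (fun s => (`|s| * phi s)%:E)) t +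
   iter n.+2 subord (fun s => `|psi s|%:E) t =
   (2 * phi 0 * ((2 * t) `^ (- nu n.+2) / Gamma (1 - nu n.+2)))%:E)%E.
Proof.
move=> t0 dphi cpsi psi0 phi0 phiM.
have cphi : continuous phi by move=> s; exact: is_derive_continuous_for (dphi s).
have mphi : measurable_fun [set: R] phi by exact: continuous_measurable_fun.
have mpsi : measurable_fun [set: R] psi by exact: continuous_measurable_fun.
pose h := fun s : R => (`|s| * phi s)%:E.
have mh : measurable_fun [set: R] h by rewrite /h; apply/measurable_EFinP; mfun.
have h0 s : (0 <= h s)%E by rewrite lee_fin mulr_ge0.
(* Dividing by [|w|] creates the factor [|w|] that [abel_iter_subord] requires: |w| f(w) is the
   subordination of [h]. *)
pose f w := ((`|w|^-1)%:E * subord h w)%E.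
have mf : measurable_fun [set: R] f.
  by apply: emeasurable_funM; [apply/measurable_EFinP; mfun|exact: measurable_subord].
have f0 w : (0 <= f w)%E by rewrite mule_ge0// ?subord_ge0// lee_fin invr_ge0.
have -> : abel (nu n.+1) (iter n.+2 subord h) t =
    abel (nu n.+1) (iter n.+1 subord (fun w => `|w|%:E * f w)%E) t.
  apply: eq_abel => s s0; rewrite iterSr; apply: eq_iter_subord => // w w0.
  by rewrite /f muleA -EFinM gtr0_norm// divff ?mul1e// gt_eqF.
rewrite EFinM -muleA abel_iter_subord// muleA -EFinM -powRD_gt0//.
rewrite (_ : 1 - nu n.+1 + (nu n.+1 - 1) = 0); last by ring.
rewrite powRr0 mul1e [iter n.+2 _ _]iterSr -iter_subordD//; last 2 first.
- by apply: measurable_subord => //; apply/measurable_EFinP; mfun.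
- by move=> s; apply: subord_ge0 => w; rewrite lee_fin.
rewrite EFinM -iter_subord_heat_kernel0// -iter_subordZ//; last 3 first.
- by rewrite lee_fin mulr_ge0.
- by apply/measurable_EFinP; mfunh.
- by move=> s; rewrite lee_fin heat_kernel_ge0.
apply: eq_iter_subord => // w w0.
by rewrite /f gtr0_norm// (subord_by_parts w0 dphi cpsi psi0 phi0 phiM) EFinM.
Qed.

End integration_by_parts.

(** * The fractional equation *)

Section cauchy_subordination.
Context {R : realType}.
Local Notation mu := lebesgue_measure.

(** Differentiation under the integral, dominated by [G] times the density. A bound uniform in y and
    s is inherited by [rsubord], which lets the next lemma iterate. *)
Lemma is_derive_rsubord_param (phi dphi : R -> R -> R) (lo hi G t : R) :
  (forall y, lo < y < hi -> bounded_mfun (phi y)) ->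
  (forall y, lo < y < hi -> bounded_mfun (dphi y)) ->
  (forall y s, lo < y < hi -> `|dphi y s| <= G) ->
  (forall y s : R, lo < y < hi -> is_derive y 1 (phi ^~ s) (dphi y s)) ->
  forall y : R, lo < y < hi ->
    is_derive y 1 (fun y => rsubord (phi y) t) (rsubord (dphi y) t).
Proof.
move=> bphi bdphi dphiG dphiE y yI.
pose f (x s : R) := phi x s * absheat s t.
have It : `]lo, hi[%classic y by rewrite /= in_itv.
have df (x s : R) : lo < x < hi -> is_derive x 1 (f ^~ s) (dphi x s * absheat s t).
  move=> xI; have d1 := dphiE x s xI; rewrite /f.
  by apply: is_derive_eq; rewrite /GRing.scale/=; ring.
have intf (x : R) : `]lo, hi[%classic x ->
    (lebesgue_measure).-integrable setT (EFin \o f x).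
  by rewrite /= in_itv/= => xI; exact: integrable_mul_absheat (bphi _ xI).
have derf1 (x s : R) : `]lo, hi[%classic x -> setT s -> derivable (f ^~ s) x 1.
  by rewrite /= in_itv/= => xI _; have [] := df x s xI.
have Gy : 0 <= G by apply: le_trans (dphiG y 0 yI).
pose H (s : R) := G * absheat s t.
have H0 s : 0 <= H s by rewrite mulr_ge0 ?absheat_ge0.
have intH : (lebesgue_measure).-integrable setT (EFin \o H).
  by apply: (@integrable_mul_absheat _ (cst G)); exact: bounded_mfun_cst.
have d1E (x s : R) : lo < x < hi -> partial1of2 f x s = dphi x s * absheat s t.
  by move=> xI; rewrite partial1of2E; have := df x s xI; move=> ?; rewrite derive_val.
have Hub (x s : R) : `]lo, hi[%classic x -> setT s -> `|partial1of2 f x s| <= H s.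
  rewrite /= in_itv/= => xI _; rewrite d1E// normrM [`|absheat _ _|]ger0_norm ?absheat_ge0//.
  by rewrite ler_wpM2r ?absheat_ge0// dphiG.
have mI : measurable (setT : set (measurableTypeR R)) by exact: measurableT.
have D := @derivable_under_integral R _ (measurableTypeR R) lebesgue_measure f _ mI _ _ _ It intf derf1 _ H0 intH Hub.
have V := @differentiation_under_integral R _ (measurableTypeR R) lebesgue_measure f _ mI _ _ _ It intf derf1 _ H0 intH Hub.
apply: DeriveDef => //; rewrite -derive1E V.
by apply: eq_Rintegral => s _; rewrite d1E.
Qed.

Lemma is_derive_iter_rsubord_param n (phi dphi : R -> R -> R) (lo hi G t : R) :
  (forall y, lo < y < hi -> bounded_mfun (phi y)) ->
  (forall y, lo < y < hi -> bounded_mfun (dphi y)) ->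
  (forall y s, lo < y < hi -> `|dphi y s| <= G) ->
  (forall y s : R, lo < y < hi -> is_derive y 1 (phi ^~ s) (dphi y s)) ->
  forall y : R, lo < y < hi ->
    is_derive y 1 (fun y => iter n rsubord (phi y) t) (iter n rsubord (dphi y) t).
Proof.
move=> bphi bdphi dphiG dphiE.
have bG y s : lo < y < hi -> `|iter n rsubord (dphi y) s| <= G.
  move=> yI; elim: n s => [|n ih] s /=; first exact: dphiG.
  by apply: norm_rsubord_le => //; exact: bounded_mfun_iter (bdphi _ yI).
elim: n t bG => [|n ih] t bG y yI /=; first exact: dphiE.
have bG' z s : lo < z < hi -> `|iter n rsubord (dphi z) s| <= G.
  move=> zI; elim: {ih bG} n s => [|n ih] s /=; first exact: dphiG.
  by apply: norm_rsubord_le => //; exact: bounded_mfun_iter (bdphi _ zI).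
apply: (@is_derive_rsubord_param (fun y => iter n rsubord (phi y))
  (fun y => iter n rsubord (dphi y)) lo hi G) => // z.
- by move=> zI; exact: bounded_mfun_iter (bphi _ zI).
- by move=> zI; exact: bounded_mfun_iter (bdphi _ zI).
- by move=> s zI; apply: ih.
Qed.

Definition cauchy_dx (x s : R) : R := - (2 * `|s| * x / (pi * (s ^+ 2 + x ^+ 2) ^+ 2)).

(* The s-derivative of [cauchy_kernel x s] is [cauchy_a x s - cauchy_b x s]; the two parts
   are kept apart because they and their derivatives have constant sign on s >= 0. *)
Definition cauchy_a (x s : R) : R := 2 * x ^+ 2 / (pi * (s ^+ 2 + x ^+ 2) ^+ 2).
Definition cauchy_b (x s : R) : R := (pi * (s ^+ 2 + x ^+ 2))^-1.
Definition cauchy_da (x s : R) : R := 8 * x ^+ 2 * s / (pi * (s ^+ 2 + x ^+ 2) ^+ 3).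
Definition cauchy_db (x s : R) : R := 2 * s / (pi * (s ^+ 2 + x ^+ 2) ^+ 2).

(** The second x-derivative of the kernel, written through minus its second s-derivative: this
    formula is where harmonicity enters. The absolute values extend it evenly to s < 0, like the
    kernel taken at [|s|]. *)
Definition cauchy_dxx (x s : R) : R := `|cauchy_da x s| - `|cauchy_db x s|.

Lemma sqr_addr_gt0 (x s : R) : x != 0 -> 0 < s ^+ 2 + x ^+ 2.
Proof. by move=> x0; rewrite ltr_wpDl ?sqr_ge0// exprn_even_gt0. Qed.

Lemma norm_frac_le (y u c : R) k : 0 < u -> `|y| <= c * u ^+ k -> `|y / (pi * u ^+ k)| <= c / pi.
Proof.
move=> u0 yc; have p0 : 0 < pi :> R := pi_gt0 R.
rewrite normrM [`|(_ * _)^-1|]ger0_norm; last first.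
  by rewrite invr_ge0 mulr_ge0 ?exprn_ge0// ltW.
rewrite ler_pdivrMr ?mulr_gt0 ?exprn_gt0//.
by rewrite mulrA divfK ?gt_eqF.
Qed.

(** * Bounds on the Cauchy kernel, uniform away from x = 0 *)

Section bounds.
Variables (d y s : R).
Hypotheses (d0 : 0 < d) (dy : d <= `|y|).
Let u := s ^+ 2 + y ^+ 2.
Let r := d^-1.

Let y0 : y != 0.
Proof. by rewrite -normr_gt0 (lt_le_trans d0). Qed.

Let u0 : 0 < u. Proof. exact: sqr_addr_gt0. Qed.
Let r0 : 0 < r. Proof. by rewrite invr_gt0. Qed.

Let su : 2 * `|s| * `|y| <= u.
Proof.
rewrite /u -(real_normK (num_real s)) -(real_normK (num_real y)).
by rewrite -subr_ge0 (_ : _ - _ = (`|s| - `|y|) ^+ 2) ?sqr_ge0//; ring.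
Qed.

Let sru : 2 * `|s| <= r * u.
Proof.
rewrite /r ler_pdivlMl//; apply: le_trans su; rewrite mulrC.
by rewrite ler_wpM2l// mulr_ge0.
Qed.

Let yu : y ^+ 2 <= u. Proof. by rewrite /u lerDr sqr_ge0. Qed.

Let ru : 1 <= r ^+ 2 * u.
Proof.
rewrite /r exprVn ler_pdivlMl ?exprn_gt0// mulr1; apply: le_trans yu.
by rewrite -(real_normK (num_real y)) lerXn2r ?nnegrE ?(ltW d0)//.
Qed.

Lemma cauchy_kernel_bound : `|cauchy_kernel y `|s| | <= r / 2 / pi.
Proof.
rewrite /cauchy_kernel real_normK ?num_real// -/u -(expr1 u).
by apply: norm_frac_le => //; rewrite normr_id expr1 mulrAC ler_pdivlMr// mulrC.
Qed.

Lemma cauchy_dx_bound : `|cauchy_dx y s| <= r ^+ 2 / pi.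
Proof.
rewrite /cauchy_dx normrN; apply: norm_frac_le => //.
rewrite !normrM normr_id [`|2|]ger0_norm//; apply: (le_trans su).
by rewrite expr2 mulrA ler_pMl.
Qed.

Lemma cauchy_da_bound : `|cauchy_da y s| <= 4 * r ^+ 3 / pi.
Proof.
apply: norm_frac_le => //.
rewrite normrM [`|8 * _|]ger0_norm; last by rewrite mulr_ge0// sqr_ge0.
rewrite (_ : 8 * y ^+ 2 * `|s| = 4 * ((2 * `|s|) * (y ^+ 2 * 1))); last by ring.
rewrite (_ : 4 * r ^+ 3 * (s ^+ 2 + y ^+ 2) ^+ 3 = 4 * (r * u * (u * (r ^+ 2 * u)))); last by rewrite /u; ring.
rewrite ler_pM2l//; apply: ler_pM; [by rewrite mulr_ge0|by rewrite mulr1 sqr_ge0|by []|].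
by apply: ler_pM => //; exact: sqr_ge0.
Qed.

Lemma cauchy_db_bound : `|cauchy_db y s| <= r ^+ 3 / pi.
Proof.
apply: norm_frac_le => //.
rewrite !normrM [`|2|]ger0_norm//.
rewrite (_ : r ^+ 3 * (s ^+ 2 + y ^+ 2) ^+ 2 = r * u * (r ^+ 2 * u)); last by rewrite /u; ring.
by rewrite -[leLHS]mulr1 ler_pM// mulr_ge0.
Qed.

Lemma mul_cauchy_a_bound : `| `|s| * cauchy_a y s | <= r / pi.
Proof.
rewrite /cauchy_a mulrA; apply: norm_frac_le => //.
rewrite normrM [`|2 * _|]ger0_norm ?normr_id; last by rewrite mulr_ge0// sqr_ge0.
rewrite (_ : `|s| * (2 * y ^+ 2) = 2 * `|s| * y ^+ 2); last by ring.
rewrite (_ : r * (s ^+ 2 + y ^+ 2) ^+ 2 = r * u * u); last by rewrite /u; ring.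
by apply: ler_pM; [rewrite mulr_ge0|exact: sqr_ge0| |].
Qed.

Lemma mul_cauchy_b_bound : `| `|s| * cauchy_b y s | <= r / 2 / pi.
Proof. by have := cauchy_kernel_bound; rewrite /cauchy_kernel real_normK ?num_real. Qed.

End bounds.

Lemma bounded_cauchy (x : R) : x != 0 ->
  [/\ bounded_mfun (fun s => cauchy_kernel x `|s|), bounded_mfun (cauchy_dx x),
      bounded_mfun (fun s => `|cauchy_da x s|), bounded_mfun (fun s => `|cauchy_db x s|) &
      bounded_mfun (fun s => `|s| * cauchy_a x s) /\ bounded_mfun (fun s => `|s| * cauchy_b x s)].
Proof.
move=> x0; have d0 : 0 < `|x| by rewrite normr_gt0.
split; [..|split]; (split; [|eexists => s]).
- by apply: measurable_cauchy_kernel; mfun.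
- exact: (cauchy_kernel_bound _ d0).
- by rewrite /cauchy_dx; mfun.
- exact: (cauchy_dx_bound _ d0).
- by rewrite /cauchy_da; mfun.
- by rewrite normr_id; exact: (cauchy_da_bound _ d0).
- by rewrite /cauchy_db; mfun.
- by rewrite normr_id; exact: (cauchy_db_bound _ d0).
- by rewrite /cauchy_a; mfun.
- exact: (mul_cauchy_a_bound _ d0).
- by rewrite /cauchy_b; mfun.
- exact: (mul_cauchy_b_bound _ d0).
Qed.

Lemma cauchy_den_ge0 (x s : R) k : 0 <= (pi * (s ^+ 2 + x ^+ 2) ^+ k)^-1.
Proof. by rewrite invr_ge0 mulr_ge0 ?pi_ge0// exprn_ge0// addr_ge0 ?sqr_ge0. Qed.

Lemma is_derive_div (f g : R -> R) (df dg x : R) :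
  is_derive x 1 f df -> is_derive x 1 g dg -> g x != 0 ->
  is_derive x 1 (fun y => f y / g y) ((df * g x - f x * dg) / g x ^+ 2).
Proof.
move=> d1 d2 gx0; have d3 := is_deriveV gx0 d2.
by apply: is_derive_eq; rewrite /GRing.scale/=; field.
Qed.

Lemma is_derive_cauchy_x (s y : R) : y != 0 ->
  is_derive y 1 (fun y => cauchy_kernel y `|s|) (cauchy_dx y s).
Proof.
move=> y0; have u0 := sqr_addr_gt0 s y0; have p0 : 0 < pi :> R := pi_gt0 R.
rewrite /cauchy_kernel /cauchy_dx real_normK ?num_real//.
move: (pi : R) p0 => q q0.
have d1 : is_derive y 1 (fun y => q * (s ^+ 2 + y ^+ 2)) (q * (2 * y)).
  by apply: is_derive_eq; rewrite /GRing.scale/=; ring.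
have g0 : q * (s ^+ 2 + y ^+ 2) != 0 by rewrite gt_eqF// mulr_gt0.
have d2 := is_derive_div (is_derive_cst `|s| _ _) d1 g0.
by apply: is_derive_eq; rewrite /cst; field0.
Qed.

Lemma is_derive_cauchy_xx (s y : R) : y != 0 ->
  is_derive y 1 (cauchy_dx ^~ s) (cauchy_dxx y s).
Proof.
move=> y0; have u0 := sqr_addr_gt0 s y0; have p0 : 0 < pi :> R := pi_gt0 R.
rewrite /cauchy_dx /cauchy_dxx /cauchy_da /cauchy_db.
rewrite (normrM _ (_ * _ ^+ 3)^-1) (normrM _ (_ * _ ^+ 2)^-1).
rewrite (ger0_norm (cauchy_den_ge0 y s 3)) (ger0_norm (cauchy_den_ge0 y s 2)).
rewrite !(normrM _ s) normr_nat (@ger0_norm _ (8 * y ^+ 2)); last first.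
  by rewrite mulr_ge0// sqr_ge0.
move: (pi : R) p0 => q q0.
have d1 : is_derive y 1 (fun y => q * (s ^+ 2 + y ^+ 2) ^+ 2) (q * (4 * y * (s ^+ 2 + y ^+ 2))).
  by apply: is_derive_eq; rewrite /GRing.scale/=; ring.
have d2 : is_derive y 1 (fun y => 2 * `|s| * y) (2 * `|s|).
  by apply: is_derive_eq; rewrite /GRing.scale/=; ring.
have g0 : q * (s ^+ 2 + y ^+ 2) ^+ 2 != 0 by rewrite gt_eqF// mulr_gt0 ?exprn_gt0.
have d3 := is_derive_div d2 d1 g0.
by apply: is_derive_eq; field0.
Qed.

Lemma is_derive_cauchy_s (x s : R) : x != 0 -> 0 < s ->
  is_derive s 1 (fun s => cauchy_kernel x `|s|)
    ((`|s| * cauchy_a x s - `|s| * cauchy_b x s) / s).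
Proof.
move=> x0 s0; have u0 := sqr_addr_gt0 s x0; have p0 : 0 < pi :> R := pi_gt0 R.
rewrite gtr0_norm//.
apply: (@near_eq_is_derive _ _ _ (cauchy_kernel x)).
  by near=> z; rewrite gtr0_norm//; near: z; exact: lt_nbhsr.
rewrite /cauchy_kernel /cauchy_a /cauchy_b.
move: (pi : R) p0 => q q0.
have d1 : is_derive s 1 (fun s => q * (s ^+ 2 + x ^+ 2)) (q * (2 * s)).
  by apply: is_derive_eq; rewrite /GRing.scale/=; ring.
have g0 : q * (s ^+ 2 + x ^+ 2) != 0 by rewrite gt_eqF// mulr_gt0.
have d2 := is_derive_div (is_derive_id _ _) d1 g0.
by apply: is_derive_eq; field0.
Unshelve. all: by end_near.
Qed.

Lemma is_derive_cauchy_a (x s : R) : x != 0 ->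
  is_derive s 1 (cauchy_a x) (- cauchy_da x s).
Proof.
move=> x0; have u0 := sqr_addr_gt0 s x0; have p0 : 0 < pi :> R := pi_gt0 R.
rewrite /cauchy_a /cauchy_da.
move: (pi : R) p0 => q q0.
have d1 : is_derive s 1 (fun s => q * (s ^+ 2 + x ^+ 2) ^+ 2) (q * (4 * s * (s ^+ 2 + x ^+ 2))).
  by apply: is_derive_eq; rewrite /GRing.scale/=; ring.
have g0 : q * (s ^+ 2 + x ^+ 2) ^+ 2 != 0 by rewrite gt_eqF// mulr_gt0 ?exprn_gt0.
have d2 := is_derive_div (is_derive_cst (2 * x ^+ 2) _ _) d1 g0.
by apply: is_derive_eq; rewrite /cst; field0.
Qed.

Lemma is_derive_cauchy_b (x s : R) : x != 0 ->
  is_derive s 1 (cauchy_b x) (- cauchy_db x s).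
Proof.
move=> x0; have u0 := sqr_addr_gt0 s x0; have p0 : 0 < pi :> R := pi_gt0 R.
rewrite /cauchy_b /cauchy_db.
move: (pi : R) p0 => q q0.
have d1 : is_derive s 1 (fun s => q * (s ^+ 2 + x ^+ 2)) (q * (2 * s)).
  by apply: is_derive_eq; rewrite /GRing.scale/=; ring.
have g0 : q * (s ^+ 2 + x ^+ 2) != 0 by rewrite gt_eqF// mulr_gt0.
have d2 := is_derive_div (is_derive_cst (1 : R) _ _) d1 g0.
rewrite (_ : (fun _ => _) = (fun s => cst 1 s / (q * (s ^+ 2 + x ^+ 2)))); last first.
  by apply/funext => z; rewrite /cst div1r.
by apply: is_derive_eq; rewrite /cst; field0.
Qed.

Lemma cauchy_a_ge0 (x s : R) : 0 <= cauchy_a x s.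
Proof. by rewrite /cauchy_a mulr_ge0 ?cauchy_den_ge0// mulr_ge0// sqr_ge0. Qed.

Lemma cauchy_b_ge0 (x s : R) : 0 <= cauchy_b x s.
Proof. by rewrite invr_ge0 ?mulr_ge0 ?pi_ge0 ?addr_ge0 ?sqr_ge0. Qed.

Lemma cauchy_da_ge0 (x s : R) : 0 <= s -> 0 <= cauchy_da x s.
Proof.
move=> s0; rewrite /cauchy_da mulr_ge0 ?cauchy_den_ge0// mulr_ge0// mulr_ge0//.
by rewrite sqr_ge0.
Qed.

Lemma cauchy_db_ge0 (x s : R) : 0 <= s -> 0 <= cauchy_db x s.
Proof. by move=> s0; rewrite /cauchy_db mulr_ge0 ?cauchy_den_ge0// mulr_ge0. Qed.

Lemma cauchy_a_le (x s : R) : x != 0 -> cauchy_a x s <= cauchy_a x 0.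
Proof.
move=> x0; have u0 := sqr_addr_gt0 s x0; have p0 : 0 < pi :> R := pi_gt0 R.
have v0 := sqr_addr_gt0 0 x0.
rewrite /cauchy_a ler_wpM2l//; first by rewrite mulr_ge0// sqr_ge0.
rewrite lef_pV2 ?posrE ?mulr_gt0 ?exprn_gt0// ler_pM2l//.
by rewrite lerXn2r ?nnegrE ?(ltW u0) ?(ltW v0)// expr0n/= add0r lerDr sqr_ge0.
Qed.

Lemma cauchy_b_le (x s : R) : x != 0 -> cauchy_b x s <= cauchy_b x 0.
Proof.
move=> x0; have u0 := sqr_addr_gt0 s x0; have p0 : 0 < pi :> R := pi_gt0 R.
have v0 := sqr_addr_gt0 0 x0.
rewrite /cauchy_b lef_pV2 ?posrE ?mulr_gt0// ler_pM2l//.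
by rewrite expr0n/= add0r lerDr sqr_ge0.
Qed.

Lemma continuous_cauchy_da (x : R) : x != 0 -> continuous (cauchy_da x).
Proof.
move=> x0 s; have u0 := sqr_addr_gt0 s x0; have p0 : 0 < pi :> R := pi_gt0 R.
apply: cvgM; first by apply: cvgM; [exact: cvg_cst|exact: cvg_id].
apply: cvgV; first by rewrite gt_eqF// mulr_gt0 ?exprn_gt0.
apply: cvgM; first exact: cvg_cst.
apply: (@cvg_comp _ _ _ (fun s => s ^+ 2 + x ^+ 2) (fun u => u ^+ 3)); last exact: exprn_continuous.
by apply: cvgD; [exact: exprn_continuous|exact: cvg_cst].
Qed.

Lemma continuous_cauchy_db (x : R) : x != 0 -> continuous (cauchy_db x).
Proof.
move=> x0 s; have u0 := sqr_addr_gt0 s x0; have p0 : 0 < pi :> R := pi_gt0 R.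
apply: cvgM; first by apply: cvgM; [exact: cvg_cst|exact: cvg_id].
apply: cvgV; first by rewrite gt_eqF// mulr_gt0 ?exprn_gt0.
apply: cvgM; first exact: cvg_cst.
apply: (@cvg_comp _ _ _ (fun s => s ^+ 2 + x ^+ 2) (fun u => u ^+ 2)); last exact: exprn_continuous.
by apply: cvgD; [exact: exprn_continuous|exact: cvg_cst].
Qed.

End cauchy_subordination.

(** * The Caputo derivative of [p_CI] *)

Section fractional_equation.
Context {R : realType}.
Local Notation mu := lebesgue_measure.

Lemma p_CI_rsubord n (x t : R) : x != 0 -> 0 < t ->
  p_CI n x t = iter n.+1 rsubord (fun s => cauchy_kernel x `|s|) t.
Proof.
move=> x0 t0; rewrite p_CIE//; have [b _ _ _ _] := bounded_cauchy x0.
by rewrite -(EFin_iter_rsubord n.+1 t b).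
Qed.

(** The two means are kept apart because the Abel identities for [cauchy_a] and [cauchy_b] each
    produce one of them. *)
Definition p_CI_dxx n (x t : R) : R :=
  iter n.+1 rsubord (fun s => `|cauchy_da x s|) t - iter n.+1 rsubord (fun s => `|cauchy_db x s|) t.

Lemma norm_ge_itv (x y : R) : x - `|x| / 2 < y < x + `|x| / 2 -> `|x| / 2 <= `|y|.
Proof.
move=> /andP[h1 h2]; have [x0|x0] := leP 0 x.
  move: h1 h2; rewrite ger0_norm// => h1 h2.
  by rewrite ger0_norm; lra.
move: h1 h2; rewrite ltr0_norm// => h1 h2.
by rewrite ltr0_norm; lra.
Qed.

(** Within distance |x| / 2 of x the parameter stays at least |x| / 2 away from 0, where the bounds
    on the kernel and its derivatives are uniform. *)
Lemma is_derive_p_CI_x n (x t : R) : x != 0 -> 0 < t ->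
  is_derive x 1 (fun y => p_CI n y t) (iter n.+1 rsubord (cauchy_dx x) t) /\
  is_derive x 1 (fun y => iter n.+1 rsubord (cauchy_dx y) t) (p_CI_dxx n x t).
Proof.
move=> x0 t0; have d0 : 0 < `|x| / 2 by rewrite divr_gt0// normr_gt0.
have xI : x - `|x| / 2 < x < x + `|x| / 2 by apply/andP; split; lra.
have nz y : x - `|x| / 2 < y < x + `|x| / 2 -> y != 0.
  by move=> /norm_ge_itv h; rewrite -normr_gt0 (lt_le_trans d0).
split.
  have d : is_derive x 1 (fun y => iter n.+1 rsubord (fun s => cauchy_kernel y `|s|) t)
      (iter n.+1 rsubord (cauchy_dx x) t).
    apply: (@is_derive_iter_rsubord_param _ n.+1 (fun y s => cauchy_kernel y `|s|) cauchy_dx _ _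
       ((`|x| / 2)^-1 ^+ 2 / pi) t _ _ _ _ x xI) => y.
    - by move=> /nz /bounded_cauchy[].
    - by move=> /nz /bounded_cauchy[].
    - by move=> s /norm_ge_itv; exact: cauchy_dx_bound.
    - by move=> s /nz; exact: is_derive_cauchy_x.
  apply: near_eq_is_derive d; near=> y; rewrite p_CI_rsubord//.
  by near: y; apply: open_nbhs_nbhs; split => //; exact: open_neq.
rewrite /p_CI_dxx -iter_rsubordB; last 2 first.
- by have [] := bounded_cauchy x0.
- by have [] := bounded_cauchy x0.
apply: (@is_derive_iter_rsubord_param _ n.+1 cauchy_dx cauchy_dxx _ _
   (4 * (`|x| / 2)^-1 ^+ 3 / pi + (`|x| / 2)^-1 ^+ 3 / pi) t _ _ _ _ x xI) => y.
- by move=> /nz /bounded_cauchy[].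
- by move=> /nz /bounded_cauchy[_ _ b1 b2 _]; exact: bounded_mfunB.
- move=> s /norm_ge_itv yd; rewrite /cauchy_dxx.
  apply: (le_trans (ler_normB _ _)); rewrite !normr_id lerD//.
    exact: cauchy_da_bound.
  exact: cauchy_db_bound.
- by move=> s /nz; exact: is_derive_cauchy_xx.
Unshelve. all: by end_near.
Qed.

Lemma derive_p_CI_xx n (x t : R) : x != 0 -> 0 < t ->
  derivable (derive1 (fun y => p_CI n y t)) x 1 /\
  derive1n 2 (fun y => p_CI n y t) x = p_CI_dxx n x t.
Proof.
move=> x0 t0; have [_ d] := is_derive_p_CI_x n x0 t0.
have D : is_derive x 1 (derive1 (fun y => p_CI n y t)) (p_CI_dxx n x t).
  apply: near_eq_is_derive d; near=> y; rewrite derive1E.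
  have y0 : y != 0 by near: y; apply: open_nbhs_nbhs; split => //; exact: open_neq.
  by have [dy _] := is_derive_p_CI_x n y0 t0; rewrite derive_val.
by split; [have [] := D|rewrite /= derive1E derive_val].
Unshelve. all: by end_near.
Qed.

Definition cauchy_mean_a n (x t : R) := iter n.+1 rsubord (fun s => `|s| * cauchy_a x s) t.
Definition cauchy_mean_b n (x t : R) := iter n.+1 rsubord (fun s => `|s| * cauchy_b x s) t.

Lemma is_derive_p_CI_t n (x t : R) : x != 0 -> 0 < t ->
  is_derive t 1 (p_CI n x) (nu n.+1 * (cauchy_mean_a n x t - cauchy_mean_b n x t) / t).
Proof.
move=> x0 t0; have [bh _ _ _ [ba bb]] := bounded_cauchy x0.
have d := @is_derive_iter_rsubord _ n.+1 (fun s => cauchy_kernel x `|s|)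
  (fun s => `|s| * cauchy_a x s - `|s| * cauchy_b x s) t bh (bounded_mfunB ba bb)
  (fun s s0 => is_derive_cauchy_s x0 s0) t0.
rewrite /cauchy_mean_a /cauchy_mean_b -iter_rsubordB//.
apply: near_eq_is_derive d; near=> y; rewrite p_CI_rsubord//.
by near: y; exact: lt_nbhsr.
Unshelve. all: by end_near.
Qed.

(** For - z in ]-1, 0[ the definition of [Gamma] uses the functional equation exactly once. *)
Lemma Gamma_opp (z : R) : 0 < z < 1 -> Gamma (- z) = - (Gamma (1 - z) / z).
Proof.
move=> /andP[z0 z1]; rewrite /Gamma oppr_gt0 ltNge (ltW z0)/= subr_gt0 z1 opprK.
rewrite (_ : Num.truncn z = 0%N); last by apply/truncn0Pn; rewrite -ltNge.
by rewrite big_ord1 addr0 invrN mulrN addrC.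
Qed.

Section abel_means.
Variables (n : nat) (t : R).
Hypothesis t0 : 0 < t.
Local Notation a := (nu n.+1).

Lemma abel_mean (phi psi : R -> R) :
  bounded_mfun (fun s => `|s| * phi s) -> bounded_mfun (fun s => `|psi s|) ->
  (forall s : R, is_derive s 1 phi (- psi s)) -> continuous psi ->
  (forall s, 0 <= s -> 0 <= psi s) -> (forall s, 0 <= phi s) -> (forall s, phi s <= phi 0) ->
  exists2 r : R, abel a (EFin \o iter n.+2 rsubord (fun s => `|s| * phi s)) t = r%:E &
    2 `^ (1 - a) * a * r + iter n.+2 rsubord (fun s => `|psi s|) t =
     2 * phi 0 * ((2 * t) `^ (- nu n.+2) / Gamma (1 - nu n.+2)).
Proof.
move=> b1 b2 dphi cpsi psi0 phi0 phiM.
have := abel_iter_subord_by_parts n t0 dphi cpsi psi0 phi0 phiM.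
rewrite -(EFin_iter_rsubord n.+2 t b2).
rewrite (_ : iter n.+2 subord _ = EFin \o iter n.+2 rsubord (fun s => `|s| * phi s)); last first.
  by apply/funext => s; rewrite -(EFin_iter_rsubord n.+2 s b1).
have c0 : 0 < 2 `^ (1 - a) * a :> R by rewrite mulr_gt0 ?powR_gt0 ?nu_gt0.
(* The right-hand side is finite, which excludes an infinite Abel integral. *)
case: (abel _ _ _) => [r| |].
- by rewrite -EFinM -EFinD => -[e]; exists r.
- by rewrite gt0_muley ?lte_fin.
- by rewrite gt0_muleNy ?lte_fin.
Qed.

End abel_means.

Lemma integrable_abel_mean n (t r : R) (f : R -> R) : measurable_fun [set: R] f ->
  (forall s, 0 <= f s) -> abel (nu n.+1) (EFin \o f) t = r%:E ->
  (lebesgue_measure).-integrable `]0%R, t[ (fun tau => (f tau / tau / (t - tau) `^ nu n.+1)%:E) /\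
  (\int[mu]_(tau in `]0%R, t[) (f tau / tau / (t - tau) `^ nu n.+1)%:E =
   (Gamma (1 - nu n.+1) * r)%:E)%E.
Proof.
move=> mf f0 fr.
have G0 : 0 < Gamma (1 - nu n.+1) :> R.
  by rewrite Gamma_gt0 ?egamma_nu_fin// ?subr_gt0 ?nu_lt1// gerBl ltW// nu_gt0.
have g0 tau : `]0%R, t[%classic tau -> 0 <= f tau / tau / (t - tau) `^ nu n.+1.
  rewrite /= in_itv/= => /andP[tau0 _].
  by rewrite !divr_ge0 ?powR_ge0// ltW.
have E : (\int[mu]_(tau in `]0%R, t[) (f tau / tau / (t - tau) `^ nu n.+1)%:E =
   (Gamma (1 - nu n.+1) * r)%:E)%E.
  rewrite EFinM -fr /abel -ge0_integralZl//; last 3 first.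
  - by emf.
  - by move=> tau _; rewrite mule_ge0// lee_fin ?abelk_ge0// nu_lt1.
  - by rewrite lee_fin ltW.
  rewrite [LHS]integral_mkcond; apply: eq_integral => tau _; rewrite patchE /abelk mem_setE in_itv/=.
  case: ifPn => [/andP[tau0 taut]|_]; last by rewrite mul0e mule0.
  rewrite -!EFinM powRN; congr EFin.
  have : 0 < (t - tau) `^ nu n.+1 by rewrite powR_gt0 ?subr_gt0.
  by move: ((t - tau) `^ nu n.+1) => P P0; field0.
split=> //; apply/integrableP; split.
  by apply/measurable_EFinP; apply: measurable_funTS; mfun.
under eq_integral => tau /[!inE] h do rewrite abse_EFin (ger0_norm (g0 tau h)).
by rewrite E ltry.
Qed.

Lemma integral_itv_scaleB (c t a b : R) (g ga gb : R -> R) :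
  (lebesgue_measure).-integrable `]0%R, t[ (fun tau => (ga tau)%:E) ->
  (lebesgue_measure).-integrable `]0%R, t[ (fun tau => (gb tau)%:E) ->
  (\int[mu]_(tau in `]0%R, t[) (ga tau)%:E = a%:E)%E ->
  (\int[mu]_(tau in `]0%R, t[) (gb tau)%:E = b%:E)%E ->
  (forall tau, 0 < tau < t -> g tau = c * (ga tau - gb tau)) ->
  (lebesgue_measure).-integrable `]0%R, t[ (fun tau => (g tau)%:E) /\
  \int[mu]_(tau in `]0%R, t[) g tau = c * (a - b).
Proof.
move=> ia ib Ia Ib gE.
have iab : (lebesgue_measure).-integrable `]0%R, t[ (fun tau => (ga tau - gb tau)%:E).
  rewrite (_ : (fun _ => _) = (fun tau => (ga tau)%:E) \- (fun tau => (gb tau)%:E))%E//.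
  exact: integrableB.
have E tau : tau \in `]0%R, t[%classic -> g tau = c * (ga tau - gb tau).
  by rewrite inE/= in_itv/=; exact: gE.
split.
  apply: eq_integrable (integrableZl _ c iab) => // tau tauI /=.
  by rewrite (E tau tauI).
under eq_Rintegral => tau tauI do rewrite (E tau tauI).
by rewrite RintegralZl// RintegralB// /Rintegral Ia Ib.
Qed.

Lemma caputo_p_CI n (x t : R) : x != 0 -> 0 < t ->
  caputo_exists (nu n.+1) (p_CI n.+1) x t /\
  caputo (nu n.+1) (p_CI n.+1) x t =
    2 `^ (nu n.+1 - 2) * (2 / (pi * x ^+ 2) * ((2 * t) `^ (- nu n.+2) / Gamma (1 - nu n.+2))
                          - p_CI_dxx n.+1 x t).
Proof.
move=> x0 t0; have [_ _ bda bdb [ba bb]] := bounded_cauchy x0.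
have [ra absa Ea] := abel_mean n t0 ba bda (fun s => is_derive_cauchy_a s x0)
  (continuous_cauchy_da x0) (fun s => @cauchy_da_ge0 _ x s) (cauchy_a_ge0 x) (fun s => cauchy_a_le s x0).
have [rb absb Eb] := abel_mean n t0 bb bdb (fun s => is_derive_cauchy_b s x0)
  (continuous_cauchy_db x0) (fun s => @cauchy_db_ge0 _ x s) (cauchy_b_ge0 x) (fun s => cauchy_b_le s x0).
have mean_ge0 (f : R -> R) s : bounded_mfun f -> (forall s, 0 <= f s) -> 0 <= iter n.+2 rsubord f s.
  move=> bf f0; rewrite -lee_fin EFin_iter_rsubord//; apply: iter_subord_ge0 => z.
  by rewrite lee_fin.
have absa' : abel (nu n.+1) (EFin \o cauchy_mean_a n.+1 x) t = ra%:E := absa.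
have absb' : abel (nu n.+1) (EFin \o cauchy_mean_b n.+1 x) t = rb%:E := absb.
have [ia Ia] := integrable_abel_mean (proj1 (bounded_mfun_iter n.+2 ba))
  (fun s => mean_ge0 _ s ba (fun z => mulr_ge0 (normr_ge0 z) (cauchy_a_ge0 x z))) absa'.
have [ib Ib] := integrable_abel_mean (proj1 (bounded_mfun_iter n.+2 bb))
  (fun s => mean_ge0 _ s bb (fun z => mulr_ge0 (normr_ge0 z) (cauchy_b_ge0 x z))) absb'.
have G0 : 0 < Gamma (1 - nu n.+1) :> R.
  by rewrite Gamma_gt0 ?egamma_nu_fin// ?subr_gt0 ?nu_lt1// gerBl ltW// nu_gt0.
(* [p_CI n.+1] is made of n + 2 subordinations, so its time derivative carries [nu n.+2], half the
   order of the Caputo derivative. *)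
have E tau : 0 < tau < t -> caputo_integrand (nu n.+1) (p_CI n.+1) x t tau =
    nu n.+2 * (cauchy_mean_a n.+1 x tau / tau / (t - tau) `^ nu n.+1
               - cauchy_mean_b n.+1 x tau / tau / (t - tau) `^ nu n.+1).
  move=> /andP[tau0 _]; have d := is_derive_p_CI_t n.+1 x0 tau0.
  rewrite /caputo_integrand derive1E derive_val.
  by move: (cauchy_mean_a _ _ _) (cauchy_mean_b _ _ _) => A B; ring.
have [ig Ig] := integral_itv_scaleB ia ib Ia Ib E.
split.
  by split=> [tau tau0 _|//]; have [] := is_derive_p_CI_t n.+1 x0 tau0.
rewrite /caputo Ig.
set K := _ `^ _ / _ in Ea Eb *.
rewrite /p_CI_dxx; move: Ea Eb; set SA := iter _ _ _ _; set SB := iter _ _ _ _ => Ea Eb.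
(* The difference of the two identities. Its boundary term contains twice [cauchy_a x 0] minus
   [cauchy_b x 0], which is the s-derivative 1 / (pi x^2) of the kernel at s = 0. *)
have -> : 2 / (pi * x ^+ 2) * K - (SA - SB) = 2 `^ (1 - nu n.+1) * nu n.+1 * (ra - rb).
  rewrite mulrBr -[X in _ = X - _](addrK SA) -[X in _ = _ - X](addrK SB) Ea Eb.
  rewrite /cauchy_a /cauchy_b expr0n/= add0r.
  by have := pi_gt0 R; move: (pi : R) => q q0; field0.
rewrite [in LHS](nuS n.+1) !mulrA -powRD_gt0//.
rewrite (_ : nu n.+1 - 2 + (1 - nu n.+1) = - 1); last by ring.
rewrite powRN powRr1//.
have e0 : 0 < 2 ^+ n.+1 :> R by rewrite exprn_gt0.
by field0.
Qed.

Lemma caputo_p_CI_equation n (x t : R) : (1 <= n)%N -> x != 0 -> 0 < t ->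
  let nu : R := 1 / 2 ^+ n in
  let p := p_CI n in
  [/\ caputo_exists nu p x t,
      (forall y : R, y != 0 -> derivable (fun y => p y t) y 1),
      derivable (derive1 (fun y => p y t)) x 1 &
      caputo nu p x t =
        - 2 `^ (nu - 2) * derive1n 2 (fun y => p y t) x
        + 2 `^ (n%:R - 1 + 1 / 2 ^+ n.+1) / pi `^ (3 / 2)
          * (Gamma (- (1 / 2)) / Gamma (- (1 / 2 ^+ n.+1)))
          * (t `^ (- (1 / 2 ^+ n.+1)) / x ^+ 2)].
Proof.
case: n => [//|n] _ x0 t0 nu0 p.
have [ce cE] := caputo_p_CI n x0 t0; have [dd ddE] := derive_p_CI_xx n.+1 x0 t0.
split; [exact: ce| |exact: dd|].
  by move=> y y0; have [[]] := is_derive_p_CI_x n.+1 y0 t0.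
rewrite /p /nu0 ddE -/(nu n.+1) -/(nu n.+2) cE mulrBr mulNr addrC; congr (_ + _).
have v0 := nu_gt0 n.+1 : 0 < _ :> R; have v1 := nu_lt1 n.+1 : _ < 1 :> R.
(* Only constants remain to be compared. Gamma(-1/2) is -2 sqrt pi, and Gamma(-1/2^(n+1)) of the
   statement brings back Gamma(1 - [nu n.+2]) with a factor [nu n.+2] that the power of 2
   compensates. *)
rewrite Gamma_opp; last by apply/andP; split; lra.
rewrite Gamma_opp; last by rewrite nu_gt0 nu_lt1.
have -> : 1 - 1 / 2 = 1 / 2 :> R by field.
rewrite (@GammaE _ (1 / 2)) ?egamma_half/=; last by lra.
have G0 : 0 < Gamma (1 - nu n.+2) :> R.
  by rewrite Gamma_gt0 ?egamma_nu_fin// ?subr_gt0 ?nu_lt1// gerBl ltW// nu_gt0.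
have p0 : 0 < pi :> R := pi_gt0 R.
have -> : pi `^ (3 / 2) = pi * Num.sqrt pi :> R.
  rewrite (_ : 3 / 2 = 1 + 2^-1); last by field.
  by rewrite powRD_gt0// powRr1 ?(ltW p0)// powR12_sqrt// ltW.
have s0 : 0 < Num.sqrt pi :> R by rewrite sqrtr_gt0.
rewrite powRM ?(ltW t0)// -[2 `^ (nu n.+1 - 2) * _]mulrC.
have -> : 2 `^ (n.+1%:R - 1 + nu n.+2) = 2 `^ (nu n.+2) * 2 ^+ n.+1 / 2 :> R.
  rewrite -powR_mulrn// -[X in _ / X](powRr1)// -powRN -!powRD_gt0//.
  by congr (_ `^ _); ring.
have -> : 2 `^ (nu n.+1 - 2) = 2 `^ (nu n.+2) * 2 `^ (nu n.+2) / 4 :> R.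
  rewrite (_ : nu n.+1 - 2 = nu n.+2 + nu n.+2 + (- 2%:R)); last by rewrite (nuS n.+1); field.
  by rewrite !powRD_gt0// powRN powR_mulrn// expr2 -natrM.
have vE : nu n.+2 = (2 ^+ n.+1)^-1 / 2 :> R by rewrite nuS /nu div1r.
rewrite (powRN 2).
have w0 : 0 < 2 `^ nu n.+2 :> R by rewrite powR_gt0.
have e0 : 0 < 2 ^+ n.+1 :> R by rewrite exprn_gt0.
move: (2 `^ nu n.+2) w0 (t `^ _) (Gamma (1 - nu n.+2)) G0 => w w0 T G G0.
rewrite vE; move: (2 ^+ n.+1) e0 => e e0.
move: (Num.sqrt _) s0 => q q0; move: (pi : R) p0 => r r0.
by field0.
Qed.

End fractional_equation.

(** * The initial condition *)

Section initial_condition.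
Context {R : realType}.
Local Notation mu := lebesgue_measure.

(** Dominated convergence for a scaling family of kernels. It serves twice: on the half-line for
    reflected Brownian motion, and on the whole line for the Cauchy process. *)
Lemma scaled_mean_cvg (D : set R) (f K : R -> R) (M L : R) :
  measurable (D : set (measurableTypeR R)) -> measurable_fun [set: R] f -> (forall s, `|f s| <= M) ->
  (lebesgue_measure).-integrable D (EFin \o K) ->
  (forall y, D y -> f (s * y) @[s --> 0^'+] --> L) ->
  \int[mu]_(y in D) (f (s * y) * K y) @[s --> 0^'+] --> L * \int[mu]_(y in D) K y.
Proof.
move=> mD mf fM iK fL; apply/cvg_at_rightP => u [u0 ucvg].
have mK : measurable_fun D (EFin \o K) by case/integrableP: iK.
have [||||| i _ H] := @dominated_convergence _ _ _ lebesgue_measure D mD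
  (fun n y => (f (u n * y) * K y)%:E) (fun y => (L * K y)%:E) (fun y => M%:E * `|(K y)%:E|)%E.
- move=> n; apply/measurable_EFinP; apply: measurable_funM; last by apply/measurable_EFinP.
  by apply: measurable_funTS; apply: (measurableT_comp mf); mfun.
- by apply/measurable_EFinP; apply: measurable_funM => //; apply/measurable_EFinP.
- apply: aeW => y Dy; apply: cvg_EFin; first by apply: nearW.
  apply: cvgM; last exact: cvg_cst.
  by have /cvg_at_rightP/(_ u (conj u0 ucvg)) := fL y Dy.
- by apply: integrableZl => //; exact: integrable_abse.
- apply: aeW => y n Dy; rewrite lee_fin normrM ler_wpM2r//.
rewrite -RintegralZl//; apply: fine_cvg; rewrite fineK//.
by apply: integrable_fin_num.
Qed.

Lemma cauchy_kernel_scale (s y : R) : 0 < s ->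
  s * cauchy_kernel (s * y) s = cauchy_kernel y 1.
Proof.
move=> s0; have p0 : 0 < pi :> R := pi_gt0 R; rewrite /cauchy_kernel.
have u0 : 0 < 1 ^+ 2 + y ^+ 2 by rewrite ltr_wpDr ?sqr_ge0// exprn_gt0.
rewrite (_ : s ^+ 2 + (s * y) ^+ 2 = s ^+ 2 * (1 ^+ 2 + y ^+ 2)); last by ring.
by move: (1 ^+ 2 + y ^+ 2) (pi : R) u0 p0 => u q u0 q0; field0.
Qed.

Lemma integral_cauchy_kernel (s : R) : 0 < s ->
  (\int[mu]_x (cauchy_kernel x s)%:E = 1)%E.
Proof.
move=> s0; have p0 : 0 < pi :> R := pi_gt0 R.
rewrite (ge0_integral_affine 0 s0); last 2 first.
- by apply/measurable_EFinP; apply: measurable_cauchy_kernel; mfun.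
- by move=> x; rewrite lee_fin cauchy_kernel_ge0// ltW.
rewrite -ge0_integral_mulrEFin//; last 3 first.
- by apply: measurable_cauchy_kernel; mfun.
- by move=> x _; rewrite cauchy_kernel_ge0// ltW.
- exact: ltW.
transitivity (\int[mu]_x ((pi : R)^-1 * (oneDsqr x)^-1)%:E)%E.
  apply: eq_integral => x _; rewrite add0r cauchy_kernel_scale//.
  by rewrite /cauchy_kernel /oneDsqr expr1n div1r invfM.
rewrite ge0_integral_mulrEFin//; last 2 first.
- by apply: continuous_measurable_fun => x; exact: continuous_oneDsqrV.
- by rewrite invr_ge0 ltW.
rewrite ge0_symfun_integralT; last 3 first.
- by move=> x; rewrite invr_ge0.
- by move=> x; exact: continuous_oneDsqrV.
- by move=> x; rewrite /oneDsqr /= sqrrN.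
by rewrite -set_itvcy integral0y_oneDsqr -!EFinM (mulrC 2) divfK// mulVf// gt_eqF.
Qed.

Lemma integrable_cauchy_kernel (s : R) :
  (lebesgue_measure).-integrable [set: R] (fun x => (cauchy_kernel x `|s|)%:E).
Proof.
apply/integrableP; split.
  by apply/measurable_EFinP; apply: measurable_cauchy_kernel; mfun.
under eq_integral do rewrite abse_EFin ger0_norm ?cauchy_kernel_ge0//.
have [->|s0] := eqVneq s 0.
  by rewrite integral0_eq// => x _; rewrite /cauchy_kernel normr0 mul0r.
by rewrite integral_cauchy_kernel ?normr_gt0// ltry.
Qed.

Lemma rsubord_cvg0 (f : R -> R) (L : R) : bounded_mfun f ->
  f s @[s --> 0^'+] --> L -> rsubord f t @[t --> 0^'+] --> L.
Proof.
move=> bf fL; have [mf [M fM]] := bf.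
have K1 : \int[mu]_(y in `]0%R, +oo[) absheat y 1 = 1 :> R.
  rewrite -[RHS](rsubord1 (ltr01 : 0 < 1 :> R)) rsubord_scale//; last exact: bounded_mfun_cst.
  by apply: eq_Rintegral => y _; rewrite mul1r.
have mI : measurable (`]0, +oo[%classic : set (measurableTypeR R)) by exact: measurable_itv.
have H := @scaled_mean_cvg _ f (absheat ^~ 1) M L mI mf fM.
rewrite K1 mulr1 in H.
have {}H : \int[mu]_(y in `]0%R, +oo[) (f (s * y) * absheat y 1) @[s --> 0^'+] --> L.
  apply: H; first by apply: integrableS (integrable_absheat 1).
  move=> y; rewrite itv0yE => y0; apply/cvg_at_rightP => u [u0 uc].
  have /cvg_at_rightP/(_ (fun n => u n * y)) := fL; apply; split.
    by move=> n; rewrite mulr_gt0.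
  by rewrite -[X in _ --> X](mul0r y); apply: cvgM => //; exact: cvg_cst.
apply/cvg_at_rightP => u [u0 uc].
rewrite (_ : (fun n => _) = fun n => \int[mu]_(y in `]0%R, +oo[) (f (Num.sqrt (u n) * y) * absheat y 1)).
  have /cvg_at_rightP/(_ (fun n => Num.sqrt (u n))) := H; apply; split.
    by move=> n; rewrite sqrtr_gt0.
  by rewrite -[X in _ --> X](@sqrtr0 R); apply: continuous_cvg => //; exact: sqrt_continuous.
by apply/funext => n; rewrite rsubord_scale.
Qed.

Lemma iter_rsubord_cvg0 n (f : R -> R) (L : R) : bounded_mfun f ->
  f s @[s --> 0^'+] --> L -> iter n rsubord f t @[t --> 0^'+] --> L.
Proof.
move=> bf fL; elim: n => [//|n ih] /=.
by apply: rsubord_cvg0 => //; exact: bounded_mfun_iter.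
Qed.

Lemma measurable_p_CI n (t : R) : 0 < t -> measurable_fun [set: R] (p_CI n ^~ t).
Proof.
move=> t0; rewrite (_ : p_CI n ^~ t = fun x => fine
  (iter n.+1 subord (fun s => (cauchy_kernel (x, s).1 `|(x, s).2|)%:E) t)).
  apply: measurableT_comp => //.
  apply: (measurableT_comp (@measurable_iter_subord2 _ n.+1
    (fun p => (cauchy_kernel p.1 `|p.2|)%:E) _ _) (measurable_pair2 t)).
    by apply/measurable_EFinP; apply: measurable_cauchy_kernel; mfun.
  by move=> p; rewrite lee_fin cauchy_kernel_ge0.
by apply/funext => x; rewrite p_CIE.
Qed.

Lemma p_CI_ge0 n (x t : R) : 0 < t -> 0 <= p_CI n x t.
Proof.
move=> t0; rewrite p_CIE// fine_ge0//; apply: iter_subord_ge0 => s.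
by rewrite lee_fin cauchy_kernel_ge0.
Qed.

Lemma integral_mul_p_CI n (psi : R -> R) (t : R) : 0 < t ->
  measurable_fun [set: R] psi -> (forall x, 0 <= psi x) ->
  (\int[mu]_x (psi x * p_CI n x t)%:E =
   iter n.+1 subord (fun s => \int[mu]_x (psi x * cauchy_kernel x `|s|)%:E) t)%E.
Proof.
move=> t0 mpsi psi0.
have h0 (x s : R) : 0 <= psi x * cauchy_kernel x `|s| by rewrite mulr_ge0 ?cauchy_kernel_ge0.
rewrite -(@iter_subord_swap _ n.+1 (fun p => (psi p.1 * cauchy_kernel p.1 `|p.2|)%:E))//; last 2 first.
- apply/measurable_EFinP; apply: measurable_funM; first exact: measurableT_comp.
  by apply: measurable_cauchy_kernel; mfun.
- by move=> p; rewrite lee_fin h0.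
apply: ae_eq_integral => //.
- by apply/measurable_EFinP; apply: measurable_funM => //; exact: measurable_p_CI.
- apply: (measurableT_comp (@measurable_iter_subord2 _ n.+1
    (fun p => (psi p.1 * cauchy_kernel p.1 `|p.2|)%:E) _ _) (measurable_pair2 t)).
    apply/measurable_EFinP; apply: measurable_funM; first exact: measurableT_comp.
    by apply: measurable_cauchy_kernel; mfun.
  by move=> p; rewrite lee_fin h0.
(* The point x = 0, where the kernel is unbounded in s and [p_CI] may take its default value, is a
   null set. *)
- exists [set 0]; split=> //; first exact: lebesgue_measure_set1.
  move=> x /= /not_implyP[_ E]; apply: contrapT => /eqP x0; apply: E.
  have [b _ _ _ _] := bounded_cauchy x0.
  have mp : measurable_fun [set: R] (fun s => (cauchy_kernel x `|s|)%:E).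
    by apply/measurable_EFinP; apply: measurable_cauchy_kernel; mfun.
  rewrite p_CI_rsubord// EFinM (EFin_iter_rsubord n.+1 t b) -(iter_subordZ n.+1) ?lee_fin//.
  by move=> s; rewrite lee_fin cauchy_kernel_ge0.
Qed.

Lemma integral_p_CI n (t : R) : 0 < t -> (\int[mu]_x (p_CI n x t)%:E = 1)%E.
Proof.
move=> t0; under eq_integral do rewrite -[p_CI _ _ _]mul1r.
rewrite (@integral_mul_p_CI n (cst 1))// -(iter_subord1 n.+1 t0).
apply: eq_iter_subord => // s s0; under eq_integral do rewrite mul1r.
by rewrite integral_cauchy_kernel// normr_gt0 gt_eqF.
Qed.

(** Adding a bound M of [phi] gives a nonnegative [psi], to which Tonelli's theorem applies. The
    integral against [p_CI] is then the iterated mean of the Poisson integral of [psi]; two scaling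
    limits send it to psi 0, and M is removed again because [p_CI] has total mass 1. *)
Lemma p_CI_initially_dirac0 n : initially_dirac0 (@p_CI R n).
Proof.
move=> phi cphi [M' phiM']; pose M : R := M'; have phiM x : `|phi x| <= M := phiM' x.
have mphi : measurable_fun [set: R] phi by exact: continuous_measurable_fun.
have M0 : 0 <= M by apply: le_trans (phiM 0).
pose psi (x : R) : R := phi x + M.
have mpsi : measurable_fun [set: R] psi by exact: measurable_funD.
have psi0 (x : R) : 0 <= psi x.
  by have := phiM x; rewrite ler_norml /psi => /andP[]; lra.
have psiM (x : R) : psi x <= 2 * M.
  by have := phiM x; rewrite ler_norml /psi => /andP[_]; lra.
have npsi (x : R) : `|psi x| <= 2 * M by rewrite ger0_norm.
have iK (s : R) :
    (lebesgue_measure).-integrable [set: R] (fun x => (psi x * cauchy_kernel x `|s|)%:E).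
  apply: (@integrable_mul_bounded _ _ _ _ _ _ _ (2 * M)) => //.
  exact: (integrable_cauchy_kernel s).
(* The mean of [psi] under the Cauchy law at time |s|. At s = 0 it takes the value 0, since the
   kernel vanishes there, but only its right limit matters. *)
pose Psi (s : R) : R := \int[mu]_x (psi x * cauchy_kernel x `|s|).
have PsiE (s : R) : (Psi s)%:E = (\int[mu]_x (psi x * cauchy_kernel x `|s|)%:E)%E.
  by rewrite /Psi /Rintegral fineK//; apply: integrable_fin_num => //; exact: iK.
have bPsi : bounded_mfun Psi.
  split.
    apply: measurableT_comp => //.
    have H := @measurable_fun_fubini_tonelli_F _ _ _ _ R lebesgue_measure
      (fun p : R * R => (psi p.2 * cauchy_kernel p.2 `|p.1|)%:E).
    apply: H; last by move=> p; rewrite lee_fin mulr_ge0 ?cauchy_kernel_ge0.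
    apply/measurable_EFinP; apply: measurable_funM; first exact: measurableT_comp.
    by apply: measurable_cauchy_kernel; mfun.
  exists (2 * M) => s; rewrite ger0_norm; last first.
    by apply: Rintegral_ge0 => x _; rewrite mulr_ge0 ?cauchy_kernel_ge0.
  rewrite -lee_fin PsiE.
  apply: (@le_trans _ _ (\int[mu]_x (2 * M * cauchy_kernel x `|s|)%:E)%E).
    apply: ge0_le_integral => //.
    - by move=> x _; rewrite lee_fin mulr_ge0 ?cauchy_kernel_ge0.
    - by apply/measurable_EFinP; apply: measurable_funM => //; apply: measurable_cauchy_kernel; mfun.
    - by apply/measurable_EFinP; apply: measurable_funM => //; apply: measurable_cauchy_kernel; mfun.
    - by move=> x _; rewrite lee_fin ler_wpM2r// cauchy_kernel_ge0.
  rewrite ge0_integral_mulrEFin//; last 3 first.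
  - by apply: measurable_cauchy_kernel; mfun.
  - by move=> x _; rewrite cauchy_kernel_ge0.
  - by rewrite mulr_ge0.
  have [->|s0] := eqVneq s 0.
    rewrite integral0_eq ?mule0 ?lee_fin ?mulr_ge0// => x _.
    by rewrite /cauchy_kernel normr0 mul0r.
  by rewrite integral_cauchy_kernel ?normr_gt0// mule1.
have Psi0 : Psi s @[s --> 0^'+] --> psi 0.
  have mT : measurable (setT : set (measurableTypeR R)) by exact: measurableT.
  have i1 : (lebesgue_measure).-integrable [set: R] (EFin \o (fun x => cauchy_kernel x 1)).
    by have := integrable_cauchy_kernel (1 : R); rewrite normr1.
  have cpsi (y : R) : psi (s * y) @[s --> 0^'+] --> psi 0.
    apply: cvgD; last exact: cvg_cst.
    apply/cvg_at_rightP => u [u0 uc]; apply: continuous_cvg; first exact: cphi.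
    by rewrite -[X in _ --> X](mul0r y); apply: cvgM => //; exact: cvg_cst.
  have H := @scaled_mean_cvg _ psi (fun x => cauchy_kernel x 1) (2 * M) (psi 0) mT mpsi npsi i1 (fun y _ => cpsi y).
  have K1 : \int[mu]_y cauchy_kernel y 1 = 1 :> R by rewrite /Rintegral integral_cauchy_kernel.
  rewrite K1 mulr1 in H.
  apply/cvg_at_rightP => u [u0 uc].
  rewrite (_ : (fun n => _) = fun n => \int[mu]_y (psi (u n * y) * cauchy_kernel y 1)).
    by have /cvg_at_rightP/(_ u (conj u0 uc)) := H.
  apply/funext => k; rewrite /Psi (Rintegral_scale (u0 k)); last exact: iK.
  rewrite -RintegralZl//; last first.
    rewrite (_ : EFin \o _ = fun x => (psi (u k * x) / u k * cauchy_kernel x 1)%:E).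
      apply: (@integrable_mul_bounded _ _ _ _ _ _ _ (2 * M / u k)) => //.
        by apply: measurable_funM => //; apply: (measurableT_comp mpsi); mfun.
      move=> x _; rewrite normrM normfV (gtr0_norm (u0 k)).
      by rewrite ler_wpM2r// invr_ge0 ltW.
    apply/funext => x /=; rewrite -(cauchy_kernel_scale x (u0 k)) gtr0_norm//; congr EFin.
    by rewrite mulrA divfK// gt_eqF.
  by apply: eq_Rintegral => y _; rewrite gtr0_norm// mulrCA cauchy_kernel_scale.
have intpsi (t : R) : 0 < t -> (\int[mu]_x (psi x * p_CI n x t)%:E = (iter n.+1 rsubord Psi t)%:E)%E.
  move=> t0; rewrite integral_mul_p_CI// (EFin_iter_rsubord n.+1 t bPsi).
  by apply: eq_iter_subord => // s s0; rewrite /= PsiE.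
have int1 (t : R) : 0 < t -> (\int[mu]_x (p_CI n x t)%:E = 1)%E.
  exact: integral_p_CI.
have E (t : R) : 0 < t -> \int[mu]_x (phi x * p_CI n x t) = iter n.+1 rsubord Psi t - M.
  move=> t0.
  have ip : (lebesgue_measure).-integrable [set: R] (fun x => (p_CI n x t)%:E).
    apply/integrableP; split; first by apply/measurable_EFinP; exact: measurable_p_CI.
    under eq_integral do rewrite abse_EFin ger0_norm ?p_CI_ge0//.
    by rewrite int1// ltry.
  transitivity (\int[mu]_x (psi x * p_CI n x t - M * p_CI n x t)).
    by apply: eq_Rintegral => x _; rewrite /psi -mulrBl addrK.
  rewrite RintegralB//; last 2 first.
  - exact: (@integrable_mul_bounded _ _ _ _ _ _ _ (2 * M)).
  - exact: (@integrable_mul_bounded _ _ _ _ _ (cst M) _ `|M|).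
  by rewrite RintegralZl// /Rintegral int1// mulr1 intpsi.
rewrite (_ : phi 0 = psi 0 - M); last by rewrite /psi addrK.
have Psic : iter n.+1 rsubord Psi t - M @[t --> 0^'+] --> psi 0 - M.
  by apply: cvgB; [exact: iter_rsubord_cvg0|exact: cvg_cst].
apply/cvg_at_rightP => u [u0 uc].
rewrite (_ : (fun n => _) = fun k => iter n.+1 rsubord Psi (u k) - M).
  by have /cvg_at_rightP/(_ u (conj u0 uc)) := Psic.
by apply/funext => k; rewrite E.
Qed.

End initial_condition.

(** * Composition with an independent random time *)

Section laws.
Context {R : realType}.
Local Notation mu := lebesgue_measure.

Import HBNNSimple.

(** Carrying an event [D] along lets the same statement express the law of [X] and its independence
    of an event. The proof is the usual passage from indicators through simple functions to monotone
    limits. *)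
Lemma integral_transfer d (T : measurableType d) (m : {measure set T -> \bar R})
    (D : set T) (X : T -> R) (g : R -> R) :
  measurable D -> measurable_fun [set: T] X ->
  measurable_fun [set: R] g -> (forall x, 0 <= g x) ->
  (forall A : set R, measurable A -> m (D `&` X @^-1` A) = \int[mu]_(x in A) (g x)%:E)%E ->
  forall phi : R -> \bar R, measurable_fun [set: R] phi -> (forall x, 0 <= phi x)%E ->
  (\int[m]_(w in D) phi (X w) = \int[mu]_x (phi x * (g x)%:E))%E.
Proof.
move=> mD mX mg g0 mA phi mphi phi0.
have mphi' : measurable_fun [set: measurableTypeR R] phi by [].
pose h := nnsfun_approx measurableT mphi'.
have hc x : (h n x)%:E @[n --> \oo] --> phi x by exact: cvg_nnsfun_approx.
have hnd x : nondecreasing_seq (fun n => (h n x)%:E).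
  by move=> a b ab; rewrite lee_fin; exact/lefP/nd_nnsfun_approx.
have mh n : measurable_fun [set: R] (h n : R -> R) by exact: (measurable_funPT (h n)).
have -> : (\int[m]_(w in D) phi (X w) = limn (fun n => \int[m]_(w in D) (h n (X w))%:E))%E.
  transitivity (\int[m]_(w in D) limn (fun n => (h n (X w))%:E))%E.
    by apply: eq_integral => w _; apply/esym/cvg_lim.
  apply: monotone_convergence => //.
  - by move=> n; apply/measurable_EFinP; apply: measurable_funTS; exact: (measurableT_comp (mh n) mX).
  - by move=> n w _; rewrite lee_fin.
have -> : (\int[mu]_x (phi x * (g x)%:E) = limn (fun n => \int[mu]_x ((h n x)%:E * (g x)%:E)))%E.
  transitivity (\int[mu]_x limn (fun n => (h n x)%:E * (g x)%:E))%E.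
    by apply: eq_integral => x _; apply/esym/cvg_lim => //; exact: cvgeZr.
  apply: monotone_convergence => //.
  - by move=> n; apply: emeasurable_funM; exact/measurable_EFinP.
  - by move=> n x _; rewrite -EFinM lee_fin mulr_ge0.
  - by move=> x _ a b ab; rewrite lee_wpmul2r ?lee_fin//; exact/lefP/nd_nnsfun_approx.
congr (limn _); apply/funext => n.
have mB y : measurable (h n @^-1` [set y] : set R) by rewrite -[X in measurable X]setTI; exact: mh n measurableT _ (measurable_set1 y).
transitivity (\sum_(y \in range (h n)) y%:E * m (D `&` X @^-1` (h n @^-1` [set y])))%E.
  transitivity (\int[m]_(w in D) \sum_(y \in range (h n))
     (y * \1_(h n @^-1` [set y]) (X w))%:E)%E.
    by apply: eq_integral => w _; rewrite fimfunE -fsumEFin.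
  rewrite ge0_integral_fsum//; last 2 first.
  - move=> y; apply/measurable_EFinP; apply: measurable_funTS; apply: measurable_funM => //.
    by apply: measurableT_comp => //.
  - by move=> y w _; exact: nnfun_muleindic_ge0.
  apply: eq_fsbigr => y; rewrite inE => -[z _ <-].
  have mXB : measurable (X @^-1` (h n @^-1` [set h n z])) by rewrite -[X in measurable X]setTI; exact: mX.
  rewrite (eq_integral (fun w => (h n z)%:E * (\1_(X @^-1` (h n @^-1` [set h n z])) w)%:E)%E)//.
  rewrite ge0_integralZl//.
  - by rewrite integral_indic// setIC.
  - by apply/measurable_EFinP; exact: measurable_funTS.
  - by rewrite lee_fin.
apply/esym.
transitivity (\int[mu]_x \sum_(y \in range (h n))
     ((y * \1_(h n @^-1` [set y]) x)%:E * (g x)%:E))%E.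
  apply: eq_integral => w _; rewrite -ge0_mule_fsuml; last by move=> y; exact: nnfun_muleindic_ge0.
  by rewrite fsumEFin// -fimfunE.
rewrite ge0_integral_fsum//; last 2 first.
- move=> y; apply: emeasurable_funM; apply/measurable_EFinP => //; exact: measurable_funM.
- by move=> y w _; rewrite mule_ge0 ?lee_fin//; exact: nnfun_muleindic_ge0.
apply: eq_fsbigr => y; rewrite inE => -[z _ <-].
under eq_integral => x _ do rewrite -EFinM -mulrA (mulrC (\1_ _ x)) !EFinM.
rewrite ge0_integralZl//.
- congr (_ * _)%E; rewrite mA// [RHS]integral_mkcond; apply: eq_integral => x _.
  rewrite patchE indicE; case: ifPn; rewrite ?mule1 ?mule0//.
- by apply: emeasurable_funM; exact/measurable_EFinP.
- by move=> x _; rewrite mule_ge0// lee_fin.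
- by rewrite lee_fin.
Qed.

End laws.

(** * Measures with a density *)

Section density_measure.
Context {R : realType}.
Local Notation mu := lebesgue_measure.
Variables (g : R -> R).
Hypotheses (mg : measurable_fun [set: R] g) (g0 : forall x, 0 <= g x).

(** The two proofs are arguments so that the measure structure, which depends on them, can be
    attached to the term. *)
Definition density_measure of measurable_fun [set: R] g & (forall x, 0 <= g x) :=
  fun A : set (measurableTypeR R) => (\int[mu]_(x in A) (g x)%:E)%E.

Local Notation nu := (density_measure mg g0).

Let nu_set0 : nu set0 = 0%E.
Proof. by rewrite /density_measure integral_set0. Qed.

Let nu_ge0 A : (0 <= nu A)%E.
Proof. by apply: integral_ge0 => x _; rewrite lee_fin. Qed.

Let nu_sigma_additive : semi_sigma_additive nu.
Proof.
move=> /= A mA tA mUA; rewrite /density_measure/= ge0_integral_bigcup//=; last 2 first.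
- by apply/measurable_EFinP; exact: measurable_funTS.
- by move=> x _; rewrite lee_fin.
by apply: is_cvg_ereal_nneg_natsum_cond => n _ _; exact: nu_ge0.
Qed.

HB.instance Definition _ := isMeasure.Build _ _ _ nu nu_set0 nu_ge0 nu_sigma_additive.

(** Open upper rays are stable under intersection and generate the Borel sets, and the rays from -k
    have finite mass and cover the line. *)
Lemma measure_eq_density (m : {measure set (measurableTypeR R) -> \bar R}) :
  (forall a : R, m `]a, +oo[%classic = \int[mu]_(x in `]a, +oo[) (g x)%:E)%E ->
  (forall a : R, m `]a, +oo[%classic < +oo)%E ->
  forall A : set R, measurable A -> m A = (\int[mu]_(x in A) (g x)%:E)%E.
Proof.
move=> mray mfin A mA.
have -> : (\int[mu]_(x in A) (g x)%:E)%E = nu A by [].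
apply: (@g_sigma_algebra_measure_unique _ R (measurableTypeR R) (@RGenOInfty.G R) _
  (fun k => `](- k%:R : R), +oo[%classic)).
- by move=> _ [a ->]; exact: measurable_itv.
- by move=> k; exists (- k%:R).
- rewrite -subTset => x _; exists (Num.truncn `|x|).+1 => //.
  rewrite /= in_itv/= andbT ltrNl; apply: (le_lt_trans (ler_norm _)); rewrite normrN.
  exact: truncnS_gt.
- move=> _ _ [a ->] [b ->]; exists (Num.max a b).
  by apply/seteqP; split => x /=; rewrite !in_itv/= !andbT gt_max => /andP.
- by move=> _ [a ->]; rewrite mray.
- by move=> k; exact: mfin.
- exact: (eq_ind _ (fun F : set (set R) => F A) mA _ (RGenOInfty.measurableE R)).
Qed.

End density_measure.

(** * Continuous test functions for a law *)

Section ramps.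
Context {R : realType}.
Local Notation mu := lebesgue_measure.

(* Continuous approximations from below of the indicator of ]a, +oo[. *)
Definition ramp (n : nat) (a x : R) : R := Num.min 1 (n%:R * Num.max 0 (x - a)).

Lemma ramp_ge0 n a x : 0 <= ramp n a x.
Proof. by rewrite /ramp le_min ler01 mulr_ge0// le_max lexx. Qed.

Lemma ramp_le1 n a x : ramp n a x <= 1.
Proof. by rewrite /ramp ge_min lexx. Qed.

Lemma nondecreasing_ramp a x : nondecreasing_seq (fun n => ramp n a x).
Proof.
move=> m n mn; rewrite /ramp le_min ge_min lexx/=.
by rewrite ge_min ler_wpM2r ?orbT ?le_max ?lexx// ler_nat.
Qed.

Lemma continuous_ramp n a : continuous (ramp n a).
Proof.
move=> x; apply: (@continuous_min _ _ (cst 1) (fun x => n%:R * Num.max 0 (x - a))).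
  exact: cvg_cst.
apply: cvgM; first exact: cvg_cst.
apply: (@continuous_max _ _ (cst 0) (fun x => x - a)); first exact: cvg_cst.
by apply: cvgB; [exact: cvg_id|exact: cvg_cst].
Qed.

Lemma measurable_ramp n a : measurable_fun [set: R] (ramp n a).
Proof. by apply: continuous_measurable_fun; exact: continuous_ramp. Qed.

Lemma near_ramp1 a x : a < x -> \forall n \near \oo, ramp n a x = 1.
Proof.
move=> ax; near=> n; rewrite /ramp; have xa : 0 < x - a by rewrite subr_gt0.
apply/min_idPl; rewrite (max_idPr _) ?(ltW xa)// -ler_pdivrMr// mul1r.
near: n; exact: nbhs_infty_ger.
Unshelve. all: by end_near. Qed.

Lemma ramp0 n a x : x <= a -> ramp n a x = 0.
Proof.
move=> xa; rewrite /ramp (max_idPl _) ?mulr0; last by rewrite subr_le0.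
by apply/min_idPr.
Qed.

(** The weight [f] covers both sides of the comparison in [law_of_ramps]: the constant 1 under [m],
    and the density under Lebesgue measure. *)
Lemma cvg_integral_ramp d (T : measurableType d) (m : {measure set T -> \bar R})
    (D : set T) (Y : T -> R) (f : T -> \bar R) (a : R) :
  measurable D -> measurable_fun [set: T] Y -> measurable_fun [set: T] f -> (forall x, 0 <= f x)%E ->
  (\int[m]_(x in D) ((ramp n a (Y x))%:E * f x) @[n --> \oo] -->
   \int[m]_(x in D `&` Y @^-1` `]a, +oo[) f x)%E.
Proof.
move=> mD mY mf f0.
have mYa : measurable (Y @^-1` `]a, +oo[).
  by rewrite -[X in measurable X]setTI; apply: mY => //; exact: measurable_itv.
have mr n : measurable_fun D (fun x => ((ramp n a (Y x))%:E * f x)%E).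
  apply: emeasurable_funM; last exact: measurable_funTS.
  apply/measurable_EFinP; apply: measurable_funTS; apply: measurableT_comp => //.
  exact: measurable_ramp.
have r0 n x : D x -> (0 <= (ramp n a (Y x))%:E * f x)%E.
  by move=> _; rewrite mule_ge0// lee_fin ramp_ge0.
have nd x : D x -> nondecreasing_seq (fun n => ((ramp n a (Y x))%:E * f x)%E).
  by move=> _ p q pq; rewrite lee_wpmul2r ?lee_fin//; exact: nondecreasing_ramp.
have := cvg_monotone_convergence (mu := m) mD mr r0 nd.
congr (_ --> _); rewrite integral_mkcondr; apply: eq_integral => x _.
apply/cvg_lim => //; rewrite patchE (_ : (x \in _) = (a < Y x)); last first.
  by apply/idP/idP; rewrite inE /= in_itv/= andbT.
case: ifPn => ax.
  apply: cvg_near_cst; near=> n.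
  have -> : ramp n a (Y x) = 1 by near: n; exact: near_ramp1.
  by rewrite mul1e.
rewrite (_ : (fun n => _) = cst 0%E); first exact: cvg_cst.
by apply/funext => n; rewrite ramp0 ?mul0e// leNgt.
Unshelve. all: by end_near. Qed.

(** A random variable obtained as a limit is controlled through continuous test functions only;
    ramps are enough of them to recover the law. *)
Lemma law_of_ramps d (T : measurableType d) (m : {measure set T -> \bar R})
    (E : set T) (Z : {mfun T >-> R}) (g : R -> R) :
  measurable E -> (m E < +oo)%E -> measurable_fun [set: R] g -> (forall x, 0 <= g x) ->
  (forall n a, \int[m]_(w in E) (ramp n a (Z w))%:E =
               \int[mu]_x ((ramp n a x)%:E * (g x)%:E))%E ->
  forall A : set R, measurable A -> m (E `&` Z @^-1` A) = (\int[mu]_(x in A) (g x)%:E)%E.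
Proof.
move=> mE mEoo mg g0 H A mA.
have mZ : measurable_fun [set: T] Z by [].
have mZA (B : set R) : measurable B -> measurable (Z @^-1` B).
  by move=> mB; rewrite -[X in measurable X]setTI; exact: mZ.
have U := @measure_eq_density _ g mg g0 (pushforward (mrestr m mE) (Z : T -> measurableTypeR R)).
rewrite setIC; apply: U mA => a.
- change (m (Z @^-1` `]a, +oo[ `&` E) = \int[mu]_(x in `]a, +oo[) (g x)%:E)%E; rewrite setIC.
  have c1 := cvg_integral_ramp (m := m) (a := a) mE mZ (@measurable_cst _ _ T _ setT 1%E) (fun=> lee01).
  have mg' : measurable_fun [set: measurableTypeR R] (EFin \o g) by exact/measurable_EFinP.
  have c2 := @cvg_integral_ramp _ _ lebesgue_measure [set: measurableTypeR R] id
    (EFin \o g) a measurableT (@measurable_id _ (measurableTypeR R) setT) mg' (fun x => g0 x).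
  rewrite setTI in c2; rewrite integral_cst ?mul1e in c1; last first.
    by apply: measurableI => //; apply: mZA; exact: measurable_itv.
  have e n : (\int[m]_(x in E) ((ramp n a (Z x))%:E * cst 1 x) =
      \int[mu]_x ((ramp n a x)%:E * (EFin \o g) x))%E.
    by rewrite -H; apply: eq_integral => x _; rewrite mule1.
  by rewrite (funext e) in c1; exact: (cvg_unique _ c1 c2).
- change (m (Z @^-1` `]a, +oo[ `&` E) < +oo)%E; apply: le_lt_trans mEoo.
  apply: le_measure; rewrite ?inE//.
  by apply: measurableI => //; apply: mZA; exact: measurable_itv.
Qed.

End ramps.

(** * Rounding a time up to a grid *)

Section grid_time.
Context {R : realType}.

Definition grid_index (m : nat) (z : R) : nat := Num.truncn (m.+1%:R * `|z|).
(** The right end of the cell of index j, hence [j.+1]: a rounded time is positive and strictly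
    larger than |z|. *)
Definition grid_point (m j : nat) : R := j.+1%:R / m.+1%:R.
Definition grid_time (m : nat) (z : R) : R := grid_point m (grid_index m z).

Lemma grid_point_gt0 m j : 0 < grid_point m j.
Proof. by rewrite divr_gt0. Qed.

Lemma grid_time_gt m z : `|z| < grid_time m z.
Proof.
rewrite /grid_time /grid_point ltr_pdivlMr// mulrC.
exact: truncnS_gt.
Qed.

Lemma grid_time_le m z : grid_time m z <= `|z| + m.+1%:R^-1.
Proof.
rewrite /grid_time /grid_point ler_pdivrMr// mulrDl mulVf// -natr1 lerD2r mulrC.
by rewrite truncn_le mulr_ge0.
Qed.

Lemma cvg_grid_time z : grid_time m z @[m --> \oo] --> `|z|.
Proof.
apply: (@squeeze_cvgr _ _ _ _ (cst `|z|) (fun m => `|z| + m.+1%:R^-1)).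
- by apply: nearW => m; rewrite ltW ?grid_time_gt//= grid_time_le.
- exact: cvg_cst.
- rewrite -[X in _ --> X]addr0; apply: cvgD; first exact: cvg_cst.
  exact: cvg_harmonic.
Qed.

Definition grid_cell m j : set R := [set z | grid_index m z = j].

Lemma measurable_grid_cell m j : measurable (grid_cell m j).
Proof.
rewrite (_ : grid_cell m j = (fun z => m.+1%:R * `|z|) @^-1` `[j%:R, j.+1%:R[%classic).
  have mf : measurable_fun [set: R] (fun z : R => m.+1%:R * `|z|) by mfun.
  by rewrite -[X in measurable X]setTI; apply: mf => //; exact: measurable_itv.
apply/seteqP; split => z; rewrite /grid_cell /grid_index /= in_itv/=.
  by move=> <-; apply: truncn_itv; rewrite mulr_ge0.
by move/truncn_def.
Qed.

Lemma trivIset_grid_cell m : trivIset setT (grid_cell m).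
Proof. by move=> i j _ _ [z [<- <-]]. Qed.

Lemma bigcup_grid_cell m : \bigcup_j grid_cell m j = setT.
Proof. by rewrite -subTset => z _; exists (grid_index m z). Qed.

Lemma measurable_grid_time m : measurable_fun [set: R] (grid_time m).
Proof.
rewrite -(bigcup_grid_cell m); apply/measurable_fun_bigcup => [j|j].
  exact: measurable_grid_cell.
apply: (eq_measurable_fun (cst (grid_point m j))); last exact: measurable_cst.
by move=> z; rewrite inE /grid_time => ->.
Qed.

End grid_time.

(** * A process at an independent random time *)

Section time_change.
Context {R : realType} {d : measure_display} {T : measurableType d} (P : probability T R).
Local Notation mu := lebesgue_measure.
Variables (X : R -> {RV P >-> R}) (Z : {RV P >-> R}) (q : R -> R -> R).
Hypotheses (Xrc : {ae P, forall w, forall s, 0 <= s -> X u w @[u --> s^'+] --> X s w})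
  (mq : measurable_fun [set: R * R] (fun p => q p.1 p.2)) (q0 : forall x s, 0 <= q x s)
  (Xlaw : forall s (A : set R), 0 < s -> measurable A ->
     P (X s @^-1` A) = (\int[mu]_(x in A) (q x s)%:E)%E).

(* Grid times exceed the random time, so that right continuity of the paths is enough. *)
Definition grid_value m w := X (grid_time m (Z w)) w.

Lemma measurable_grid_value m : measurable_fun [set: T] (grid_value m).
Proof.
have mZ : measurable_fun [set: T] Z by [].
rewrite (_ : setT = \bigcup_j (Z @^-1` grid_cell m j)); last first.
  by rewrite -preimage_bigcup bigcup_grid_cell preimage_setT.
apply/measurable_fun_bigcup => [j|j].
  by rewrite -[X in measurable X]setTI; apply: mZ => //; exact: measurable_grid_cell.
apply: (eq_measurable_fun (X (grid_point m j))); last by apply: measurable_funTS.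
by move=> w; rewrite inE /grid_value /grid_time /= => ->.
Qed.

Definition mean_kernel (phi : R -> R) (s : R) := (\int[mu]_x ((phi x)%:E * (q x s)%:E))%E.

Lemma measurable_q1 s : measurable_fun [set: R] (q ^~ s).
Proof. exact: (measurableT_comp mq (measurable_pair2 s)). Qed.

Lemma mean_kernel_ge0 phi s : (forall x, 0 <= phi x) -> (0 <= mean_kernel phi s)%E.
Proof. by move=> phi0; apply: integral_ge0 => x _; rewrite mule_ge0// lee_fin. Qed.

Lemma measurable_mean_kernel (phi : R -> R) : measurable_fun [set: R] phi -> (forall x, 0 <= phi x) ->
  measurable_fun [set: R] (mean_kernel phi).
Proof.
move=> mphi phi0.
have H := @measurable_fun_fubini_tonelli_F _ _ _ _ R lebesgue_measure
  (fun p : R * R => (phi p.2)%:E * (q p.2 p.1)%:E)%E.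
apply: H; last by move=> p; rewrite mule_ge0// lee_fin.
apply: emeasurable_funM; apply/measurable_EFinP; first exact: measurableT_comp.
by apply: (measurableT_comp mq (g := fun p => (p.2, p.1))); exact: measurable_fun_pair.
Qed.

Lemma integral_law (phi : R -> R) (s : R) : 0 < s -> measurable_fun [set: R] phi -> (forall x, 0 <= phi x) ->
  (\int[P]_w (phi (X s w))%:E = mean_kernel phi s)%E.
Proof.
move=> s0 mphi phi0.
rewrite (@integral_transfer _ _ _ P setT (X s) (q ^~ s) measurableT _ (measurable_q1 s) _ _ (EFin \o phi))//.
- by move=> A mA; rewrite setTI; exact: Xlaw.
- exact/measurable_EFinP.
Qed.

(** [E] stands for an event of the processes not involved so far. Keeping it makes the law of the
    composed variable and its independence of those processes one and the same computation. *)
Definition time_independent (E : set T) := forall s (A A' : set R), 0 < s -> measurable A -> measurable A' ->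
  (P (E `&` X s @^-1` A `&` Z @^-1` A') = P E * P (X s @^-1` A) * P (Z @^-1` A'))%E.

(** On each cell of the grid the rounded time is a constant, so the process is evaluated at a fixed
    time, where its law and independence are known; the cells are then summed. *)
Lemma integral_grid_value (E : set T) m (phi : R -> R) : measurable E -> time_independent E ->
  measurable_fun [set: R] phi -> (forall x, 0 <= phi x) ->
  (\int[P]_(w in E) (phi (grid_value m w))%:E =
   P E * \int[P]_w mean_kernel phi (grid_time m (Z w)))%E.
Proof.
move=> mE indE mphi phi0.
have mZ : measurable_fun [set: T] Z by [].
pose F j := Z @^-1` grid_cell m j.
have mF j : measurable (F j).
  by rewrite -[X in measurable X]setTI; apply: mZ => //; exact: measurable_grid_cell.
have tF : trivIset setT F.
  by move=> i j _ _ [w [Fi Fj]]; apply: (@trivIset_grid_cell _ m i j) => //; exists (Z w).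
have UF : \bigcup_j F j = setT by rewrite -preimage_bigcup bigcup_grid_cell preimage_setT.
have mK := measurable_mean_kernel mphi phi0.
have mKg : measurable_fun [set: T] (fun w => mean_kernel phi (grid_time m (Z w))).
  by apply: (measurableT_comp mK); apply: measurableT_comp => //; exact: measurable_grid_time.
have -> : (\int[P]_w mean_kernel phi (grid_time m (Z w)) =
    \sum_(j <oo) (mean_kernel phi (grid_point m j) * P (F j)))%E.
  rewrite -[in LHS]UF ge0_integral_bigcup//=.
  - apply: eq_eseriesr => j _.
    rewrite (eq_integral (fun=> mean_kernel phi (grid_point m j))) ?integral_cst//.
    by move=> w; rewrite inE /F /grid_time /= => ->.
  - exact: measurable_funTS.
  - by move=> w _; exact: mean_kernel_ge0.
have PE : P E \is a fin_num by exact: fin_num_measure.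
rewrite -[X in (_ = X * _)%E](fineK PE) -nneseriesZl; last by move=> j _; rewrite mule_ge0// mean_kernel_ge0.
have -> : E = \bigcup_j (E `&` F j) by rewrite -setI_bigcupr UF setIT.
rewrite ge0_integral_bigcup//=.
- rewrite -setI_bigcupr UF setIT; apply: eq_eseriesr => j _.
  rewrite (eq_integral (fun w => (phi (X (grid_point m j) w))%:E)); last first.
    by move=> w; rewrite inE /F => -[_ /=]; rewrite /grid_value /grid_time => ->.
  have PF : P (F j) \is a fin_num by exact: fin_num_measure.
  (* By independence [c] times [q] is the density of the process at the grid point, restricted to
     [E] and to the cell. *)
  pose c := fine (P E) * fine (P (F j)).
  have c0 : 0 <= c by rewrite mulr_ge0// fine_ge0.
  rewrite (@integral_transfer _ _ _ P (E `&` F j) (X (grid_point m j)) (fun x => c * q x (grid_point m j))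
    _ _ _ _ _ (EFin \o phi))//.
  + under eq_integral do rewrite EFinM muleCA.
    rewrite ge0_integralZl//.
    * by rewrite /c EFinM !fineK// -muleA; congr (_ * _)%E; rewrite muleC.
    * by apply: emeasurable_funM; apply/measurable_EFinP => //; exact: measurable_q1.
    * by move=> x _; rewrite mule_ge0// lee_fin.
  + exact: measurableI.
  + by apply: measurable_funM => //; exact: measurable_q1.
  + by move=> x; rewrite mulr_ge0.
  + move=> A mA; rewrite ge0_integral_mulrEFin//; last exact: measurable_funTS (measurable_q1 _).
    transitivity (P (E `&` X (grid_point m j) @^-1` A `&` Z @^-1` grid_cell m j)).
      by rewrite setIAC.
    have gp := @grid_point_gt0 R m j.
    rewrite (indE _ _ _ gp mA (measurable_grid_cell m j)) (Xlaw gp mA).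
    by rewrite /c EFinM !fineK// muleAC.
  + exact/measurable_EFinP.
- by move=> j; exact: measurableI.
- apply/measurable_EFinP; apply: measurable_funTS; apply: measurableT_comp => //.
  exact: measurable_grid_value.
- by move=> w _; rewrite lee_fin.
- by apply: trivIset_setIl.
Qed.

Lemma mean_kernel_le1 (phi : R -> R) (s : R) : 0 < s -> measurable_fun [set: R] phi ->
  (forall x, 0 <= phi x) -> (forall x, phi x <= 1) -> (mean_kernel phi s <= 1)%E.
Proof.
move=> s0 mphi phi0 phi1; rewrite -integral_law//.
apply: (@le_trans _ _ (\int[P]_w cst 1%E w)%E).
  apply: ge0_le_integral => //.
  - by move=> w _; rewrite lee_fin.
  - by apply/measurable_EFinP; exact: measurableT_comp.
  - by move=> w _; rewrite lee_fin.
by rewrite integral_cst//= probability_setT mule1.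
Qed.

(** Right continuity in time is read off the paths of [X] by dominated convergence, so that only
    measurability of [q] is assumed. *)
Lemma mean_kernel_right_cvg (phi : R -> R) (s : R) (u : nat -> R) : 0 < s -> continuous phi ->
  (forall x, 0 <= phi x) -> (forall x, phi x <= 1) ->
  (forall m, s < u m) -> u m @[m --> \oo] --> s ->
  mean_kernel phi (u m) @[m --> \oo] --> mean_kernel phi s.
Proof.
move=> s0 cphi phi0 phi1 us ucvg.
have mphi : measurable_fun [set: R] phi by exact: continuous_measurable_fun.
rewrite -integral_law//.
rewrite (_ : (fun m => _) = fun m => (\int[P]_w (phi (X (u m) w))%:E)%E); last first.
  by apply/funext => m; rewrite integral_law// (lt_trans s0).
have [||||| _ _ H] := @dominated_convergence _ _ _ P setT measurableT
  (fun m w => (phi (X (u m) w))%:E) (fun w => (phi (X s w))%:E) (cst 1%E).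
- by move=> m; apply/measurable_EFinP; exact: measurableT_comp.
- by apply/measurable_EFinP; exact: measurableT_comp.
- apply: filterS Xrc => w /(_ s (ltW s0)) Xw _; apply: cvg_EFin; first exact: nearW.
  apply: continuous_cvg; first exact: cphi.
  by move/cvg_at_rightP : Xw; apply.
- apply/integrableP; split => //; rewrite /= (eq_integral (cst 1%E)); last first.
    by move=> w _; rewrite /= normr1.
  by rewrite integral_cst//= probability_setT mule1 ltry.
- by apply: aeW => w m _; rewrite /= lee_fin ger0_norm.
exact: H.
Qed.

(** The composed map need not be measurable. The upper limit of the grid values always is, and it
    agrees with the composition wherever the path is right continuous. *)
Lemma time_change_rv : exists Z' : {RV P >-> R},
  {ae P, forall w, Z' w = X `|Z w| w} /\
  {ae P, forall w, grid_value m w @[m --> \oo] --> Z' w}.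
Proof.
pose f w := fine (limn_esup (fun m => (grid_value m w)%:E)).
have mf : measurable_fun [set: T] f.
  apply: measurableT_comp => //; apply: measurable_fun_limn_esup => m.
  by apply/measurable_EFinP; exact: measurable_grid_value.
pose mf_mixin := isMeasurableFun.Build _ _ _ _ _ mf.
pose Z' : {mfun T >-> R} := HB.pack f mf_mixin.
have H : {ae P, forall w, grid_value m w @[m --> \oo] --> X `|Z w| w}.
  apply: filterS Xrc => w /(_ `|Z w| (normr_ge0 _)) Xw.
  move/cvg_at_rightP : Xw; apply; split; first by move=> m; exact: grid_time_gt.
  exact: cvg_grid_time.
have E w : grid_value m w @[m --> \oo] --> X `|Z w| w -> Z' w = X `|Z w| w.
  move=> cw.
  have ce : (grid_value m w)%:E @[m --> \oo] --> (X `|Z w| w)%:E.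
    by apply: cvg_EFin => //; exact: nearW.
  rewrite /Z' /= /f is_cvg_limn_esupE; last by apply/cvg_ex; exists (X `|Z w| w)%:E.
  by rewrite (cvg_lim _ ce).
exists Z'; split; apply: filterS H => w cw; first exact: E.
by rewrite E.
Qed.

Section independent_time.
Variables (k : nat) (t : R) (f : R -> R).
Hypotheses (t0 : 0 < t)
  (Zlaw : forall psi : R -> \bar R, measurable_fun [set: R] psi -> (forall s, 0 <= psi s)%E ->
     (\int[P]_w psi (`|Z w|)%R = iter k subord psi t)%E)
  (mf : measurable_fun [set: R] f) (f0 : forall x, 0 <= f x)
  (fE : forall x, x != 0 -> (f x)%:E = iter k subord (fun s => (q x s)%:E) t).

(** Iterated subordination from a positive time sees only positive arguments, so the indicator of 0
    has mean 0. Positivity matters because the law of [X s] is given for s > 0 only. *)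
Lemma norm_time_gt0 : {ae P, forall w, 0 < `|Z w|}.
Proof.
have mZ : measurable_fun [set: T] Z by [].
have m0 : measurable (Z @^-1` [set 0]) by rewrite -[X in measurable X]setTI; exact: mZ.
exists (Z @^-1` [set 0]); split => //.
  have m1 : measurable_fun [set: R] (fun s : R => (\1_([set (0 : R)] : set R) s : R)%:E).
    by apply/measurable_EFinP; exact: measurable_indic.
  have := Zlaw m1 (fun s => _); rewrite (_ : (\int[P]_w _)%E = P (Z @^-1` [set 0])); last first.
    rewrite -[Z @^-1` _](setIT) -integral_indic//; apply: eq_integral => w _.
    rewrite !indicE (_ : (`|Z w| \in [set 0]) = (w \in Z @^-1` [set 0]))//.
    by apply/idP/idP; rewrite !inE /=; [exact: normr0_eq0|move=> ->; rewrite normr0].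
  move=> ->; last by move=> s; rewrite lee_fin.
  rewrite (@eq_iter_subord _ k _ (fun s => 0%:E * cst 1 s)%E)//.
    by rewrite iter_subordZ// mul0e.
  move=> s s0; rewrite indicE memNset//= ?mul0e// => s00.
  by rewrite s00 ltxx in s0.
by move=> w /= /negP; rewrite normr_gt0 negbK => /eqP.
Qed.

Lemma integral_mean_kernel (phi : R -> R) : measurable_fun [set: R] phi -> (forall x, 0 <= phi x) ->
  (\int[P]_w mean_kernel phi `|Z w| = \int[mu]_x ((phi x)%:E * (f x)%:E))%E.
Proof.
move=> mphi phi0; rewrite Zlaw; last 2 first.
- exact: measurable_mean_kernel.
- by move=> s; exact: mean_kernel_ge0.
rewrite /mean_kernel -(@iter_subord_swap _ k (fun p => (phi p.1)%:E * (q p.1 p.2)%:E)%E)//; last 2 first.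
- by apply: emeasurable_funM; apply/measurable_EFinP => //; exact: measurableT_comp.
- by move=> p; rewrite mule_ge0// lee_fin.
apply: ae_eq_integral => //.
- apply: (measurableT_comp (@measurable_iter_subord2 _ k
    (fun p => (phi p.1)%:E * (q p.1 p.2)%:E)%E _ _) (measurable_pair2 t)).
    by apply: emeasurable_funM; apply/measurable_EFinP => //; exact: measurableT_comp.
  by move=> p; rewrite mule_ge0// lee_fin.
- by apply: emeasurable_funM; exact/measurable_EFinP.
- exists [set 0]; split=> //; first exact: lebesgue_measure_set1.
  move=> x /= /not_implyP[_ E]; apply: contrapT => /eqP x0; apply: E.
  rewrite fE// iter_subordZ ?lee_fin//.
  + by apply/measurable_EFinP; exact: (measurableT_comp mq (measurable_pair1 x)).
  + by move=> s; rewrite lee_fin.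
Qed.

(** The limit of [integral_grid_value] as the grid is refined: by convergence of the grid values on
    one side, by right continuity of the mean in time on the other. *)
Lemma integral_time_change (Z' : {RV P >-> R}) (E : set T) (phi : R -> R) :
  {ae P, forall w, grid_value m w @[m --> \oo] --> Z' w} ->
  measurable E -> time_independent E -> continuous phi ->
  (forall x, 0 <= phi x) -> (forall x, phi x <= 1) ->
  (\int[P]_(w in E) (phi (Z' w))%:E = P E * \int[mu]_x ((phi x)%:E * (f x)%:E))%E.
Proof.
move=> gc mE indE cphi phi0 phi1.
have mphi : measurable_fun [set: R] phi by exact: continuous_measurable_fun.
have mK := measurable_mean_kernel mphi phi0.
have i1 D : measurable D -> P.-integrable D (cst 1%E).
  move=> mD; apply/integrableP; split => //; rewrite (eq_integral (cst 1%E)); last first.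
    by move=> w _; rewrite /= normr1.
  by rewrite integral_cst// mul1e (le_lt_trans (probability_le1 P mD))// ltry.
have mZ : measurable_fun [set: T] Z by [].
have c1 : (\int[P]_(w in E) (phi (grid_value m w))%:E @[m --> \oo] -->
    \int[P]_(w in E) (phi (Z' w))%:E)%E.
  have [||||| _ _ H] := @dominated_convergence _ _ _ P E mE
    (fun m w => (phi (grid_value m w))%:E) (fun w => (phi (Z' w))%:E) (cst 1%E).
  - move=> m; apply/measurable_EFinP; apply: measurable_funTS; apply: measurableT_comp => //.
    exact: measurable_grid_value.
  - by apply/measurable_EFinP; apply: measurable_funTS; exact: measurableT_comp.
  - apply: filterS gc => w gw _; apply: cvg_EFin; first exact: nearW.
    by apply: continuous_cvg => //; exact: cphi.
  - exact: i1.
  - by apply: aeW => w m _; rewrite /= lee_fin ger0_norm.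
  exact: H.
have c2 : (\int[P]_w mean_kernel phi (grid_time m (Z w)) @[m --> \oo] -->
    \int[P]_w mean_kernel phi `|Z w|)%E.
  have [||||| _ _ H] := @dominated_convergence _ _ _ P setT measurableT
    (fun m w => mean_kernel phi (grid_time m (Z w))) (fun w => mean_kernel phi `|Z w|) (cst 1%E).
  - move=> m; apply: (measurableT_comp mK); apply: measurableT_comp => //.
    exact: measurable_grid_time.
  - by apply: (measurableT_comp mK); exact: measurableT_comp.
  - apply: filterS norm_time_gt0 => w Zw0 _; apply: mean_kernel_right_cvg => //.
    + by move=> m; exact: grid_time_gt.
    + exact: cvg_grid_time.
  - exact: i1.
  - apply: aeW => w m _; rewrite gee0_abs ?mean_kernel_ge0// mean_kernel_le1//.
    exact: grid_point_gt0.
  exact: H.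
have c3 : (\int[P]_(w in E) (phi (grid_value m w))%:E @[m --> \oo] -->
    P E * \int[P]_w mean_kernel phi `|Z w|)%E.
  have e m : (\int[P]_(w in E) (phi (grid_value m w))%:E =
      P E * \int[P]_w mean_kernel phi (grid_time m (Z w)))%E by rewrite integral_grid_value.
  by rewrite (funext e); apply: cvgeZl => //; exact: fin_num_measure.
by rewrite -integral_mean_kernel//; exact: (cvg_unique _ c1 c3).
Qed.

Lemma law_time_change (Z' : {RV P >-> R}) (E : set T) :
  {ae P, forall w, grid_value m w @[m --> \oo] --> Z' w} ->
  measurable E -> time_independent E ->
  forall A : set R, measurable A ->
    (P (E `&` Z' @^-1` A) = P E * \int[mu]_(x in A) (f x)%:E)%E.
Proof.
move=> gc mE indE A mA.
have PE : P E \is a fin_num by exact: fin_num_measure.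
have c0 : 0 <= fine (P E) by rewrite fine_ge0.
rewrite (@law_of_ramps _ _ _ P E Z' (fun x => fine (P E) * f x))//.
- rewrite ge0_integral_mulrEFin// ?fineK//.
  exact: measurable_funTS.
- by rewrite (le_lt_trans (probability_le1 P mE))// ltry.
- exact: measurable_funM.
- by move=> x; rewrite mulr_ge0.
- move=> n a; rewrite (integral_time_change gc)//.
  + rewrite -[P E]fineK// -ge0_integralZl//.
    * by apply: eq_integral => x _; rewrite EFinM muleCA.
    * by apply: emeasurable_funM; apply/measurable_EFinP => //; exact: measurable_ramp.
    * by move=> x _; rewrite mule_ge0 ?lee_fin ?ramp_ge0.
  + exact: continuous_ramp.
  + exact: ramp_ge0.
  + exact: ramp_le1.
Qed.

End independent_time.

End time_change.

(** * The density of iterated Brownian motion *)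

Section heat_law.
Context {R : realType}.
Local Notation mu := lebesgue_measure.

Lemma integral_norm (g : R -> \bar R) : measurable_fun [set: R] g -> (forall x, 0 <= g x)%E ->
  (\int[mu]_x g `|x|%R = \int[mu]_(x in `]0%R, +oo[) g x + \int[mu]_(x in `]0%R, +oo[) g x)%E.
Proof.
move=> mg g0.
have mgn : measurable_fun [set: R] (fun x : R => g `|x|) by apply: (measurableT_comp mg); mfun.
have -> : [set: measurableTypeR R] = `]-oo, 0%R]%classic `|` `]0%R, +oo[%classic.
  apply/esym; rewrite -subTset => x _ /=; rewrite !in_itv/= andbT.
  by case: (leP x 0); [left|right].
rewrite ge0_integral_setU//=; last 2 first.
- exact: measurable_funTS.
- apply/disj_setPS => x /=; rewrite !in_itv/= andbT => -[x0 /lt_le_trans/(_ x0)].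
  by rewrite ltxx.
congr (_ + _)%E; last by apply: eq_integral => x; rewrite inE itv0yE => x0; rewrite gtr0_norm.
transitivity (\int[mu]_(r in `]-oo, 0%R]) (fun x : R => g `|x|%R) (- r)%R)%E.
  by apply: eq_integral => r _; rewrite normrN.
rewrite -(ge0_integration_by_substitution0 (f := fun x => g `|x|%R))// -integral_itv_obnd_cbnd; last exact: measurable_funTS.
by apply: eq_integral => x; rewrite inE itv0yE => x0; rewrite gtr0_norm.
Qed.

Lemma subord_norm (psi : R -> \bar R) (s : R) : measurable_fun [set: R] psi ->
  (forall x, 0 <= psi x)%E ->
  (\int[mu]_x (psi `|x|%R * (heat_kernel x s)%:E) = subord psi s)%E.
Proof.
move=> mpsi psi0.
transitivity (\int[mu]_x (fun y : R => psi y * (heat_kernel y s)%:E) `|x|%R)%E.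
  by apply: eq_integral => x _; rewrite /heat_kernel real_normK ?num_real.
have m1 : measurable_fun [set: R] (fun y : R => (psi y * (heat_kernel y s)%:E)%E).
  by apply: emeasurable_funM => //; apply/measurable_EFinP; mfunh.
rewrite (integral_norm m1); last by move=> y; rewrite mule_ge0// lee_fin heat_kernel_ge0.
rewrite !integral_itv0y_if -ge0_integralD//; last 4 first.
- by move=> y _; case: ifP => // _; rewrite mule_ge0// lee_fin heat_kernel_ge0.
- by apply: measurable_fun_ifT => //; mfun.
- by move=> y _; case: ifP => // _; rewrite mule_ge0// lee_fin heat_kernel_ge0.
- by apply: measurable_fun_ifT => //; mfun.
apply: eq_integral => y _; rewrite /absheat; case: ifPn => _; last by rewrite mule0 adde0.
by rewrite mulr_natl mulr2n EFinD ge0_muleDr ?lee_fin ?heat_kernel_ge0.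
Qed.

(* The density of the (k+1)-fold iterated Brownian motion. *)
Definition iterated_heat (k : nat) (t x : R) : R :=
  fine (iter k subord (fun s => (heat_kernel x s)%:E) t).

Lemma iterated_heatE k (t x : R) : 0 < t ->
  (iterated_heat k t x)%:E = iter k subord (fun s => (heat_kernel x s)%:E) t.
Proof.
move=> t0; rewrite /iterated_heat fineK// ge0_fin_numE; last first.
  by apply: iter_subord_ge0 => s; rewrite lee_fin heat_kernel_ge0.
apply: (@le_lt_trans _ _ (iter k subord (fun s => (heat_kernel 0 s)%:E) t)).
  apply: le_iter_subord.
  - by apply/measurable_EFinP; mfunh.
  - by apply/measurable_EFinP; mfunh.
  - by move=> s; rewrite lee_fin heat_kernel_ge0.
  - by move=> s; rewrite lee_fin heat_kernel_le_center.
by rewrite iter_subord_heat_kernel0// ltry.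
Qed.

Lemma measurable_iterated_heat k (t : R) : measurable_fun [set: R] (iterated_heat k t).
Proof.
apply: measurableT_comp => //.
apply: (measurableT_comp (@measurable_iter_subord2 _ k
  (fun p => (heat_kernel p.1 p.2)%:E) _ _) (measurable_pair2 t)).
  by apply/measurable_EFinP; mfunh.
by move=> p; rewrite lee_fin heat_kernel_ge0.
Qed.

Lemma iterated_heat_ge0 k (t x : R) : 0 <= iterated_heat k t x.
Proof.
by rewrite fine_ge0//; apply: iter_subord_ge0 => s; rewrite lee_fin heat_kernel_ge0.
Qed.

Lemma integral_iterated_heat k (t : R) (psi : R -> \bar R) : 0 < t -> measurable_fun [set: R] psi ->
  (forall x, 0 <= psi x)%E ->
  (\int[mu]_x (psi `|x|%R * (iterated_heat k t x)%:E) = iter k.+1 subord psi t)%E.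
Proof.
move=> t0 mpsi psi0; rewrite iterSr.
have mn : measurable_fun [set: R * R] (fun p : R * R => psi `|p.1|%R).
  by apply: (measurableT_comp mpsi); mfun.
rewrite (@eq_iter_subord _ k _ (fun s => \int[mu]_x (psi `|x|%R * (heat_kernel x s)%:E))%E)//; last first.
  by move=> s s0; rewrite subord_norm.
rewrite -(@iter_subord_swap _ k (fun p => psi `|p.1|%R * (heat_kernel p.1 p.2)%:E)%E)//; last 2 first.
- by apply: emeasurable_funM => //; apply/measurable_EFinP; mfunh.
- by move=> p; rewrite mule_ge0// lee_fin heat_kernel_ge0.
apply: eq_integral => x _; rewrite iterated_heatE//.
rewrite -iter_subordZ//.
- by apply/measurable_EFinP; mfunh.
- by move=> s; rewrite lee_fin heat_kernel_ge0.
Qed.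

End heat_law.

(** * Laws and sigma-algebras of processes *)

Section process_laws.
Context {R : realType} {d : measure_display} {T : measurableType d} (P : probability T R).
Local Notation mu := lebesgue_measure.

Lemma ae_eq_preimage (Y Z : {RV P >-> R}) (A : set R) : {ae P, forall w, Y w = Z w} ->
  measurable A -> P (Y @^-1` A) = P (Z @^-1` A).
Proof.
move=> YZ mA.
have mX (X : {RV P >-> R}) : measurable (X @^-1` A).
  by rewrite -[X in measurable X]setTI; apply: (_ : measurable_fun _ X).
rewrite -[Y @^-1` A]setIT -[Z @^-1` A]setIT -!integral_indic//.
apply: ae_eq_integral => //; [by apply/measurable_EFinP; exact: measurable_indic..|].
apply: filterS YZ => w YZw _; rewrite !indicE.
by rewrite (_ : (w \in Y @^-1` A) = (w \in Z @^-1` A))//; apply/idP/idP; rewrite !inE /= YZw.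
Qed.

Lemma process_law (X : R -> {RV P >-> R}) (q : R -> R -> R) :
  {ae P, forall w, X 0 w = 0} ->
  (forall s t, 0 <= s -> s < t -> has_density P (fun w => X t w - X s w) (fun x => q x (t - s))) ->
  forall s (A : set R), 0 < s -> measurable A ->
    (P (X s @^-1` A) = \int[mu]_(x in A) (q x s)%:E)%E.
Proof.
move=> X0 Xd s A s0 mA; have [_ _ [Y XY Yd]] := Xd 0 s (lexx 0) s0.
have := Yd A mA; rewrite subr0 => <-; apply: ae_eq_preimage mA.
by apply: filterS2 X0 XY => w X0w <-; rewrite X0w subr0.
Qed.

Lemma brownian_right_continuous (X : R -> {RV P >-> R}) : is_brownian X ->
  {ae P, forall w, forall s, 0 <= s -> X u w @[u --> s^'+] --> X s w}.
Proof.
case=> _ _ _; apply: filterS => w /continuous_within_itvcyP[c0 c] s.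
rewrite le_eqVlt => /predU1P[<-//|s0].
by apply: cvg_at_right_filter; apply: c0; rewrite in_itv/= s0.
Qed.

Lemma process_sigma_measurable (X : R -> {RV P >-> R}) : process_sigma X `<=` measurable.
Proof.
apply: smallest_sub; first exact: sigma_algebra_measurable.
move=> _ [t _ [A mA ->]]; rewrite -[X in measurable X]setTI.
by apply: (_ : measurable_fun _ (X t)).
Qed.

Lemma process_sigma_preimage (X : R -> {RV P >-> R}) (s : R) (A : set R) : 0 <= s -> measurable A ->
  process_sigma X (X s @^-1` A).
Proof. by move=> s0 mA; apply: sub_sigma_algebra; exists s => //; exists A. Qed.

Lemma process_sigmaT (X : R -> {RV P >-> R}) : process_sigma X setT.
Proof.
rewrite -(preimage_setT (X 0)); apply: process_sigma_preimage => //.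
Qed.

End process_laws.

(** * Independence of the processes not yet used *)

Section composition.
Context {R : realType} {d : measure_display} {T : measurableType d} (P : probability T R).
Local Notation mu := lebesgue_measure.
Variables (I : finType) (X : I -> R -> {RV P >-> R}).
Hypothesis Xind : independent_processes X.

(** The events of the processes listed in [s] are trivial, so [Z], built from these processes, is
    independent of all the others. *)
Definition independent_of (s : seq I) (Z : {RV P >-> R}) :=
  forall E : I -> set T, (forall i, process_sigma (X i) (E i)) -> {in s, forall i, E i = setT} ->
  forall A : set R, measurable A ->
    (P (\bigcap_i E i `&` Z @^-1` A) = P (\bigcap_i E i) * P (Z @^-1` A))%E.

Lemma measurable_bigcap_sigma (E : I -> set T) : (forall i, process_sigma (X i) (E i)) ->
  measurable (\bigcap_i E i).
Proof.
move=> sE; apply: fin_bigcap_measurable => // i _.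
exact: process_sigma_measurable (sE i).
Qed.

Lemma independent_time (s : seq I) (Z : {RV P >-> R}) (i : I) (E : I -> set T) :
  independent_of s Z -> i \notin s ->
  (forall i, process_sigma (X i) (E i)) -> {in i :: s, forall i, E i = setT} ->
  time_independent (X i) Z (\bigcap_i E i).
Proof.
move=> Zind si sE Es u A A' u0 mA mA'.
(* The slot i of [E] is trivial, so the event on [X i] can be placed there, and joint independence
   evaluates the enlarged product. *)
pose E' j := if j == i then X i u @^-1` A else E j.
have sE' j : process_sigma (X j) (E' j).
  by rewrite /E'; case: eqP => [->|_//]; apply: process_sigma_preimage => //; exact: ltW.
have Ei : E i = setT by apply: Es; rewrite mem_head.
have E'E : \bigcap_i E' i = \bigcap_i E i `&` X i u @^-1` A.
  apply/seteqP; split => w.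
    move=> E'w; split; last by have := E'w i Logic.I; rewrite /E' eqxx.
    move=> j _; have := E'w j Logic.I; rewrite /E'; case: eqP => [->|//].
    by rewrite Ei.
  by move=> [Ew Xw] j _; rewrite /E'; case: eqP => // _; exact: Ew.
have fE (F : I -> set T) : (forall i, process_sigma (X i) (F i)) ->
    P (\bigcap_i F i) = (\prod_i fine (P (F i)))%:E.
  move=> sF; rewrite -(Xind sF) fineK//; apply: fin_num_measure.
  exact: measurable_bigcap_sigma.
rewrite -E'E Zind//; last first.
  move=> j js; rewrite /E'; case: eqP => [ji|_]; first by rewrite -ji js in si.
  by apply: Es; rewrite inE js orbT.
congr (_ * _)%E; rewrite !fE//.
rewrite (bigD1 i)//= [in RHS](bigD1 i)//= Ei probability_setT/= mul1r.
have -> : E' i = X i u @^-1` A by rewrite /E' eqxx.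
rewrite (eq_bigr (fun j => fine (P (E j)))); last by move=> j /negPf ji; rewrite /E' ji.
have PX : P (X i u @^-1` A) \is a fin_num.
  apply: fin_num_measure; apply: (@process_sigma_measurable _ _ _ P (X i)).
  exact: process_sigma_preimage (ltW u0) mA.
by rewrite EFinM (fineK PX) muleC.
Qed.

End composition.

(** * Induction along the composition *)

Section iterated_processes.
Context {R : realType} {d : measure_display} {T : measurableType d} (P : probability T R).
Local Notation mu := lebesgue_measure.
Variables (n : nat) (B : 'I_n.+1 -> R -> {RV P >-> R}) (C : R -> {RV P >-> R}).
Hypotheses (B_brownian : forall i, is_brownian (B i)) (C_cauchy : is_cauchy_process C).
Let X (i : option 'I_n.+1) := if i is Some j then B j else C.
Hypothesis BC_indep : independent_processes X.

Lemma time_independent_setT (s : seq (option 'I_n.+1)) (Z : {RV P >-> R}) i :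
  independent_of X s Z -> i \notin s -> time_independent (X i) Z setT.
Proof.
move=> Zind si; have := independent_time BC_indep Zind si 
  (E := fun=> setT) (fun i => @process_sigmaT _ _ _ P (X i)) (fun i _ => erefl).
by rewrite bigcapT.
Qed.

Lemma iterated_brownian_law (t : R) (s : seq 'I_n.+1) : 0 < t -> uniq s ->
  exists Z : {RV P >-> R},
    [/\ {ae P, forall w, Z w = foldr (fun i r => B i `|r| w) t s},
        (forall psi : R -> \bar R, measurable_fun [set: R] psi -> (forall s, 0 <= psi s)%E ->
           (\int[P]_w psi (`|Z w|)%R = iter (size s) subord psi t)%E) &
        independent_of X (map Some s) Z].
Proof.
move=> t0; elim: s => [_|i s ih] /=.
  have mt : measurable_fun [set: T] (cst t) by [].
  pose mt_mixin := isMeasurableFun.Build _ _ _ _ _ mt.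
  pose Z : {mfun T >-> R} := HB.pack (cst t : T -> R) mt_mixin.
  exists Z; split.
  - by apply: aeW.
  - move=> psi mpsi psi0 /=; rewrite (eq_integral (cst (psi t))); last first.
      by move=> w _ /=; rewrite gtr0_norm.
    by rewrite integral_cst//= probability_setT mule1.
  - move=> E sE _ A mA; rewrite /= preimage_cst; case: ifPn => _.
      by rewrite setIT probability_setT mule1.
    by rewrite setI0 measure0 mule0.
move=> /andP[si us]; have [Z [ZE Zlaw Zind]] := ih us.
have [B0 Binc Bd Bc] := B_brownian i.
have Xrc := brownian_right_continuous (B_brownian i).
have Xlaw := process_law B0 Bd.
have mq : measurable_fun [set: R * R] (fun p : R * R => heat_kernel p.1 p.2) by mfunh.
have [Z' [Z'E Z'c]] := time_change_rv Z Xrc.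
have sS : Some i \notin map Some s by rewrite (mem_map (@Some_inj _)).
have L E := @law_time_change _ _ _ P (B i) Z heat_kernel Xrc mq (@heat_kernel_ge0 R) Xlaw (size s) t
  (iterated_heat (size s) t) t0 Zlaw (measurable_iterated_heat _ t) (iterated_heat_ge0 _ t)
  (fun x _ => iterated_heatE _ x t0) Z' E Z'c.
(* The case of the sure event is the law itself; comparing it with the case of a general event gives
   independence. *)
have LT (A : set R) : measurable A -> P (Z' @^-1` A) = (\int[mu]_(x in A) (iterated_heat (size s) t x)%:E)%E.
  move=> mA; have := L setT measurableT (time_independent_setT Zind sS) A mA.
  by rewrite setTI probability_setT mul1e.
exists Z'; split.
- by apply: filterS2 ZE Z'E => w <- ->.
- move=> psi mpsi psi0; rewrite -iterS -integral_iterated_heat//.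
  apply: (@integral_transfer _ _ _ P setT Z' (iterated_heat (size s) t) measurableT _
    (measurable_iterated_heat _ t) (iterated_heat_ge0 _ t) _ (fun x => psi `|x|)) => //.
  + by move=> A mA; rewrite setTI; exact: LT.
  + by apply: (measurableT_comp mpsi); mfun.
- move=> E sE Es A mA.
  have mE := measurable_bigcap_sigma sE.
  by rewrite (L _ mE (independent_time BC_indep Zind sS sE Es) A mA) LT.
Qed.

Lemma has_density_cauchy_iterated (t : R) : 0 < t ->
  has_density P (fun w => C `|iterated_brownian B t w| w) (p_CI n ^~ t).
Proof.
move=> t0; have [Z [ZE Zlaw Zind]] := iterated_brownian_law t0 (enum_uniq 'I_n.+1).
have [C0 Cinc Cd Cc] := C_cauchy.
have Xrc : {ae P, forall w, forall s, 0 <= s -> C u w @[u --> s^'+] --> C s w}.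
  by apply: filterS Cc => w [].
(* The time is taken in absolute value so that the kernel is nonnegative for every real s. *)
have Xlaw s (A : set R) : 0 < s -> measurable A ->
    (P (C s @^-1` A) = \int[mu]_(x in A) (cauchy_kernel x `|s|)%:E)%E.
  by move=> s0 mA; rewrite (process_law C0 Cd s0 mA) gtr0_norm.
have mq : measurable_fun [set: R * R] (fun p : R * R => cauchy_kernel p.1 `|p.2|).
  by apply: measurable_cauchy_kernel; mfun.
have [Z' [Z'E Z'c]] := time_change_rv Z Xrc.
split; [exact: measurable_p_CI|by move=> x; exact: p_CI_ge0|].
exists Z'.
  by apply: filterS2 ZE Z'E => w; rewrite /iterated_brownian => <- ->.
move=> A mA.
have sS : None \notin map Some (enum 'I_n.+1) by apply/mapP => -[].
have q0 (x s : R) : 0 <= cauchy_kernel x `|s| by rewrite cauchy_kernel_ge0.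
have fE (x : R) : x != 0 -> (p_CI n x t)%:E =
    iter (size (enum 'I_n.+1)) subord (fun s => (cauchy_kernel x `|s|)%:E) t.
  move=> x0; have [b _ _ _ _] := bounded_cauchy x0.
  by rewrite p_CI_rsubord// size_enum_ord (EFin_iter_rsubord n.+1 t b).
have := @law_time_change _ _ _ P C Z (fun x s => cauchy_kernel x `|s|) Xrc mq q0 Xlaw (size (enum 'I_n.+1)) t
  (p_CI n ^~ t) t0 Zlaw (measurable_p_CI n t0) (fun x => p_CI_ge0 n x t0) fE Z' setT Z'c measurableT
  (time_independent_setT (i := None) Zind sS) A mA.
by rewrite setTI probability_setT mul1e.
Qed.

End iterated_processes.

Theorem theorem3p4 (R : realType) (d : measure_display) (T : measurableType d)
    (P : probability T R) (n : nat) (n_ge1 : (1 <= n)%N)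
    (B : 'I_n.+1 -> R -> {RV P >-> R}) (C : R -> {RV P >-> R})
    (B_brownian : forall i, is_brownian (B i))
    (C_cauchy : is_cauchy_process C)
    (BC_indep : independent_processes
                  (fun i : option 'I_n.+1 => if i is Some j then B j else C)) :
  let nu : R := 1 / 2 ^+ n in
  let p : R -> R -> R := p_CI n in
  [/\ (forall t : R, 0 < t ->
         has_density P (fun w => C `|iterated_brownian B t w| w)
                     (fun x => p x t)),
      (forall x t : R, x != 0 -> 0 < t ->
         [/\ caputo_exists nu p x t,
             (forall y : R, y != 0 -> derivable (fun y => p y t) y 1),
             derivable (derive1 (fun y => p y t)) x 1 &
             caputo nu p x t =
               - 2 `^ (nu - 2) * derive1n 2 (fun y => p y t) x
               + 2 `^ (n%:R - 1 + 1 / 2 ^+ n.+1) / pi `^ (3 / 2)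
                 * (Gamma (- (1 / 2)) / Gamma (- (1 / 2 ^+ n.+1)))
                 * (t `^ (- (1 / 2 ^+ n.+1)) / x ^+ 2)]) &
      initially_dirac0 p].
Proof.
move=> nu p; split.
- by move=> t t0; exact: (has_density_cauchy_iterated B_brownian C_cauchy BC_indep t0).
- by move=> x t x0 t0; exact: caputo_p_CI_equation.
- exact: p_CI_initially_dirac0.
Qed.
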